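(* Suppose Assumptions 1 and 2 (stated in the context) hold and $\bar F(x)=x^{-\alpha}L(x)$ is regularly varying with $\alpha\in(1,1.5]$. Then there exists a selection of $p=(p_k:k\ge1)$ (depending on $b$) such that the family of unbiased estimators $(Z(b):b>0)$ of $\mathbb{P}\{\tau_b<\infty\}$ satisfies both $$\limsup_{b\to\infty}\frac{\mathbb{E}^Q[Z^{1+\gamma}(b)]}{\mathbb{P}\{\tau_b<\infty\}^{1+\gamma}}<\infty\quad\text{for all }\gamma\in\Big(0,\frac{\alpha-1}{2-\alpha}\Big),$$ and $$\mathbb{E}^Q[\nu_b]\le Cb\quad\text{for some constant } C \text{ and all sufficiently large } b.$$ In particular, for the selection $$p_k=\frac{\bar G^{(\beta)}_I(b+n_{k-1}\mu)-\bar G^{(\beta)}_I(b+n_k\mu)}{\bar G^{(\beta)}_I(b)},\qquad k\ge1,$$ given $\gamma\in\big(0,\frac{\alpha-1}{2-\alpha}\big)$, if $\beta$ is chosen in $(2,\alpha+\gamma^{-1}(\alpha-1))$, then both $$\limsup_{b\to\infty}\frac{\mathbb{E}^Q[Z^{1+\gamma}(b)]}{\mathbb{P}\{\tau_b<\infty\}^{1+\gamma}}<\infty\quad\text{(for this }\gamma)$$ and $$\mathbb{E}^Q[\nu_b]\le Cb\quad\text{for some constant } C \text{ and all sufficiently large } b$$ are satisfied.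
   Context: $X,X_1,X_2,\dots$ are i.i.d. real random variables with distribution function $F$, $\mathbb{E}X=0$, under a probability measure $\mathbb{P}$; $S_0=0$, $S_n=X_1+\dots+X_n$. Fix $\mu>0$ and an integer $r>1$. For $b>0$, $\tau_b:=\inf\{n\ge0: S_n-n\mu>b\}$. $n_0=0$, $n_k=r^k$ for $k\ge1$. Assumption 1: $\bar F(x):=\mathbb{P}\{X>x\}=x^{-\alpha}L(x)$ for some $\alpha>1$ and some slowly varying $L$ (i.e. $L(tx)/L(x)\to1$ as $x\to\infty$ for every $t>0$). Further, if $\mathrm{Var}[X]=\infty$, then $\limsup_{x\to\infty}\mathbb{P}\{X<-x\}/\mathbb{P}\{X>x\}<\infty$. Assumption 2: there is $t_0>0$ such that $L$ is continuously differentiable on $[t_0,\infty)$, and $L'(x)=o(L(x)/x)$ as $x\nearrow\infty$. For $\beta>2$: $\bar G^{(\beta)}(x):=\bar F(x)/x^{\beta-\alpha}$ and $\bar G^{(\beta)}_I(x):=\int_x^\infty\bar G^{(\beta)}(u)\,du$. Also $q_k(b):=\sum_{i=n_{k-1}+1}^{n_k}\bar F(b+i\mu)$. Events: $A_k=\bigcup_{i=n_{k-1}+1}^{n_k}\{X_i>b+i\mu\}$, $B_k=\bigcap_{i=1}^{n_k}\{X_i<b+n_{k-1}\mu\}$; bars denote complements. Measure $\mathbb{P}_{k,1}$: choose $J\in\{n_{k-1}+1,\dots,n_k\}$ with $\Pr\{J=n\}=\bar F(b+n\mu)/q_k(b)$; then generate independently $X_n$, $n\le n_k$, from $F(\cdot\mid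 X_n\ge b+n\mu)$ if $n=J$ and from $F$ otherwise. Estimator: $$Z_{k,1}(b):=\frac{q_k(b)}{\#\{n_{k-1}<i\le n_k: X_i\ge b+i\mu\}}\mathbb{I}(n_{k-1}<\tau_b\le n_k,\ A_k).$$ Measure $\mathbb{P}_{k,2}$: let $\theta_k=\theta_k(b):=\frac{-\log(n_k\bar F(b+n_{k-1}\mu))}{b+n_{k-1}\mu}$ (positive for all $k$ once $b$ is large) and $\Lambda_k(\theta):=\log\int_{-\infty}^{b+n_{k-1}\mu}e^{\theta x}F(dx)$, $\theta\ge0$. Generate $X_1,\dots,X_{\tau_b\wedge n_k}$ independently from $F_k$, where $\frac{dF_k(x)}{dF(x)}=\exp(\theta_kx-\Lambda_k(\theta_k))\mathbf 1(x<b+n_{k-1}\mu)$; the remaining increments up to index $n_k$ have law $F$ independently. Estimator: $$Z_{k,2}(b):=\exp(-\theta_kS_{\tau_b}+\tau_b\Lambda_k(\theta_k))\,\mathbb{I}(n_{k-1}<\tau_b\le n_k,\ B_k).$$ Measure $\mathbb{P}_{k,3}$: choose $J$ uniformly from $\{1,\dots,n_k\}$; generate independently $X_n$, $n\le n_k$, from $F(\cdot\mid X_n\ge b+n_{k-1}\mu)$ if $n=J$ and from $F$ otherwise. Estimator: $$Z_{k,3}(b):=\frac{n_k\bar F(b+n_{k-1}\mu)}{\#\{1\le i\le n_k: X_i\ge b+n_{k-1}\mu\}}\mathbb{I}(n_{k-1}<\tau_b\le n_k,\ \bar A_k\cap\bar B_k).$$ $Z_k(b):=Z_{k,1}(b)+Z_{k,2}(b)+Z_{k,3}(b)$,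 with the three summands generated independently under $\mathbb{P}_{k,1},\mathbb{P}_{k,2},\mathbb{P}_{k,3}$ respectively; it estimates $\mathbb{P}\{n_{k-1}<\tau_b\le n_k\}$. Overall estimator: given a probability mass function $(p_k:k\ge1)$ with all $p_k>0$ (possibly depending on $b$), draw $K$ with $\Pr\{K=k\}=p_k$; given $K=k$ generate $Z_{k,1}(b),Z_{k,2}(b),Z_{k,3}(b)$ independently under $\mathbb{P}_{k,1},\mathbb{P}_{k,2},\mathbb{P}_{k,3}$ respectively and form their sum $Z_k(b)$; set $Z(b):=Z_K(b)/p_K$. $Q$ is the probability measure induced by this procedure, with expectation $\mathbb{E}^Q$. $\nu_b$ denotes the largest index of the increment random variables considered for simulation in a run; since the procedure generates $X_1,\dots,X_{n_K}$ and none with larger index, $\nu_b=n_K$.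
   Formalization: Unbiasedness of Z(b) is asserted for all sufficiently large b rather than for every b>0: for small b, θ_k(b) can be negative with Λ_k(θ_k) infinite, or F can have atoms at the levels, so that Z(b) is undefined or biased. *)

(* Defs.v *)
From HB Require Import structures.
From mathcomp Require Import all_boot all_order all_algebra.
From mathcomp Require Import interval_inference.
From mathcomp Require Import all_classical all_reals all_analysis.
From mathcomp Require Import measurable_realfun.

Set Implicit Arguments.
Unset Strict Implicit.
Unset Printing Implicit Defensive.

Import Order.TTheory GRing.Theory Num.Theory.
Import numFieldNormedType.Exports.

Local Open Scope classical_set_scope.
Local Open Scope ring_scope.

Definition mutually_independent d (T : measurableType d) (R : realType)
    (P : probability T R) (X : nat -> {RV P >-> R}) :=
  forall (I : seq nat) (A : nat -> set R), uniq I ->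
    (forall i, measurable (A i)) ->
    P (\big[setI/setT]_(i <- I) (X i @^-1` A i)) =
    (\prod_(i <- I) P (X i @^-1` A i))%E.

Definition identically_distributed d (T : measurableType d) (R : realType)
    (P : probability T R) (X : nat -> {RV P >-> R}) :=
  forall (i j : nat) (A : set R), measurable A ->
    P (X i @^-1` A) = P (X j @^-1` A).

Definition slowly_varying (R : realType) (L : R -> R) :=
  forall t : R, 0 < t -> L (t * x) / L x @[x --> +oo] --> (1 : R).

Definition is_pmf (R : realType) (p : nat -> R) :=
  (forall k, (0 < k)%N -> 0 < p k) /\
  (\sum_(1 <= k <oo) (p k)%:E = 1)%E.

(* Real sequences with the sigma-algebra generated by the coordinates.
   The increments of a path x are x 1, x 2, ...; x 0 plays no role. *)
Definition cylinders (R : realType) : set (set (nat -> R)) :=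
  [set C | exists (i : nat) (B : set R),
     measurable B /\ C = [set x | B (x i)]].

Definition increments (R : realType) := g_sigma_algebraType (@cylinders R).

Section increments_theory.
Context (R : realType).
Local Notation incr := (increments R).

Lemma measurable_coord (i : nat) :
  measurable_fun [set: incr] (fun x : incr => x i).
Proof.
move=> _ B mB; rewrite setTI; apply: sub_gen_smallest.
by exists i, B.
Qed.

Lemma measurable_to_increments d (T : measurableType d) (f : T -> incr) :
  (forall i, measurable_fun [set: T] (fun t => f t i)) ->
  measurable_fun [set: T] f.
Proof.
move=> mf.
apply: (@measurability _ _ _ _ setT f (@cylinders R)) => //.
move=> _ [_ [i [B [mB ->]]] <-].
exact: mf.
Qed.

Definition set_coord (n : nat) (z : incr * R) : incr :=
  fun i => if i == n then z.2 else z.1 i.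

Lemma measurable_set_coord n : measurable_fun [set: incr * R] (set_coord n).
Proof.
apply: measurable_to_increments => i; rewrite /set_coord.
case: (i == n); first exact: measurable_snd.
exact: measurableT_comp (measurable_coord i) measurable_fst.
Qed.

HB.instance Definition _ n :=
  isMeasurableFun.Build _ _ _ _ (set_coord n) (measurable_set_coord n).

End increments_theory.

(* Law of a path whose increments x 1, ..., x n are independent, x i having
   law m i; the remaining coordinates are set to 0. *)
Fixpoint independent_increments (R : realType) (m : nat -> probability R R)
    (n : nat) : probability (increments R) R :=
  if n is n'.+1 then
    distribution (independent_increments m n' \x m n)%E (@set_coord R n)
  else dirac (cst 0 : increments R).

(* The mixture sum_j (w j) (m j), for nonnegative weights w of sum 1: in that
   case the absolute value and the normalization are both void. *)
Definition mixture d (T : measurableType d) (R : realType) (w : nat -> R)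
    (m : nat -> probability T R) : probability T R :=
  mnormalize (mseries (fun j => mscale (NngNum (normr_ge0 (w j))) (m j)) 0)
    (m 0%N).

Lemma mixtureE d (T : measurableType d) (R : realType) (w : nat -> R)
    (m : nat -> probability T R) (A : set T) :
  (forall j, 0 <= w j) -> (\sum_(j <oo) (w j)%:E = 1)%E ->
  mixture w m A = (\sum_(j <oo) (w j)%:E * m j A)%E.
Proof.
move=> w0 w1; pose s := mseries (fun j => mscale (NngNum (normr_ge0 (w j))) (m j)) 0.
have sE B : s B = (\sum_(j <oo) (w j)%:E * m j B)%E.
  rewrite /s /mseries; apply: eq_eseriesr => j _.
  by rewrite /mscale; congr (_%:E * _)%E; exact: ger0_norm.
have sT : s setT = 1%E.
  by rewrite sE -w1; apply: eq_eseriesr => j _; rewrite probability_setT mule1.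
have -> : mixture w m A =
    (if (s setT == 0) || (s setT == +oo) then m 0%N A
     else s A * (fine (s setT))^-1%:E)%E.
  by rewrite /mixture /= /mnormalize /s; case: (_ || _).
by rewrite sT onee_eq0 /= invr1 mule1 sE.
Qed.

Section simulation.
Context (R : realType).
Variable F : probability R R.
Variables (mu : R) (r : nat).
Local Notation incr := (increments R).

Definition Fbar (x : R) : R := fine (F `]x, +oo[%classic).

Definition walk (x : incr) (n : nat) : R := \sum_(1 <= i < n.+1) x i.

Definition tau (b : R) (x : incr) : \bar R :=
  ereal_inf [set n%:R%:E | n in [set n : nat | b < walk x n - n%:R * mu]].

(* n_0 = 0, and not r ^ 0 *)
Definition nn (k : nat) : nat := if k is 0 then 0 else (r ^ k)%N.

(* b + n_{k-1} mu *)
Definition level (b : R) (k : nat) : R := b + (nn k.-1)%:R * mu.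

Definition q (b : R) (k : nat) : R :=
  \sum_((nn k.-1).+1 <= i < (nn k).+1) Fbar (b + i%:R * mu).

Definition crossing (b : R) (k : nat) : set incr :=
  [set x | ((nn k.-1)%:R%:E < tau b x <= (nn k)%:R%:E)%E].

Definition event_A (b : R) (k : nat) : set incr :=
  [set x | exists2 i, (nn k.-1 < i <= nn k)%N & b + i%:R * mu < x i].

Definition event_B (b : R) (k : nat) : set incr :=
  [set x | forall i, (0 < i <= nn k)%N -> x i < level b k].

Definition F_above (c : R) : probability R R :=
  mnormalize (mrestr F (measurable_itv `[c, +oo[)) F.

Definition law1 (b : R) (k : nat) : probability incr R :=
  mixture
    (fun j => if (nn k.-1 < j <= nn k)%N then Fbar (b + j%:R * mu) / q b k
              else 0)
    (fun j => independent_increments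
       (fun i => if i == j then F_above (b + j%:R * mu) else F) (nn k)).

Definition Z1 (b : R) (k : nat) (x : incr) : R :=
  q b k / (\sum_((nn k.-1).+1 <= i < (nn k).+1)
             (b + i%:R * mu <= x i)%R)%N%:R
  * \1_(crossing b k `&` event_A b k) x.

Definition theta (b : R) (k : nat) : R :=
  - ln ((nn k)%:R * Fbar (level b k)) / level b k.

Definition Lambda (b : R) (k : nat) (t : R) : R :=
  ln (\int[F]_(x in `]-oo, level b k[) expR (t * x)).

Definition tilt_density (b : R) (k : nat) (x : R) : R :=
  expR (theta b k * x - Lambda b k (theta b k)) * \1_(`]-oo, level b k[) x.

Definition tilt (b : R) (k : nat) (A : set R) : \bar R :=
  (\int[F]_(x in A) (tilt_density b k x)%:E)%E.

Let tilt0 b k : tilt b k set0 = 0%E.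
Proof. exact: integral_set0. Qed.

Let tilt_density_ge0 b k x : 0 <= tilt_density b k x.
Proof. by rewrite mulr_ge0 ?expR_ge0. Qed.

Let tilt_ge0 b k A : (0 <= tilt b k A)%E.
Proof. by apply: integral_ge0 => x _; rewrite lee_fin. Qed.

Let tilt_sigma_additive b k : semi_sigma_additive (tilt b k).
Proof.
apply: semi_sigma_additive_nng_induced => [|x]; last by rewrite lee_fin.
apply: (@measurableT_comp _ _ _ _ _ _ EFin) => //.
apply: measurable_funM; last exact: measurable_indic.
apply: (@measurableT_comp _ _ _ _ _ _ expR) => //.
by apply: measurable_funB => //; exact: measurable_funM.
Qed.

HB.instance Definition _ b k := isMeasure.Build _ _ _ (tilt b k)
  (@tilt0 b k) (@tilt_ge0 b k) (@tilt_sigma_additive b k).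

(* tilt has mass 1 as soon as exp (theta x) is F-integrable below the level
   with a positive integral; mnormalize is then void. *)
Definition F_tilted (b : R) (k : nat) : probability R R :=
  mnormalize (tilt b k) F.

(* The increments z.1 up to the first passage of z.1, those of z.2 after. *)
Definition switch (b : R) (z : incr * incr) : incr :=
  fun i => if (i%:R%:E <= tau b z.1)%E then z.1 i else z.2 i.

Lemma le_tauP b (x : incr) (i : nat) : (i%:R%:E <= tau b x)%E <->
  forall n, (n < i)%N -> walk x n - n%:R * mu <= b.
Proof.
split=> [h n ni|h].
  rewrite leNgt; apply/negP => bn.
  have : (tau b x <= n%:R%:E)%E by apply: ereal_inf_lbound; exists n.
  move=> /(le_trans h); rewrite lee_fin ler_nat.
  by rewrite leqNgt ni.
apply: le_ereal_inf_tmp => _ [n /= bn <-]; rewrite lee_fin ler_nat leqNgt.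
by apply/negP => /h; rewrite leNgt bn.
Qed.

Lemma measurable_walk n : measurable_fun [set: incr] (walk ^~ n).
Proof.
rewrite /walk; apply: measurable_sum => i; exact: measurable_coord.
Qed.

Lemma measurable_le_tau b (i : nat) :
  measurable_fun [set: incr] (fun x : incr => i%:R%:E <= tau b x)%E.
Proof.
apply: (measurable_fun_bool true); rewrite setTI.
rewrite (_ : _ @^-1` _ = \bigcap_(n in [set n | (n < i)%N])
   (fun x : incr => walk x n - n%:R * mu <= b) @^-1` [set true]); last first.
  apply/seteqP; split=> x /=.
    by move/le_tauP => h n ni; exact: h.
  by move=> h; apply/le_tauP => n ni; exact: (h n ni).
apply: bigcap_measurableType => // n _; rewrite -[X in measurable X]setTI.
apply: measurable_fun_ler => //.
by apply: measurable_funB => //; exact: measurable_walk.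
Qed.

Lemma measurable_switch b : measurable_fun [set: incr * incr] (switch b).
Proof.
apply: measurable_to_increments => i; rewrite /switch.
apply: measurable_fun_ifT.
- exact: measurableT_comp (measurable_le_tau b i) measurable_fst.
- exact: measurableT_comp (measurable_coord i) measurable_fst.
- exact: measurableT_comp (measurable_coord i) measurable_snd.
Qed.

HB.instance Definition _ b :=
  isMeasurableFun.Build _ _ _ _ (switch b) (@measurable_switch b).

Definition law2 (b : R) (k : nat) : probability incr R :=
  distribution (independent_increments (fun=> F_tilted b k) (nn k) \x
                independent_increments (fun=> F) (nn k))%E (switch b).

(* On the event in the indicator tau is finite, hence a natural number. *)
Definition Z2 (b : R) (k : nat) (x : incr) : R :=
  let t := Num.truncn (fine (tau b x)) in
  expR (- theta b k * walk x t + t%:R * Lambda b k (theta b k))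
  * \1_(crossing b k `&` event_B b k) x.

Definition law3 (b : R) (k : nat) : probability incr R :=
  mixture
    (fun j => if (0 < j <= nn k)%N then (nn k)%:R^-1 else 0)
    (fun j => independent_increments
       (fun i => if i == j then F_above (level b k) else F) (nn k)).

Definition Z3 (b : R) (k : nat) (x : incr) : R :=
  (nn k)%:R * Fbar (level b k)
  / (\sum_(1 <= i < (nn k).+1) (level b k <= x i)%R)%N%:R
  * \1_(crossing b k `&` (~` event_A b k `&` ~` event_B b k)) x.

(* One run: the index K, then the paths generated under law1, law2, law3. *)
Local Notation run := (nat * (incr * incr * incr))%type.

Definition Q (p : nat -> R) (b : R) : probability run R :=
  mixture (fun k => if (0 < k)%N then p k else 0)
    (fun k => (\d_k \x (law1 b k \x law2 b k \x law3 b k))%E).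

Definition Z (p : nat -> R) (b : R) (w : run) : R :=
  (Z1 b w.1 w.2.1.1 + Z2 b w.1 w.2.1.2 + Z3 b w.1 w.2.2) / p w.1.

Definition nu (w : run) : nat := nn w.1.

Definition Gbar (alpha beta x : R) : R := Fbar x / x `^ (beta - alpha).

Definition GbarI (alpha beta x : R) : R :=
  \int[lebesgue_measure]_(u in `[x, +oo[) Gbar alpha beta u.

Definition selection (alpha beta b : R) (k : nat) : R :=
  (GbarI alpha beta (level b k) - GbarI alpha beta (level b k.+1))
  / GbarI alpha beta b.

End simulation.

(* X 0 is the generic increment X; the walk uses X 1, X 2, ... *)
Section performance.
Context d (T : measurableType d) (R : realType) (P : probability T R).
Variables (X : nat -> {RV P >-> R}) (mu : R) (r : nat).
Let F : probability R R := distribution P (X 0%N).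

Definition passage_prob (b : R) : R :=
  fine (P [set w | (tau mu b (fun i => X i w) < +oo)%E]).

Definition unbiased_estimator (p : R -> nat -> R) (b : R) :=
  'E_(Q F mu r (p b) b)[Z F mu r (p b) b]%E = (passage_prob b)%:E.

Definition relative_moment (p : R -> nat -> R) (gamma b : R) : \bar R :=
  ('E_(Q F mu r (p b) b)[(fun w => Z F mu r (p b) b w `^ (1 + gamma))%R]
   * ((passage_prob b `^ (1 + gamma))^-1)%:E)%E.

Definition expected_nu (p : R -> nat -> R) (b : R) : \bar R :=
  'E_(Q F mu r (p b) b)[(fun w => (nu r w)%:R)%R]%E.

End performance.

(* Main.v *)
Require Import Defs.
From HB Require Import structures.
From mathcomp Require Import all_boot all_order all_algebra.
From mathcomp Require Import all_classical all_reals all_analysis.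
From mathcomp Require Import interval_inference measurable_realfun.
From mathcomp Require Import ring lra.
Import Order.TTheory GRing.Theory Num.Theory.
Import numFieldNormedType.Exports.
Local Open Scope classical_set_scope.
Local Open Scope ring_scope.

Set Implicit Arguments.
Unset Strict Implicit.
Unset Printing Implicit Defensive.

(** The run K = k estimates the probability of crossing during the k-th block,
    n_{k-1} < tau <= n_k, by splitting that event into A_k, B_k and the rest.

    Unbiasedness.  With respect to the law of n_k independent increments, the
    first and third sampling laws have density the number of exceedances over
    a normalization ([integral_spread]), and the second one is an exponential
    change of measure stopped at the passage time.  On its piece of the event,
    each estimator is the inverse of that density, so its mean is the
    probability of the piece ([mean_Z1], [mean_Z2], [mean_Z3]); summing over
    the pieces and the blocks gives [expectation_Z] and [passage_probE].  The
    conditioning is on closed half-lines and Fbar is the tail on open ones: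
    they agree where L is differentiable, F having no atom there ([no_atom]).

    Moments.  Put m_k = b + n_{k-1} mu and rho_k = m_k / b.  The three
    estimators of the k-th block are bounded pathwise by a constant times
    n_k Fbar m_k.  For the tilted one, exp (- theta_k m_k) = n_k Fbar m_k, and
    the remaining factor exp (tau Lambda_k) is bounded as soon as
    exp Lambda_k <= 1 + C / n_k.  This is [tilt_mass_bound], the analytic core
    of the proof: it compares the exponential with its first order Taylor
    polynomial on the bulk, where the zero mean and a moment of some order
    a in (1, alpha) give the error theta_k ^ a = O(1 / m_k), and with a
    geometric sum on the range up to m_k, where Potter's bounds ([potter]) give
    the error O(1 / n_k); finally n_k = O(m_k).  Hence the moment of order 1 + gamma is at most a
    constant times the sum over k of p_k (n_k Fbar m_k / p_k) ^ (1 + gamma).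
    If p_k >= c (n_k / b) rho_k ^ - kappa, Potter's bounds turn this into
    (b Fbar b) ^ (1 + gamma) times the sum of
    (n_k / b) rho_k ^ - (a (1 + gamma) - gamma kappa), with a close to alpha.
    The latter sum is comparable with the integral of a power of rho over
    [1, oo), hence bounded in b when alpha (1 + gamma) - gamma kappa > 1
    ([sum_rho_le], [Z_moment_bound]).  Dividing is harmless because
    P (tau_b < oo) is at least of order b Fbar b: one of the first b increments
    may be huge while the walk has not gone far below 0
    ([passage_prob_lower]).

    Selections.  For the power selection kappa may be any number above beta,
    and beta < alpha + (alpha - 1) / gamma is exactly the room that is needed;
    the sum of p_k n_k is O(b) because beta > 2.  A single selection for all
    gamma needs every kappa > 2 at once.  The increments of
    1 / (v (1 + ln v) ^ 2) along v = rho_k have this property, and the sum of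
    p_k n_k is still O(b), as 1 / (v (1 + ln v) ^ 2) is integrable at
    infinity; gamma < (alpha - 1) / (2 - alpha) means exactly that
    alpha (1 + gamma) - 2 gamma > 1. *)

(** * Integration over paths with independent increments *)

Section density.
Local Open Scope ereal_scope.
Context d (T : measurableType d) (R : realType).
Variables (m m' : probability T R) (g : T -> R).
Hypothesis mg : measurable_fun [set: T] g.
Hypothesis g0 : forall x, (0 <= g x)%R.
Hypothesis m'E : forall A, measurable A -> m' A = \int[m]_(x in A) (g x)%:E.

(** A measure given by a density has it as its Radon-Nikodym derivative.  The
    integrand is only assumed nonnegative. *)
Lemma ge0_integral_density (f : T -> \bar R) :
  measurable_fun [set: T] f -> (forall x, 0 <= f x) ->
  \int[m']_x f x = \int[m]_x (f x * (g x)%:E).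
Proof.
move=> mf f0.
have dom : m' `<< m.
  apply/null_content_dominatesP => A mA mA0; rewrite m'E//.
  apply: null_set_integral => //.
  exact/measurable_EFinP/measurable_funTS.
pose h := Radon_Nikodym_SigmaFinite.f m' m.
have mh : m.-integrable [set: T] h by exact: Radon_Nikodym_SigmaFinite.f_integrable.
have gint : m.-integrable [set: T] (EFin \o g).
  apply/integrableP; split; first exact/measurable_EFinP.
  under eq_integral do rewrite gee0_abs ?lee_fin//.
  by rewrite -m'E// probability_setT ltry.
rewrite -(Radon_Nikodym_SigmaFinite.change_of_variables dom f0 measurableT mf).
have hg : ae_eq m [set: T] h (EFin \o g).
  apply: integral_ae_eq => //; first exact: measurable_int gint.
  move=> A _ mA; rewrite -m'E//.
  by rewrite -(Radon_Nikodym_SigmaFinite.f_integral dom mA).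
apply: ae_eq_integral => //.
- by apply: emeasurable_funM => //; exact: measurable_int mh.
- by apply: emeasurable_funM => //; exact/measurable_EFinP.
- by apply: filterS hg => x + Tx /=; rewrite -/h => ->.
Qed.

End density.

Section mixture_integral.
Local Open Scope ereal_scope.

Lemma ge0_integral_mixture d (T : measurableType d) (R : realType)
    (w : nat -> R) (m : nat -> probability T R) (f : T -> \bar R) :
  (forall j, (0 <= w j)%R) -> \sum_(j <oo) (w j)%:E = 1 ->
  measurable_fun [set: T] f -> (forall x, 0 <= f x) ->
  \int[mixture w m]_x f x = \sum_(j <oo) (w j)%:E * \int[m j]_x f x.
Proof.
move=> w0 w1 mf f0.
rewrite (eq_measure_integral (mseries
    (fun j => mscale (NngNum (normr_ge0 (w j))) (m j)) 0)); last first.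
  move=> A mA _; apply: (eq_trans (mixtureE m A w0 w1)); rewrite /= /mseries.
  apply: eq_eseriesr => j _.
  by rewrite /mscale/=; congr (_%:E * _); exact/esym/ger0_norm.
rewrite ge0_integral_measure_series//; apply: eq_eseriesr => j _.
by rewrite ge0_integral_mscale//=; congr (_%:E * _); exact: ger0_norm.
Qed.

End mixture_integral.

Section increments_integral.
Local Open Scope ereal_scope.
Context (R : realType).
Local Notation incr := (increments R).
Implicit Types (m : nat -> probability R R) (f : incr -> \bar R).

Lemma set_coordE n (x : incr) (y : R) i :
  set_coord n (x, y) i = if i == n then y else x i.
Proof. by []. Qed.

Lemma measurable_set_coordr n (x : incr) :
  measurable_fun [set: R] (fun y => set_coord n (x, y)).
Proof. exact: (measurableT_comp (measurable_set_coord n) (measurable_pair1 x)). Qed.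

Lemma integral_incr0 m f : measurable_fun [set: incr] f ->
  \int[independent_increments m 0]_x f x = f (cst 0%R).
Proof. by move=> mf; rewrite /= integral_dirac// diracT mul1e. Qed.

Lemma integral_incrS m n f : measurable_fun [set: incr] f ->
  (forall x, 0 <= f x) ->
  \int[independent_increments m n.+1]_x f x =
  \int[independent_increments m n]_x \int[m n.+1]_y f (set_coord n.+1 (x, y)).
Proof.
move=> mf f0 /=; rewrite ge0_integral_distribution//.
rewrite fubini_tonelli1//.
exact: (measurableT_comp mf (measurable_set_coord _)).
by move=> z; rewrite /= f0.
Qed.

(** A function of a path that reads the increments 1, ..., t only. *)
Definition reads (S : Type) (t : nat) (f : incr -> S) :=
  forall x y : incr, (forall i, (0 < i <= t)%N -> x i = y i) -> f x = f y.

Lemma reads_set_coord (S : Type) t (f : incr -> S) n x y :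
  reads t f -> (t < n)%N -> f (set_coord n (x, y)) = f x.
Proof.
move=> rf tn; apply: rf => i /andP[_ it]; rewrite set_coordE ifN//.
by apply/eqP => ein; move: it; rewrite ein leqNgt tn.
Qed.

Lemma measurable_section_integral m n f :
  measurable_fun [set: incr] f -> (forall x, 0 <= f x) ->
  measurable_fun [set: incr]
    (fun x => \int[m n]_y f (set_coord n (x, y))).
Proof.
move=> mf f0.
apply: (@measurable_fun_fubini_tonelli_F _ _ _ _ _ (m n)
  (fun z => f (set_coord n z))) => //.
exact: (measurableT_comp mf (measurable_set_coord _)).
Qed.

Lemma measurable_prod_coord (g : nat -> R -> R) a b :
  (forall i, measurable_fun [set: R] (g i)) ->
  measurable_fun [set: incr] (fun x : incr => \prod_(a <= i < b) g i (x i))%R.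
Proof.
move=> mg; apply: measurable_prod => i _.
exact: (measurableT_comp (mg i) (measurable_coord i)).
Qed.

(** Change of measure for independent increments: the likelihood ratio is the
    product of the likelihood ratios of the increments. *)
Lemma integral_incr_density m m' (g : nat -> R -> R) n f :
  (forall i, measurable_fun [set: R] (g i)) ->
  (forall i x, (0 <= g i x)%R) ->
  (forall i, (0 < i <= n)%N -> forall A, measurable A ->
    m' i A = \int[m i]_(x in A) (g i x)%:E) ->
  measurable_fun [set: incr] f -> (forall x, 0 <= f x) ->
  \int[independent_increments m' n]_x f x =
  \int[independent_increments m n]_x
    (f x * (\prod_(1 <= i < n.+1) g i (x i))%R%:E).
Proof.
move=> mg g0 m'E; elim: n f m'E => [|n IH] f m'E mf f0.
  rewrite !integral_incr0//; first by rewrite big_nil mule1.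
  apply: emeasurable_funM => //; apply/measurable_EFinP.
  exact: measurable_prod_coord.
have prod0 (x : incr) a b : (0 <= \prod_(a <= i < b) g i (x i))%R.
  by apply: prodr_ge0 => i _.
rewrite integral_incrS// IH//; last 3 first.
- by move=> i /andP[i0 ni]; apply: m'E; rewrite i0 ltnW.
- exact: measurable_section_integral.
- by move=> x; exact: integral_ge0.
rewrite integral_incrS//; last 2 first.
- apply: emeasurable_funM => //; apply/measurable_EFinP.
  exact: measurable_prod_coord.
- by move=> x; rewrite mule_ge0// lee_fin.
apply: eq_integral => x _.
have mfx : measurable_fun [set: R] (fun y => f (set_coord n.+1 (x, y))).
  exact: (measurableT_comp mf (measurable_set_coordr _ _)).
rewrite (@ge0_integral_density _ _ _ (m n.+1) _ (g n.+1))//; last first.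
  by apply: m'E; rewrite ltnSn.
rewrite -ge0_integralZr//; last 3 first.
- by apply: emeasurable_funM => //; exact/measurable_EFinP.
- by move=> y _; rewrite mule_ge0// lee_fin.
- by rewrite lee_fin.
apply: eq_integral => y _; rewrite -muleA -EFinM; congr (_ * _%:E).
rewrite [RHS]big_nat_recr//= set_coordE eqxx mulrC; congr (_ * _)%R.
rewrite [LHS]big_nat_cond [RHS]big_nat_cond; apply: eq_bigr => i.
by rewrite andbT set_coordE => /andP[_ ni]; rewrite ltn_eqF.
Qed.

(** Under independent increments, a function of the first t increments and a
    product over the later ones have mean the product of their means. *)
Lemma integral_incr_factor m (h : nat -> R -> R) t n f :
  (forall i, measurable_fun [set: R] (h i)) ->
  (forall i x, (0 <= h i x)%R) -> (t <= n)%N ->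
  measurable_fun [set: incr] f -> (forall x, 0 <= f x) -> reads t f ->
  \int[independent_increments m n]_x
    (f x * (\prod_(t.+1 <= i < n.+1) h i (x i))%R%:E) =
  \int[independent_increments m t]_x f x *
  \prod_(t.+1 <= i < n.+1) \int[m i]_y (h i y)%:E.
Proof.
move=> mh h0 + mf f0 rf; elim: n => [|n IH].
  rewrite leqn0 => /eqP ->; rewrite big_geq// mule1.
  by apply: eq_integral => x _; rewrite big_geq// mule1.
have prod0 (x : incr) a b : (0 <= \prod_(a <= i < b) h i (x i))%R.
  by apply: prodr_ge0 => i _.
rewrite leq_eqVlt => /predU1P[->|].
  rewrite big_geq// mule1.
  by apply: eq_integral => x _; rewrite big_geq// mule1.
rewrite ltnS => tn; rewrite integral_incrS//; last 2 first.
- apply: emeasurable_funM => //; apply/measurable_EFinP.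
  exact: measurable_prod_coord.
- by move=> x; rewrite mule_ge0// lee_fin.
rewrite [in RHS]big_nat_recr//= muleA -IH// -ge0_integralZr//; last 3 first.
- apply: emeasurable_funM => //; apply/measurable_EFinP.
  exact: measurable_prod_coord.
- by move=> x _; rewrite mule_ge0// lee_fin.
- by apply: integral_ge0 => y _; rewrite lee_fin.
apply: eq_integral => x _; rewrite -ge0_integralZl//; last 3 first.
- exact/measurable_EFinP.
- by move=> y _; rewrite lee_fin.
- by rewrite mule_ge0// lee_fin.
apply: eq_integral => y _; rewrite (reads_set_coord _ _ rf)// -muleA -EFinM.
rewrite big_nat_recr//= set_coordE eqxx; congr (_ * (_ * _)%:E).
rewrite [LHS]big_nat_cond [RHS]big_nat_cond; apply: eq_bigr => i.
by rewrite andbT set_coordE => /andP[_ ni]; rewrite ltn_eqF.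
Qed.

End increments_integral.

(** * First passage times *)

Section passage_times.
Context (R : realType) (mu : R) (r : nat).
Local Notation incr := (increments R).
Implicit Types (b : R) (x y : incr) (t n : nat).

(** The paths that first exceed the boundary at time t or later. *)
Definition ge_tau b t : set incr := [set x | (t%:R%:E <= tau mu b x)%E].

(** The paths whose first passage time is exactly t. *)
Definition hit b t : set incr := ge_tau b t `\` ge_tau b t.+1.

Lemma ge_tauP b t x :
  ge_tau b t x <-> forall n, (n < t)%N -> walk x n - n%:R * mu <= b.
Proof. exact: le_tauP. Qed.

Lemma measurable_ge_tau b t : measurable (ge_tau b t).
Proof.
rewrite [X in measurable X](_ : _ =
  (fun x : incr => (t%:R%:E <= tau mu b x)%E) @^-1` [set true])//.
rewrite -[X in measurable X]setTI; exact: (measurable_le_tau mu b t).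
Qed.

Lemma measurable_hit b t : measurable (hit b t).
Proof. by apply: measurableD; exact: measurable_ge_tau. Qed.

Lemma tau_leP b x n : (tau mu b x <= n%:R%:E)%E <-> ~ ge_tau b n.+1 x.
Proof.
split=> [taun H|/ge_tauP H].
  have := le_trans H taun; by rewrite lee_fin ler_nat ltnn.
have [s sn bs] : exists2 s, (s < n.+1)%N & b < walk x s - s%:R * mu.
  apply: contrapT => H'; apply: H => s sn; rewrite leNgt; apply/negP => bs.
  by apply: H'; exists s.
apply: (@le_trans _ _ s%:R%:E); last by rewrite lee_fin ler_nat -ltnS.
by apply: ereal_inf_lbound; exists s.
Qed.

Lemma tau_gtP b x n : (n%:R%:E < tau mu b x)%E <-> ge_tau b n.+1 x.
Proof.
rewrite ltNge; split=> [/negP H|H]; last first.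
  by apply/negP => /tau_leP; exact.
by apply: contrapT => /tau_leP.
Qed.

Lemma hit_tau b t x : hit b t x -> tau mu b x = t%:R%:E.
Proof.
by move=> [ge1 /tau_leP le1]; apply/eqP; rewrite eq_le le1 /=.
Qed.

Lemma tau_fin_hit b x : (tau mu b x < +oo)%E -> exists t, hit b t x.
Proof.
move=> /ereal_inf_lt [_ [n /= bn <-] _].
have /ex_minnP[t bt tmin] : exists n, b < walk x n - n%:R * mu by exists n.
exists t; split; last by move=> /ge_tauP /(_ t (ltnSn t)); rewrite leNgt bt.
apply/ge_tauP => s st; rewrite leNgt; apply/negP => /tmin.
by rewrite leqNgt st.
Qed.

Lemma ge_tau0 b x : ge_tau b 0 x.
Proof. exact/ge_tauP. Qed.

Lemma ge_tauS b t : ge_tau b t.+1 `<=` ge_tau b t.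
Proof. by move=> x /ge_tauP H; apply/ge_tauP => n nt; apply: H; exact: ltnW. Qed.

Lemma ge_tau1 b x : 0 < b -> ge_tau b 1 x.
Proof.
move=> b0; apply/ge_tauP => -[|//] _.
by rewrite /walk big_geq// mul0r subr0 ltW.
Qed.

Lemma reads_walk t : reads t (fun x : incr => walk x t).
Proof.
move=> x y xy; rewrite /walk; apply: eq_big_nat => i /andP[i0 it].
by apply: xy; rewrite i0.
Qed.

Lemma reads_ge_tau b t : reads t (ge_tau b t.+1 : incr -> Prop).
Proof.
have H (x y : incr) : (forall i, (0 < i <= t)%N -> x i = y i) ->
    ge_tau b t.+1 x -> ge_tau b t.+1 y.
  move=> xy /ge_tauP H; apply/ge_tauP => n nt.
  suff <- : walk x n = walk y n by exact: H.
  apply: reads_walk => i /andP[i0 it].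
  by apply: xy; rewrite i0 (leq_trans it).
move=> x y xy; apply/propext; split; first exact: H.
by apply: H => i it; rewrite xy.
Qed.

Lemma reads_le (S : Type) s t (f : incr -> S) : (s <= t)%N -> reads s f -> reads t f.
Proof.
move=> st rf x y xy; apply: rf => i /andP[i0 it].
by apply: xy; rewrite i0 (leq_trans it).
Qed.

Lemma reads_hit b t : reads t (hit b t : incr -> Prop).
Proof.
move=> x y xy; rewrite /hit /setD /mkset (@reads_ge_tau b t x y xy).
suff -> : ge_tau b t x = ge_tau b t y by [].
case: t xy => [|t] xy; last exact: (reads_le (leqnSn t) (@reads_ge_tau b t) xy).
by apply/propext; split=> _; exact: ge_tau0.
Qed.

Lemma crossingE b k :
  crossing mu r b k = ge_tau b (nn r k.-1).+1 `\` ge_tau b (nn r k).+1.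
Proof.
apply/seteqP; split=> x; rewrite /crossing /=.
  by move=> /andP[/tau_gtP ? /tau_leP].
by move=> [/tau_gtP -> /tau_leP ->].
Qed.

Lemma measurable_crossing b k : measurable (crossing mu r b k).
Proof. by rewrite crossingE; apply: measurableD; exact: measurable_ge_tau. Qed.

Lemma indic_setDsub (A B : set incr) x : B `<=` A ->
  \1_(A `\` B) x = \1_A x - \1_B x :> R.
Proof.
move=> BA; rewrite !indicE in_setD.
have [/set_mem/BA/mem_set ->|] := boolP (x \in B); first by rewrite subrr.
by rewrite andbT subr0.
Qed.

Lemma ge_tau_le b s t : (s <= t)%N -> ge_tau b t `<=` ge_tau b s.
Proof.
by move=> st x /ge_tauP H; apply/ge_tauP => n ns; apply: H; exact: leq_trans st.
Qed.

Lemma nn_le k : (0 < r)%N -> (nn r k.-1 <= nn r k)%N.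
Proof.
by move=> r0; case: k => // -[|k] //=; rewrite leq_pexp2l.
Qed.

Lemma indic_crossing b k x : (0 < r)%N ->
  \1_(crossing mu r b k) x =
  \sum_((nn r k.-1).+1 <= t < (nn r k).+1) \1_(hit b t) x :> R.
Proof.
move=> r0; rewrite crossingE indic_setDsub; last first.
  by apply: ge_tau_le; rewrite ltnS nn_le.
under eq_bigr => t _ do rewrite (indic_setDsub _ (@ge_tauS b t)).
rewrite (@telescope_sumr_eq _ _ _ (fun t => - \1_(ge_tau b t) x)).
- by rewrite opprK addrC.
- by rewrite ltnS nn_le.
- by move=> t _; rewrite opprK addrC.
Qed.

End passage_times.

(** * The estimators based on large increments *)

Section finite_series.
Local Open Scope ereal_scope.
Context (R : realType).

Lemma eseries_finite (u : nat -> \bar R) N :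
  (forall j, (N <= j)%N -> u j = 0) ->
  \sum_(j <oo) u j = \sum_(0 <= j < N) u j.
Proof.
move=> u0; apply: cvg_lim => //; apply: cvg_near_cst; exists N => // n /= Nn.
rewrite (big_cat_nat (n := N))//= [X in _ + X]big1_seq ?adde0//.
by move=> j /andP[_]; rewrite mem_index_iota => /andP[Nj _]; exact: u0.
Qed.

(** A series whose terms vanish outside a < j <= n. *)
Lemma eseries_window (u : nat -> \bar R) a n :
  \sum_(j <oo) (if (a < j <= n)%N then u j else 0) =
  \sum_(a.+1 <= j < n.+1) u j.
Proof.
rewrite (@eseries_finite _ n.+1) => [|j nj]; last by rewrite [(j <= n)%N]leqNgt nj andbF.
rewrite -big_mkcond/= [RHS](big_nat_widenl _ 0)//.
rewrite [LHS]big_nat_cond [RHS]big_nat_cond; apply: eq_bigl => j.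
by rewrite ltnS; case: (a < j)%N; case: (j <= n)%N; rewrite ?andbF.
Qed.

End finite_series.

Section tail_conditioning.
Local Open Scope ereal_scope.
Context (R : realType) (F : probability R R).
Local Notation incr := (increments R).
Local Notation pi_ := (independent_increments (fun=> F)).

(** The hypothesis says that F has no atom at c: F_above conditions on the
    closed half-line, Fbar is the tail on the open one. *)
Lemma F_aboveE c A : F `[c, +oo[%classic = (Fbar F c)%:E -> (0 < Fbar F c)%R ->
  measurable A ->
  F_above F c A = \int[F]_(x in A) ((c <= x)%R%:R / Fbar F c)%:E.
Proof.
move=> Fc c0 mA; have mT : mrestr F (measurable_itv `[c, +oo[) [set: R] = (Fbar F c)%:E.
  by rewrite /mrestr setTI.
rewrite /F_above /= /mnormalize /= mT eqe gt_eqF//= /mrestr.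
under eq_integral do rewrite mulrC EFinM.
have mi : measurable_fun [set: R] (fun x : R => (c <= x)%R%:R%:E : \bar R).
  apply/measurable_EFinP.
  rewrite (_ : (fun x : R => _) = \1_(`[c, +oo[%classic)) ?measurable_indic//.
  apply/funext => x; rewrite indicE; congr (nat_of_bool _)%:R.
  by rewrite mem_setE in_itv/= andbT.
rewrite ge0_integralZl//=; last 2 first.
- exact: measurable_funTS.
- by rewrite lee_fin invr_ge0 ltW.
rewrite muleC; congr (_ * _).
rewrite (_ : (fun x : R => _) = EFin \o \1_(`[c, +oo[%classic)).
  by rewrite integral_indic// setIC.
apply/funext => x /=; rewrite indicE; congr (nat_of_bool _)%:R%:E.
by rewrite mem_setE in_itv/= andbT.
Qed.

Lemma measurable_tail_indic (c v : R) :
  measurable_fun [set: R] (fun x : R => (c <= x)%R%:R / v)%R.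
Proof.
apply: measurable_funM => //.
rewrite (_ : (fun x : R => _) = \1_(`[c, +oo[%classic)) ?measurable_indic//.
apply/funext => x; rewrite indicE; congr (nat_of_bool _)%:R.
by rewrite mem_setE in_itv/= andbT.
Qed.

(** Conditioning the j-th increment on exceeding c. *)
Lemma integral_replace c j n f :
  F `[c, +oo[%classic = (Fbar F c)%:E -> (0 < Fbar F c)%R -> (0 < j <= n)%N ->
  measurable_fun [set: incr] f -> (forall x, 0 <= f x) ->
  \int[independent_increments (fun i => if i == j then F_above F c else F) n]_x
    f x = \int[pi_ n]_x (f x * ((c <= x j)%R%:R / Fbar F c)%:E).
Proof.
move=> Fc c0 /andP[j0 jn] mf f0.
pose g i (y : R) := (if i == j then (c <= y)%R%:R / Fbar F c else 1)%R.
rewrite (@integral_incr_density _ (fun=> F) _ g)//.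
- apply: eq_integral => x _; congr (_ * _%:E).
  rewrite (bigD1_seq j)/= ?iota_uniq ?mem_index_iota ?j0//= {1}/g eqxx.
  by rewrite big1_seq ?mulr1// => i /andP[ij _]; rewrite /g (negbTE ij).
- move=> i; rewrite /g; case: (i == j); last exact: measurable_cst.
  exact: measurable_tail_indic.
- move=> i y; rewrite /g; case: (i == j) => //.
  by rewrite mulr_ge0// invr_ge0 ltW.
- move=> i _ A mA; rewrite /g; case: (i == j); first exact: F_aboveE.
  by rewrite integral_cst//= mul1e.
Qed.

(** The law in which one increment, chosen among a < j <= n with probability
    proportional to Fbar (c j), is conditioned on exceeding c j: its density
    is the number of exceedances divided by the normalization. *)
Lemma integral_spread (c : nat -> R) a n w (f : incr -> \bar R) :
  let q := (\sum_(a.+1 <= j < n.+1) Fbar F (c j))%R in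
  (a < n)%N ->
  (forall j, (a < j <= n)%N ->
     F `[c j, +oo[%classic = (Fbar F (c j))%:E /\ (0 < Fbar F (c j))%R) ->
  (forall j, w j = if (a < j <= n)%N then Fbar F (c j) / q else 0)%R ->
  measurable_fun [set: incr] f -> (forall x, 0 <= f x) ->
  \int[mixture w (fun j => independent_increments
     (fun i => if i == j then F_above F (c j) else F) n)]_x f x =
  \int[pi_ n]_x
    (f x * (((\sum_(a.+1 <= j < n.+1) (c j <= x j)%R)%N)%:R / q)%:E).
Proof.
move=> q an cF wE mf f0.
have q0 : (0 < q)%R.
  rewrite /q big_nat_recr//=; apply: ltr_wpDl; last first.
    by apply: (cF n _).2; rewrite an leqnn.
  rewrite big_nat_cond; apply: sumr_ge0 => j; rewrite andbT => /andP[aj jn].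
  by apply/ltW; apply: (cF j _).2; rewrite aj ltnW.
have w0 j : (0 <= w j)%R.
  rewrite wE; case: ifP => // /cF[_ cj0].
  by rewrite divr_ge0// ltW.
have w1 : \sum_(j <oo) (w j)%:E = 1.
  transitivity (\sum_(j <oo) (if (a < j <= n)%N then (Fbar F (c j) / q)%:E else 0)).
    by apply: eq_eseriesr => j _; rewrite wE; case: ifP.
  by rewrite eseries_window sumEFin -mulr_suml divff ?gt_eqF.
rewrite ge0_integral_mixture//.
transitivity (\sum_(j <oo) (if (a < j <= n)%N then
   (Fbar F (c j) / q)%:E *
     \int[pi_ n]_x (f x * ((c j <= x j)%R%:R / Fbar F (c j))%:E) else 0)).
  apply: eq_eseriesr => j _; rewrite wE; case: ifP => [ajn|_]; last by rewrite mul0e.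
  have [Fc c0] := cF _ ajn; case/andP: ajn => aj jn.
  by rewrite integral_replace// jn (leq_trans _ aj).
have mc j : measurable_fun [set: incr] (fun x : incr => ((c j <= x j)%R%:R / q)%:E).
  apply/measurable_EFinP.
  exact: (measurableT_comp (measurable_tail_indic _ _) (measurable_coord j)).
rewrite eseries_window.
transitivity (\sum_(a.+1 <= j < n.+1)
    \int[pi_ n]_x (f x * ((c j <= x j)%R%:R / q)%:E)).
  rewrite [LHS]big_nat_cond [RHS]big_nat_cond; apply: eq_bigr => j.
  rewrite andbT ltnS => /cF[Fc c0]; rewrite -ge0_integralZl//; last 3 first.
  - apply: emeasurable_funM => //; apply/measurable_EFinP.
    exact: (measurableT_comp (measurable_tail_indic _ _) (measurable_coord j)).
  - by move=> x _; rewrite mule_ge0// lee_fin mulr_ge0// invr_ge0 ltW.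
  - by rewrite lee_fin divr_ge0// ltW.
  apply: eq_integral => x _; rewrite muleCA -EFinM; congr (_ * _%:E).
  by rewrite mulrC mulrA divfK ?gt_eqF.
rewrite -ge0_integral_sum//; last 2 first.
- by move=> j; exact: emeasurable_funM.
- by move=> j x _; rewrite mule_ge0// lee_fin mulr_ge0// invr_ge0 ltW.
apply: eq_integral => x _.
rewrite natr_sum mulr_suml -sumEFin ge0_sume_distrr// => j _.
by rewrite lee_fin mulr_ge0// invr_ge0 ltW.
Qed.

End tail_conditioning.

Section estimator_measurability.
Context (R : realType) (F : probability R R) (mu : R) (r : nat).
Local Notation incr := (increments R).

Lemma measurable_count (c : nat -> R) a n :
  measurable_fun [set: incr]
    (fun x : incr => (\sum_(a <= i < n) (c i <= x i)%R)%N%:R : R).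
Proof.
rewrite (_ : (fun x : incr => _) =
    fun x : incr => \sum_(a <= i < n) ((c i <= x i)%R%:R / 1)); last first.
  by apply/funext => x; rewrite natr_sum; apply: eq_bigr => i _; rewrite divr1.
apply: measurable_sum => i.
exact: (measurableT_comp (measurable_tail_indic _ _) (measurable_coord i)).
Qed.

Lemma measurable_event_A b k : measurable (event_A mu r b k).
Proof.
rewrite (_ : event_A _ _ _ _ = \bigcup_(i in [set i | (nn r k.-1 < i <= nn r k)%N])
    (fun x : incr => x i) @^-1` `]b + i%:R * mu, +oo[%classic); last first.
  apply/seteqP; split=> x /=.
    by move=> [i ai bi]; exists i => //=; rewrite in_itv/= bi.
  by move=> [i ai /=]; rewrite in_itv/= andbT => bi; exists i.
apply: bigcup_measurable => i _; rewrite -[X in measurable X]setTI.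
exact: (measurable_coord i).
Qed.

Lemma measurable_event_B b k : measurable (event_B mu r b k).
Proof.
rewrite (_ : event_B _ _ _ _ = \bigcap_(i in [set i | (0 < i <= nn r k)%N])
    (fun x : incr => x i) @^-1` `]-oo, level mu r b k[%classic); last first.
  apply/seteqP; split=> x /=.
    by move=> H i /H /=; rewrite in_itv.
  by move=> H i /H /=; rewrite in_itv.
apply: bigcap_measurableType => // i _; rewrite -[X in measurable X]setTI.
exact: (measurable_coord i).
Qed.

Lemma measurable_count_ratio (c : nat -> R) a n (v : R) (E : set incr) :
  measurable E ->
  measurable_fun [set: incr] (fun x : incr =>
    v / (\sum_(a <= i < n) (c i <= x i)%R)%N%:R * \1_E x).
Proof.
move=> mE; apply: measurable_funM; last exact: measurable_indic.
apply: measurable_funM => //.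
rewrite (_ : (fun x : incr => _) =
  (fun y : R => y `^ (-1)) \o
  (fun x : incr => (\sum_(a <= i < n) (c i <= x i)%R)%N%:R : R)); last first.
  by apply/funext => x /=; rewrite powR_inv1.
exact: (measurableT_comp (measurable_powR _) (measurable_count _ _ _)).
Qed.

Lemma measurable_Z1 b k : measurable_fun [set: incr] (Z1 F mu r b k).
Proof.
apply: (measurable_count_ratio (fun i => b + i%:R * mu)).
apply: measurableI; [exact: measurable_crossing|exact: measurable_event_A].
Qed.

Lemma measurable_Z3 b k : measurable_fun [set: incr] (Z3 F mu r b k).
Proof.
apply: (measurable_count_ratio (fun=> level mu r b k)).
apply: measurableI; first exact: measurable_crossing.
apply: measurableI; apply: measurableC.
- exact: measurable_event_A.
- exact: measurable_event_B.
Qed.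

(** The likelihood ratio of the exponentially tilted walk at time t, on the
    paths that first cross at time t and have no large increment. *)
Definition Z2_at b k t (x : incr) : R :=
  expR (- theta F mu r b k * walk x t
        + t%:R * Lambda F mu r b k (theta F mu r b k))
  * \1_(hit mu b t) x * \1_(event_B mu r b k) x.

(** On the crossing event exactly one passage time t lies in the block. *)
Lemma Z2E b k x : (0 < r)%N ->
  Z2 F mu r b k x = \sum_((nn r k.-1).+1 <= t < (nn r k).+1) Z2_at b k t x.
Proof.
move=> r0; rewrite /Z2 indicI /= indic_crossing// mulrA mulr_sumr mulr_suml.
apply: eq_bigr => t _; rewrite /Z2_at; congr (_ * _).
have [xt|xt] := pselect (hit mu b t x); last by rewrite indicE memNset// !mulr0.
by rewrite (hit_tau xt) /= natrK.
Qed.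

End estimator_measurability.

Lemma nn_lt r k : (1 < r)%N -> (0 < k)%N -> (nn r k.-1 < nn r k)%N.
Proof.
move=> r1; case: k => // -[|j] _ /=; first by rewrite expn1 ltnW.
by rewrite ltn_exp2l.
Qed.

Section piece_means.
Local Open Scope ereal_scope.
Context (R : realType) (F : probability R R) (mu : R) (r : nat).
Local Notation incr := (increments R).
Local Notation pi_ := (independent_increments (fun=> F)).
Variables (b : R) (k : nat).
Hypotheses (mu0 : (0 < mu)%R) (r1 : (1 < r)%N) (k0 : (0 < k)%N).
Hypothesis tailF : forall c, (b <= c)%R ->
  F `[c, +oo[%classic = (Fbar F c)%:E /\ (0 < Fbar F c)%R.
Local Notation n := (nn r k).
Local Notation a := (nn r k.-1).

(** On an event where at least one increment exceeds its threshold, the number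
    of exceedances cancels against its inverse. *)
Lemma integral_count_ratio (c : nat -> R) (v : R) (s t : nat) (E : set incr) :
  (0 < v)%R -> measurable E ->
  (forall x, E x -> exists2 i, (s <= i < t)%N & (c i <= x i)%R) ->
  \int[pi_ n]_x
    ((v / (\sum_(s <= i < t) (c i <= x i)%R)%N%:R * \1_E x)%R%:E
     * ((\sum_(s <= i < t) (c i <= x i)%R)%N%:R / v)%:E) = pi_ n E.
Proof.
move=> v0 mE Ec; rewrite -[E in RHS]setIT -integral_indic//; apply: eq_integral => x _.
rewrite -EFinM; congr (_%:E).
have [/[dup] xE /set_mem/Ec[i sit ci]|/negP xE] := boolP (x \in E); last first.
  by rewrite indicE (negbTE (introN idP xE)) mulr0 mul0r.
rewrite indicE xE mulr1 mulrA divfK ?divff ?gt_eqF//.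
rewrite ltr0n (bigD1_seq i)/= ?iota_uniq ?mem_index_iota// ci.
by [].
Qed.

Lemma mean_Z1 : \int[law1 F mu r b k]_x (Z1 F mu r b k x)%:E =
  pi_ n (crossing mu r b k `&` event_A mu r b k).
Proof.
have tl j : (a < j <= n)%N ->
    F `[(b + j%:R * mu)%R, +oo[%classic = (Fbar F (b + j%:R * mu))%:E /\
    (0 < Fbar F (b + j%:R * mu))%R.
  by move=> _; apply: tailF; rewrite lerDl mulr_ge0// ltW.
have q0 : (0 < q F mu r b k)%R.
  rewrite /q big_nat_recr//= ?(nn_lt r1 k0)//; apply: ltr_wpDl.
    by apply: sumr_ge0 => j _; rewrite fine_ge0.
  by apply: (tl n _).2; rewrite (nn_lt r1 k0) leqnn.
have mE : measurable (crossing mu r b k `&` event_A mu r b k).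
  apply: measurableI; [exact: measurable_crossing|exact: measurable_event_A].
rewrite /law1 (@integral_spread _ F (fun j => b + j%:R * mu)%R a n)//.
- apply: (@integral_count_ratio (fun j => b + j%:R * mu)%R) => //.
  move=> x [_ [i /andP[ai ni] bi]]; exists i; last exact: ltW.
  by rewrite ltnS ai ni.
- exact: nn_lt r1 k0.
- apply/measurable_EFinP; exact: measurable_Z1.
- move=> x; rewrite lee_fin; apply: mulr_ge0; last by rewrite indicE.
  by rewrite divr_ge0// ltW.
Qed.

Lemma mean_Z3 : \int[law3 F mu r b k]_x (Z3 F mu r b k x)%:E =
  pi_ n (crossing mu r b k `&` (~` event_A mu r b k `&` ~` event_B mu r b k)).
Proof.
set m := level mu r b k.
have [Fm m0] : F `[m, +oo[%classic = (Fbar F m)%:E /\ (0 < Fbar F m)%R.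
  by apply: tailF; rewrite lerDl mulr_ge0// ltW.
have n0 : (0 < n)%N by exact: leq_ltn_trans (nn_lt r1 k0).
have sumE : (\sum_(1 <= j < n.+1) Fbar F m = n%:R * Fbar F m)%R.
  by rewrite sumr_const_nat subn1 mulr_natl.
have mE : measurable
    (crossing mu r b k `&` (~` event_A mu r b k `&` ~` event_B mu r b k)).
  apply: measurableI; first exact: measurable_crossing.
  apply: measurableI; apply: measurableC.
  - exact: measurable_event_A.
  - exact: measurable_event_B.
have q0 : (0 < n%:R * Fbar F m)%R by rewrite mulr_gt0// ltr0n.
rewrite /law3 (@integral_spread _ F (fun=> m) 0 n)//.
- rewrite sumE; apply: (@integral_count_ratio (fun=> m)) => //.
  move=> x [_ [_ /existsNP[i /not_implyP[ni /negP]]]].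
  by rewrite -leNgt => mi; exists i.
- move=> j; rewrite sumE; case: ifP => // _.
  by rewrite invfM mulrCA divff ?mulr1// gt_eqF.
- apply/measurable_EFinP; exact: measurable_Z3.
- move=> x; rewrite lee_fin; apply: mulr_ge0; last by rewrite indicE.
  by rewrite divr_ge0// ltW.
Qed.

End piece_means.

(** * The exponentially tilted estimator *)

Section tilted_mean.
Local Open Scope ereal_scope.
Context (R : realType) (F : probability R R) (mu : R) (r : nat).
Local Notation incr := (increments R).
Local Notation pi_ := (independent_increments (fun=> F)).
Variables (b : R) (k : nat).
Hypotheses (mu0 : (0 < mu)%R) (r1 : (1 < r)%N) (k0 : (0 < k)%N).
Local Notation n := (nn r k).
Local Notation a := (nn r k.-1).
Local Notation m := (level mu r b k).
Local Notation th := (theta F mu r b k).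
Local Notation La := (Lambda F mu r b k th).
Variable D : R.
Hypotheses (D0 : (0 < D)%R)
  (DE : \int[F]_(x in `]-oo, m[) (expR (th * x))%:E = D%:E).

Lemma expR_Lambda : expR La = D.
Proof. by rewrite /Lambda /Rintegral DE/= lnK. Qed.

Lemma measurable_tilt_density : measurable_fun [set: R] (tilt_density F mu r b k).
Proof.
apply: measurable_funM; last exact: measurable_indic.
apply: (@measurableT_comp _ _ _ _ _ _ expR) => //.
by apply: measurable_funB => //; exact: measurable_funM.
Qed.

Lemma tilt_density_ge0 x : (0 <= tilt_density F mu r b k x)%R.
Proof. by rewrite mulr_ge0 ?expR_ge0. Qed.

Lemma tiltT : tilt F mu r b k [set: R] = 1.
Proof.
rewrite /tilt; transitivity (\int[F]_(x in `]-oo, m[) ((D^-1)%:E * (expR (th * x))%:E)).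
  rewrite [RHS]integral_mkcond; apply: eq_integral => x _.
  rewrite epatch_indic /= -!EFinM /tilt_density expRD expRN expR_Lambda.
  by congr (_ * _)%:E; rewrite mulrC.
rewrite ge0_integralZl//; last 2 first.
- apply/measurable_EFinP; apply: measurable_funTS.
  by apply: (@measurableT_comp _ _ _ _ _ _ expR) => //; exact: measurable_funM.
- by rewrite lee_fin invr_ge0 ltW.
by rewrite DE -EFinM mulVf ?gt_eqF.
Qed.

(** The tilted measure has mass 1, by the choice of Lambda. *)
Lemma F_tiltedE A : measurable A ->
  F_tilted F mu r b k A = \int[F]_(x in A) (tilt_density F mu r b k x)%:E.
Proof.
move=> mA; rewrite /F_tilted /= /mnormalize /= tiltT eqe oner_eq0/=.
by rewrite invr1 mule1.
Qed.

(** The indicator of the increments below m. *)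
Definition below (m : R) (x : R) : R := \1_(`]-oo, m[%classic) x.

Lemma measurable_below c : measurable_fun [set: R] (below c).
Proof. exact: measurable_indic. Qed.

Lemma below_ge0 c x : (0 <= below c x)%R. Proof. by rewrite /below indicE. Qed.

Lemma indic_event_B x :
  \1_(event_B mu r b k) x = (\prod_(1 <= i < n.+1) below m (x i))%R.
Proof.
rewrite indicE; have [/set_mem H|/negP H] := boolP (x \in event_B mu r b k).
  rewrite big_nat_cond big1// => i; rewrite andbT ltnS => ni.
  by rewrite /below indicE mem_set//= in_itv/=; exact: H.
have /existsNP[i /not_implyP[ni /negP xi]] : ~ event_B mu r b k x.
  by move=> H'; apply: H; rewrite inE.
rewrite (bigD1_seq i)/= ?iota_uniq ?mem_index_iota// /below indicE memNset ?mul0r//=.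
by rewrite in_itv/=; exact/negP.
Qed.

Lemma switchE t x y i : hit mu b t x ->
  switch mu b (x, y) i = if (i <= t)%N then x i else y i.
Proof. by move=> /hit_tau tx; rewrite /switch/= tx lee_fin ler_nat. Qed.

(** Resampling the increments after the passage time leaves it unchanged. *)
Lemma hit_switch t x y : hit mu b t (switch mu b (x, y)) = hit mu b t x.
Proof.
have agree s : hit mu b s x -> hit mu b s (switch mu b (x, y)).
  move=> xs; rewrite -(_ : hit mu b s x = hit mu b s (switch mu b (x, y)))//.
  by apply: reads_hit => i /andP[_ is_]; rewrite (switchE _ _ xs) is_.
apply/propext; split; last exact: agree.
have [/tau_fin_hit[s xs] /hit_tau|] := pselect (tau mu b x < +oo).
  rewrite (hit_tau (agree _ xs)) => -[/eqP]; rewrite eqr_nat => /eqP <- //.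
move=> /negP; rewrite -leNgt leye_eq => /eqP xoo.
rewrite (_ : switch mu b (x, y) = x)//.
by apply/funext => i; rewrite /switch/= xoo leey.
Qed.

(** The value of the estimator at time t, read off the increments 1, ..., t. *)
Let U t (x : incr) : R :=
  (expR (- th * walk x t + t%:R * La) * \1_(hit mu b t) x
   * \prod_(1 <= i < t.+1) below m (x i))%R.

(** The requirement that the increments after time t stay below the level. *)
Let V t (x : incr) : R := (\prod_(t.+1 <= i < n.+1) below m (x i))%R.

Lemma Z2_at_switch t x y : (t <= n)%N ->
  Z2_at F mu r b k t (switch mu b (x, y)) = (U t x * V t y)%R.
Proof.
move=> tn; rewrite /Z2_at !indicE (_ : (_ \in hit mu b t) = (x \in hit mu b t)); last first.
  by apply/asboolP/asboolP; rewrite hit_switch.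
rewrite /U indicE.
have [/set_mem xt|_] := boolP (x \in hit mu b t); last by rewrite !(mulr0, mul0r).
have -> : walk (switch mu b (x, y)) t = walk x t.
  by rewrite /walk; apply: eq_big_nat => i /andP[_ it]; rewrite (switchE _ _ xt) -ltnS it.
rewrite !mulr1 -indicE indic_event_B (big_cat_nat (n := t.+1))//= -mulrA.
congr *%R; congr *%R.
  by apply: eq_big_nat => i /andP[i1 i2]; rewrite (switchE _ _ xt) -ltnS i2.
by apply: eq_big_nat => i /andP[i1 i2]; rewrite (switchE _ _ xt) leqNgt i1.
Qed.

Lemma measurable_U t : measurable_fun [set: incr] (U t).
Proof.
apply: measurable_funM; last first.
  by apply: (@measurable_prod_coord _ (fun=> below m)) => i; exact: measurable_below.
apply: measurable_funM; last by apply: measurable_indic; exact: measurable_hit.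
apply: (@measurableT_comp _ _ _ _ _ _ expR) => //.
by apply: measurable_funD => //; apply: measurable_funM => //; exact: measurable_walk.
Qed.

Lemma U_ge0 t x : (0 <= U t x)%R.
Proof.
rewrite /U; apply: mulr_ge0; last by apply: prodr_ge0 => i _; exact: below_ge0.
by rewrite mulr_ge0 ?expR_ge0// indicE.
Qed.

Lemma reads_U t : reads t (U t).
Proof.
move=> x y xy; rewrite /U (reads_walk xy) !indicE; congr (_ * _ * _)%R.
  congr (nat_of_bool _)%:R; apply/asboolP/asboolP; by rewrite (reads_hit _ _ xy).
by apply: eq_big_nat => i /andP[i1 i2]; rewrite xy// i1.
Qed.

Lemma measurable_V t : measurable_fun [set: incr] (V t).
Proof. by apply: (@measurable_prod_coord _ (fun=> below m)) => i; exact: measurable_below. Qed.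

Lemma V_ge0 t x : (0 <= V t x)%R.
Proof. by apply: prodr_ge0 => i _; exact: below_ge0. Qed.

(** Increments that are not read can be dropped. *)
Lemma integral_reads p (law : nat -> probability R R) t (f : incr -> \bar R) :
  (t <= p)%N -> measurable_fun [set: incr] f -> (forall x, 0 <= f x) -> reads t f ->
  \int[independent_increments law p]_x f x =
  \int[independent_increments law t]_x f x.
Proof.
move=> tp mf f0 rf.
have := @integral_incr_factor _ law (fun _ _ => 1%R) t p f.
rewrite [X in _ * X]big1 => [|i _]; last first.
  by rewrite integral_cst//= mul1e; exact: probability_setT.
rewrite mule1 => <- //.
by apply: eq_integral => x _; rewrite big1// mule1.
Qed.

(** The likelihood ratio cancels the tilt, and leaves the truncation of the
    increments 1, ..., t below the level. *)
Lemma mean_U t : (t <= n)%N ->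
  \int[independent_increments (fun=> F_tilted F mu r b k) n]_x (U t x)%:E =
  \int[pi_ t]_x (\1_(hit mu b t) x * \prod_(1 <= i < t.+1) below m (x i))%R%:E.
Proof.
move=> tn; have mU : measurable_fun [set: incr] (EFin \o U t).
  by apply/measurable_EFinP; exact: measurable_U.
rewrite (@integral_reads _ _ t)//; last 2 first.
- by move=> x; rewrite lee_fin U_ge0.
- by move=> x y xy; rewrite (reads_U xy).
rewrite (@integral_incr_density _ (fun=> F) _ (fun=> tilt_density F mu r b k))//.
- apply: eq_integral => x _; rewrite -EFinM; congr _%:E.
  have -> : (U t x * \prod_(1 <= i < t.+1) tilt_density F mu r b k (x i) =
      expR (- th * walk x t + t%:R * La) * \1_(hit mu b t) x *
      (expR (th * walk x t - t%:R * La) *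
       \prod_(1 <= i < t.+1) below m (x i)))%R.
    rewrite /U -mulrA -big_split/=; congr (_ * _)%R.
    rewrite (eq_bigr (fun i => expR (th * x i - La) * below m (x i))%R).
      rewrite big_split/= -expR_sum; congr (expR _ * _)%R.
      rewrite big_split/= -mulr_sumr -/(walk x t) sumr_const_nat subn1/=.
      by rewrite mulNrn mulr_natl.
    move=> i _; rewrite /tilt_density -/(below m (x i)) mulrCA; congr (_ * _)%R.
    by rewrite /below indicE -natrM mulnb andbb.
  rewrite mulrACA -expRD mulNr [X in expR X](_ : _ = 0)%R ?expR0 ?mul1r//.
  by rewrite addrACA addNr subrr addr0.
- by move=> i; exact: measurable_tilt_density.
- by move=> i x; exact: tilt_density_ge0.
- by move=> i _ A mA; exact: F_tiltedE.
- by move=> x; rewrite lee_fin U_ge0.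
Qed.

Lemma measurable_Z2_at t : measurable_fun [set: incr] (Z2_at F mu r b k t).
Proof.
apply: measurable_funM; last by apply: measurable_indic; exact: measurable_event_B.
apply: measurable_funM; last by apply: measurable_indic; exact: measurable_hit.
apply: (@measurableT_comp _ _ _ _ _ _ expR) => //.
by apply: measurable_funD => //; apply: measurable_funM => //; exact: measurable_walk.
Qed.

Lemma Z2_at_ge0 t x : (0 <= Z2_at F mu r b k t x)%R.
Proof. by rewrite /Z2_at !mulr_ge0 ?expR_ge0// indicE. Qed.

Lemma measurable_Z2 : measurable_fun [set: incr] (Z2 F mu r b k).
Proof.
rewrite (_ : Z2 F mu r b k = fun x =>
    \sum_(a.+1 <= t < n.+1) Z2_at F mu r b k t x)%R; last first.
  by apply/funext => x; rewrite Z2E// ltnW.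
by apply: measurable_sum => t; exact: measurable_Z2_at.
Qed.

(** The paths that first cross at time t with the increments 1, ..., t below
    the level. *)
Let H t (x : incr) : R :=
  (\1_(hit mu b t) x * \prod_(1 <= i < t.+1) below m (x i))%R.

Lemma mean_Z2_at t : (t <= n)%N ->
  \int[law2 F mu r b k]_x (Z2_at F mu r b k t x)%:E =
  \int[pi_ n]_x (\1_(hit mu b t `&` event_B mu r b k) x)%:E.
Proof.
move=> tn.
have mH : measurable_fun [set: incr] (EFin \o H t).
  apply/measurable_EFinP; apply: measurable_funM; last first.
    by apply: (@measurable_prod_coord _ (fun=> below m)) => i; exact: measurable_below.
  by apply: measurable_indic; exact: measurable_hit.
have H0 x : 0 <= (EFin \o H t) x.
  rewrite lee_fin mulr_ge0//.
  by apply: prodr_ge0 => i _; exact: below_ge0.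
have rH : reads t (EFin \o H t).
  move=> x y xy; rewrite /= /H !indicE; congr (_ * _)%R%:E.
    by congr (nat_of_bool _)%:R; apply/asboolP/asboolP; rewrite (reads_hit _ _ xy).
  by apply: eq_big_nat => i /andP[i1 i2]; rewrite xy// i1.
have mU : measurable_fun [set: incr] (EFin \o U t).
  by apply/measurable_EFinP; exact: measurable_U.
have mV : measurable_fun [set: incr] (EFin \o V t).
  by apply/measurable_EFinP; exact: measurable_V.
have mB (i : nat) : measurable_fun [set: R] (below m) by exact: measurable_below.
have B0 (i : nat) x : (0 <= below m x)%R by exact: below_ge0.
have IV : \int[pi_ n]_y (V t y)%:E = \prod_(t.+1 <= i < n.+1) \int[F]_y (below m y)%:E.
  have := @integral_incr_factor _ (fun=> F) (fun=> below m) t n (cst 1).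
  rewrite integral_cst//= mul1e [X in _ = X * _](_ : _ = 1) ?mul1e; last exact: probability_setT.
  move=> <- //. apply: eq_integral => x _; by rewrite mul1e.
transitivity (\int[independent_increments (fun=> F_tilted F mu r b k) n]_x
    \int[pi_ n]_y ((U t x)%:E * (V t y)%:E)).
  rewrite /law2 ge0_integral_distribution//; last 2 first.
  - by apply/measurable_EFinP; exact: measurable_Z2_at.
  - by move=> x; rewrite lee_fin Z2_at_ge0.
  rewrite fubini_tonelli1//; last 2 first.
  - apply: measurableT_comp; last exact: measurable_switch.
    by apply/measurable_EFinP; exact: measurable_Z2_at.
  - by move=> x; rewrite lee_fin Z2_at_ge0.
  apply: eq_integral => x _; apply: eq_integral => y _.
  by rewrite /= Z2_at_switch.
under eq_integral => x _.
  rewrite ge0_integralZl//; last 2 first.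
  - by move=> y _; rewrite lee_fin V_ge0.
  - by rewrite lee_fin U_ge0.
  over.
rewrite ge0_integralZr//; last 2 first.
- by move=> x _; rewrite lee_fin U_ge0.
- by apply: integral_ge0 => y _; rewrite lee_fin V_ge0.
rewrite mean_U// IV -[X in X * _]/(\int[pi_ t]_x (EFin \o H t) x).
rewrite -(@integral_incr_factor _ (fun=> F) (fun=> below m) t n (EFin \o H t))//.
apply: eq_integral => x _.
rewrite -EFinM; congr (_%:E); rewrite indicI/= indic_event_B.
by rewrite [in RHS](big_cat_nat (n := t.+1))//= /H mulrA.
Qed.

Lemma mean_Z2 : \int[law2 F mu r b k]_x (Z2 F mu r b k x)%:E =
  pi_ n (crossing mu r b k `&` event_B mu r b k).
Proof.
have r0 : (0 < r)%N by exact: ltnW.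
have mB t : measurable (hit mu b t `&` event_B mu r b k).
  by apply: measurableI; [exact: measurable_hit|exact: measurable_event_B].
under eq_integral => x _ do rewrite Z2E// -sumEFin.
rewrite ge0_integral_sum//; last 2 first.
- by move=> t; apply/measurable_EFinP; exact: measurable_Z2_at.
- by move=> t x _; rewrite lee_fin Z2_at_ge0.
transitivity (\sum_(a.+1 <= t < n.+1)
    \int[pi_ n]_x (\1_(hit mu b t `&` event_B mu r b k) x)%:E).
  by apply: eq_big_nat => t /andP[_ tn]; rewrite mean_Z2_at.
rewrite -ge0_integral_sum//; last first.
  by move=> t; apply/measurable_EFinP; apply: measurable_indic; exact: mB.
rewrite -[crossing mu r b k `&` _ in RHS]setIT -integral_indic//; last first.
  by apply: measurableI; [exact: measurable_crossing|exact: measurable_event_B].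
apply: eq_integral => x _; rewrite sumEFin; congr (_%:E).
rewrite indicI/= indic_crossing// mulr_suml; apply: eq_bigr => t _.
by rewrite indicI.
Qed.

End tilted_mean.

(** * The law of the path *)

Section path_law.
Local Open Scope ereal_scope.
Context (R : realType).
Local Notation incr := (increments R).

(** The paths whose increments all lie in prescribed sets. *)
Definition box (A : nat -> set R) : set incr := [set x | forall i, A i (x i)].

Lemma measurable_box A : (forall i, measurable (A i)) -> measurable (box A).
Proof.
move=> mA; rewrite (_ : box A = \bigcap_i (fun x : incr => x i) @^-1` A i).
  apply: bigcap_measurableType => // i _; rewrite -[X in measurable X]setTI.
  exact: (measurable_coord i).
by apply/seteqP; split=> x H i; [move=> _|]; exact: H.
Qed.

(** Boxes form a pi-system generating the sigma-algebra of the increments. *)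
Lemma increments_measure_unique (m1 m2 : probability incr R) :
  (forall A, (forall i, measurable (A i)) -> m1 (box A) = m2 (box A)) ->
  forall C, measurable C -> m1 C = m2 C.
Proof.
move=> m12 C mC.
pose G := [set box A | A in [set A | forall i, measurable (A i)]].
apply: (@g_sigma_algebra_measure_unique _ _ _ G _ (fun=> setT)).
- by move=> _ [A mA <-]; exact: measurable_box.
- by move=> _; exists (fun=> setT) => //; apply/seteqP; split.
- by apply/seteqP; split => // x _; exists 0%N.
- move=> _ _ [A mA <-] [B mB <-]; exists (fun i => A i `&` B i).
    by move=> i; exact: measurableI.
  apply/seteqP; split=> x.
    by move=> H; split=> i; have [] := H i.
  by move=> [H1 H2] i; split; [exact: H1|exact: H2].
- by move=> _ [A mA <-]; exact: m12.
- by move=> _; apply: (@le_lt_trans _ _ 1); [exact: probability_le1|exact: ltry].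
- apply: (smallest_sub (smallest_sigma_algebra _ _) _ mC).
  move=> _ [i [B [mB ->]]]; apply: sub_gen_smallest.
  exists (fun j => if j == i then B else setT).
    by move=> j; case: ifP.
  apply/seteqP; split=> x H /=; first by have := H i; rewrite eqxx.
  by move=> j; case: ifP => // /eqP ->.
Qed.

(** The increments outside 1, ..., n vanish, hence the first factor. *)
Lemma incr_box (m : nat -> probability R R) n A : (forall i, measurable (A i)) ->
  independent_increments m n (box A) =
  (if `[< forall i, ~~ (0 < i <= n)%N -> A i 0%R >] then 1 else 0) *
  \prod_(1 <= i < n.+1) m i (A i).
Proof.
elim: n A => [|n IH] A mA.
  rewrite big_geq// mule1 /= diracE; case: asboolP => H; first by rewrite mem_set//= => i; apply: H; case: i.
  rewrite memNset// => H'; apply: H => i _; exact: H'.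
pose A' i := if i == n.+1 then setT else A i.
have mA' i : measurable (A' i) by rewrite /A'; case: ifP.
transitivity ((independent_increments m n \x m n.+1) (box A' `*` A n.+1)).
  rewrite /= /distribution /pushforward; congr ((_ \x _) _).
  apply/seteqP; split=> -[x y] /=.
    move=> H; split; last by have := H n.+1; rewrite set_coordE eqxx.
    move=> i; rewrite /A'; case: ifP => // ni.
    by have := H i; rewrite set_coordE ni.
  move=> [H Hy] i; rewrite set_coordE; case: ifP => [/eqP ->//|ni].
  by have := H i; rewrite /A' ni.
rewrite product_measure1E//; last exact: measurable_box.
rewrite [in RHS]big_nat_recr//= muleA; congr (_ * _).
apply: (eq_trans (IH _ mA')); congr (_ * _).
  suff -> : (forall i, ~~ (0 < i <= n)%N -> A' i 0%R) =
     (forall i, ~~ (0 < i <= n.+1)%N -> A i 0%R) by [].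
  apply/propext; split=> H i ni.
    have := H i; rewrite /A' ifN; last first.
      by apply/eqP => ein; move: ni; rewrite ein ltnSn.
    by apply; apply: contra ni => /andP[-> /=]; exact: leqW.
  rewrite /A'; case: ifP => // /negbT ni'; apply: H.
  by apply: contra ni => /andP[-> /=]; rewrite leq_eqVlt (negbTE ni').
by apply: eq_big_nat => i /andP[_ ni]; rewrite /A' ltn_eqF.
Qed.

Context d (T : measurableType d) (P : probability T R).
Variable X : nat -> {RV P >-> R}.
Let F : probability R R := distribution P (X 0%N).
Hypothesis indep : mutually_independent X.
Hypothesis idist : identically_distributed X.

Lemma measurable_path : measurable_fun [set: T] (fun w => (fun i => X i w) : incr).
Proof. by apply: measurable_to_increments => i; exact: measurable_funP. Qed.

(** The path of the random variables, with the increments other than 1, ..., n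
    set to 0 as in [independent_increments]. *)
Definition cut_path n (w : T) : incr := fun i => if (0 < i <= n)%N then X i w else 0%R.

Lemma measurable_cut_path n : measurable_fun [set: T] (cut_path n).
Proof.
apply: measurable_to_increments => i; rewrite /cut_path.
by case: (0 < i <= n)%N; [exact: measurable_funP|exact: measurable_cst].
Qed.

HB.instance Definition _ n :=
  isMeasurableFun.Build _ _ _ _ (cut_path n) (measurable_cut_path n).

Lemma cut_path_law n C : measurable C ->
  P (cut_path n @^-1` C) = independent_increments (fun=> F) n C.
Proof.
move: C; apply: (@increments_measure_unique (distribution P (cut_path n))).
move=> A mA; rewrite incr_box// /distribution /pushforward.
have FE i : F (A i) = P (X i @^-1` A i) by exact: idist.
rewrite (eq_bigr _ (fun i _ => FE i)) -indep ?iota_uniq//.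
case: asboolP => H.
  rewrite mul1e; congr (P _); apply/seteqP; split=> w.
    rewrite -bigcap_seq => H' i /=; rewrite mem_index_iota ltnS => ni.
    have <- : cut_path n w i = X i w by rewrite /cut_path ni.
    exact: H'.
  rewrite -bigcap_seq => H' i; change (A i (cut_path n w i)).
  have [ni|ni] := boolP (0 < i <= n)%N.
    have -> : cut_path n w i = X i w by rewrite /cut_path ni.
    by apply: H'; rewrite /= mem_index_iota ltnS.
  have -> : cut_path n w i = 0%R by rewrite /cut_path (negbTE ni).
  exact: H.
rewrite mul0e; change (P (cut_path n @^-1` box A) = 0).
rewrite (_ : _ @^-1` _ = set0) ?measure0//.
apply/seteqP; split=> // w H'; apply: H => i ni.
have <- : cut_path n w i = 0%R by rewrite /cut_path (negbTE ni).
exact: H'.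
Qed.

(** Events that depend on the increments 1, ..., n only. *)
Lemma path_law n C : measurable C -> reads n (C : incr -> Prop) ->
  P [set w | C (fun i => X i w)] = independent_increments (fun=> F) n C.
Proof.
move=> mC rC; rewrite -cut_path_law//; congr (P _).
apply/funext => w; apply: rC => i ni; by rewrite /cut_path ni.
Qed.

End path_law.

(** * The mean of the randomized estimator *)

Section product_means.
Local Open Scope ereal_scope.
Context d1 d2 (T1 : measurableType d1) (T2 : measurableType d2) (R : realType).
Variables (m1 : probability T1 R) (m2 : probability T2 R).

Lemma ge0_integral_fst (f : T1 -> \bar R) : measurable_fun [set: T1] f ->
  (forall x, 0 <= f x) -> \int[(m1 \x m2)%E]_z f z.1 = \int[m1]_x f x.
Proof.
move=> mf f0; rewrite fubini_tonelli1//.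
  apply: eq_integral => x _; rewrite /fubini_F/= integral_cst//.
  by rewrite [X in _ * X](_ : _ = 1) ?mule1//; exact: probability_setT.
exact: (measurableT_comp mf measurable_fst).
Qed.

Lemma ge0_integral_snd (f : T2 -> \bar R) : measurable_fun [set: T2] f ->
  (forall x, 0 <= f x) -> \int[(m1 \x m2)%E]_z f z.2 = \int[m2]_x f x.
Proof.
move=> mf f0; rewrite fubini_tonelli1//.
  rewrite (eq_integral (cst (\int[m2]_y f y)))// integral_cst//.
  by rewrite [X in _ * X](_ : _ = 1) ?mule1//; exact: probability_setT.
exact: (measurableT_comp mf measurable_snd).
Qed.

End product_means.

Lemma measurable_nat_sections d d' (T : measurableType d) (U : measurableType d')
    (f : nat * T -> U) :
  (forall k, measurable_fun [set: T] (fun x => f (k, x))) ->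
  measurable_fun [set: nat * T] f.
Proof.
move=> mf _ B mB; rewrite setTI.
rewrite (_ : f @^-1` B = \bigcup_k ([set k] `*` ((fun x => f (k, x)) @^-1` B))).
  apply: bigcup_measurable => k _; apply: measurableX => //.
  by rewrite -[X in measurable X]setTI; exact: mf.
apply/seteqP; split=> [[k x] /= fkx|[k x] [j _ [/= -> //]]].
by exists k.
Qed.

Section simulation_mean.
Local Open Scope ereal_scope.
Context (R : realType) (F : probability R R) (mu : R) (r : nat).
Variables (p : nat -> R) (b : R).
Hypothesis pmf : is_pmf p.
Local Notation incr := (increments R).
Local Notation run := (nat * (incr * incr * incr))%type.

Let w k : R := if (0 < k)%N then p k else 0%R.

Lemma eseries_from1 (u : nat -> \bar R) : (forall k, 0 <= u k) ->
  \sum_(k <oo) (if (0 < k)%N then u k else 0) = \sum_(1 <= k <oo) u k.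
Proof.
move=> u0; rewrite (@nneseries_split _ _ 0 1); last first.
  by move=> k _; case: ifP.
rewrite big_nat1/= add0e add0n.
rewrite eseries_cond [RHS]eseries_cond.
by apply: eq_eseriesr => -[|k].
Qed.

Lemma weight_ge0 k : (0 <= w k)%R.
Proof. by rewrite /w; case: ifP => // /pmf.1 /ltW. Qed.

Lemma weight_sum1 : \sum_(k <oo) (w k)%:E = 1.
Proof.
rewrite -pmf.2.
transitivity (\sum_(k <oo) (if (0 < k)%N then (w k)%:E else 0)).
  by apply: eq_eseriesr => -[|k].
rewrite eseries_from1; last by move=> k; rewrite lee_fin weight_ge0.
rewrite eseries_cond [RHS]eseries_cond.
by apply: eq_eseriesr => -[|k].
Qed.

Lemma integral_Q (f : run -> \bar R) :
  measurable_fun [set: run] f -> (forall x, 0 <= f x) ->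
  \int[Q F mu r p b]_x f x =
  \sum_(k <oo) (w k)%:E *
    \int[(law1 F mu r b k \x law2 F mu r b k \x law3 F mu r b k)%E]_z f (k, z).
Proof.
move=> mf f0; rewrite /Q ge0_integral_mixture//; last 2 first.
- exact: weight_ge0.
- exact: weight_sum1.
apply: eq_eseriesr => k _; congr (_ * _).
rewrite fubini_tonelli1// integral_dirac ?diracT ?mul1e//.
Qed.

Hypotheses (mu0 : (0 < mu)%R) (r1 : (1 < r)%N).
(** No atoms and a positive tail beyond b, and exponential tilts of positive finite mass. *)
Hypothesis tailF : forall c, (b <= c)%R ->
  F `[c, +oo[%classic = (Fbar F c)%:E /\ (0 < Fbar F c)%R.
Hypothesis tiltF : forall k, (0 < k)%N -> exists2 D : R, (0 < D)%R &
  \int[F]_(x in `]-oo, level mu r b k[) (expR (theta F mu r b k * x))%:E = D%:E.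

Lemma Z1_ge0 k x : (0 <= Z1 F mu r b k x)%R.
Proof.
apply: mulr_ge0; last by rewrite indicE.
apply: divr_ge0 => //; apply: sumr_ge0 => i _; exact: fine_ge0.
Qed.

Lemma Z2_ge0 k x : (0 <= Z2 F mu r b k x)%R.
Proof. by apply: mulr_ge0; rewrite ?expR_ge0// indicE. Qed.

Lemma Z3_ge0 k x : (0 <= Z3 F mu r b k x)%R.
Proof.
apply: mulr_ge0; last by rewrite indicE.
by apply: divr_ge0 => //; apply: mulr_ge0 => //; exact: fine_ge0.
Qed.

Lemma measurable_Z : measurable_fun [set: run] (Z F mu r p b).
Proof.
apply: measurable_nat_sections => k.
apply: measurable_funM; last by rewrite /=; exact: measurable_cst.
apply: measurable_funD.
  apply: measurable_funD.
    apply: (measurableT_comp (measurable_Z1 F mu r b k)).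
    exact: (measurableT_comp measurable_fst measurable_fst).
  apply: (measurableT_comp (measurable_Z2 F mu b k r1)).
  exact: (measurableT_comp measurable_snd measurable_fst).
exact: (measurableT_comp (measurable_Z3 F mu r b k) measurable_snd).
Qed.

Lemma crossing0 : crossing mu r b 0 = set0.
Proof.
apply/seteqP; split=> // x; rewrite /crossing /= => /andP[a1 a2].
by have := lt_le_trans a1 a2; rewrite ltxx.
Qed.

Lemma Z_ge0 x : (0 <= Z F mu r p b x)%R.
Proof.
case: x => -[|k] [[x1 x2] x3]; rewrite /Z /=.
  by rewrite /Z1 /Z2 /Z3 crossing0 !set0I indic0 /= !mulr0 !addr0 mul0r.
rewrite divr_ge0//; last by apply/ltW/pmf.1.
by rewrite !addr_ge0// ?Z1_ge0 ?Z2_ge0 ?Z3_ge0.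
Qed.

(** The crossing event is the disjoint union of three pieces: an increment in
    A_k exceeds the level, so that A_k and B_k are incompatible. *)
Lemma indic_pieces k :
  independent_increments (fun=> F) (nn r k) (crossing mu r b k) =
  independent_increments (fun=> F) (nn r k)
    (crossing mu r b k `&` event_A mu r b k) +
  independent_increments (fun=> F) (nn r k)
    (crossing mu r b k `&` event_B mu r b k) +
  independent_increments (fun=> F) (nn r k)
    (crossing mu r b k `&` (~` event_A mu r b k `&` ~` event_B mu r b k)).
Proof.
set C := crossing mu r b k; set A := event_A mu r b k; set B := event_B mu r b k.
have mC : measurable C by exact: measurable_crossing.
have mA : measurable A by exact: measurable_event_A.
have mB : measurable B by exact: measurable_event_B.
have AB x : A x -> ~ B x.
  move=> [i /andP[ai ni] bi] /(_ i); rewrite ni (leq_ltn_trans _ ai)//.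
  move=> /(_ isT); apply/negP; rewrite -leNgt; apply: le_trans (ltW bi).
  by rewrite /level lerD2l ler_wpM2r ?(ltW mu0)// ler_nat ltnW.
have mE : measurable (~` A `&` ~` B) by apply: measurableI; exact: measurableC.
rewrite -measureU//; first last.
- by apply/seteqP; split => // x [[_ Ax] [_ Bx]]; exact: AB Bx.
- exact: measurableI.
- exact: measurableI.
rewrite -measureU//; first last.
- by apply/seteqP; split => // x [[[_ Ax]|[_ Bx]] [_ [nAx nBx]]].
- exact: measurableI.
- by apply: measurableU; exact: measurableI.
congr (_ _); apply/seteqP; split=> x; last by move=> [[[]|[]]|[]].
move=> Cx; have [Ax|nAx] := pselect (A x); first by left; left.
have [Bx|nBx] := pselect (B x); first by left; right.
by right.
Qed.

(** Dividing by p_k undoes the randomization of the block. *)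
Lemma expectation_Z :
  'E_(Q F mu r p b)[Z F mu r p b] =
  \sum_(k <oo) independent_increments (fun=> F) (nn r k) (crossing mu r b k).
Proof.
have mZ1 k : measurable_fun [set: incr] (EFin \o Z1 F mu r b k).
  by apply/measurable_EFinP; exact: measurable_Z1.
have mZ2 k : measurable_fun [set: incr] (EFin \o Z2 F mu r b k).
  by apply/measurable_EFinP; exact: measurable_Z2.
have mZ3 k : measurable_fun [set: incr] (EFin \o Z3 F mu r b k).
  by apply/measurable_EFinP; exact: measurable_Z3.
have Z10 k x : 0 <= (EFin \o Z1 F mu r b k) x by rewrite lee_fin Z1_ge0.
have Z20 k x : 0 <= (EFin \o Z2 F mu r b k) x by rewrite lee_fin Z2_ge0.
have Z30 k x : 0 <= (EFin \o Z3 F mu r b k) x by rewrite lee_fin Z3_ge0.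
rewrite unlock integral_Q; last 2 first.
- by apply/measurable_EFinP; exact: measurable_Z.
- by move=> x; rewrite lee_fin Z_ge0.
apply: eq_eseriesr => -[_|k _]; first by rewrite mul0e crossing0 measure0.
have pk : (0 < p k.+1)%R by exact: pmf.1.
have [D D0 DE] := tiltF (ltn0Sn k).
pose f1 (z : incr * incr) := (EFin \o Z1 F mu r b k.+1) z.1.
pose f2 (z : incr * incr) := (EFin \o Z2 F mu r b k.+1) z.2.
have mf1 : measurable_fun [set: incr * incr] f1.
  exact: (measurableT_comp (mZ1 _) measurable_fst).
have mf2 : measurable_fun [set: incr * incr] f2.
  exact: (measurableT_comp (mZ2 _) measurable_snd).
rewrite (eq_integral (fun z => (p k.+1)^-1%:E *
    (f1 z.1 + f2 z.1 + (EFin \o Z3 F mu r b k.+1) z.2))); last first.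
  by move=> z _; rewrite /= -!EFinD -EFinM mulrC.
rewrite ge0_integralZl//; last 3 first.
- apply: emeasurable_funD; last exact: (measurableT_comp (mZ3 _) measurable_snd).
  apply: emeasurable_funD; first exact: (measurableT_comp mf1 measurable_fst).
  exact: (measurableT_comp mf2 measurable_fst).
- by move=> z _; apply: adde_ge0; [apply: adde_ge0; [exact: Z10|exact: Z20]|exact: Z30].
- by rewrite lee_fin invr_ge0 ltW.
rewrite muleA -EFinM divff ?gt_eqF// mul1e.
have g10 (z : incr * incr * incr) : [set: incr * incr * incr] z -> 0 <= f1 z.1.
  by move=> _; exact: Z10.
have g20 (z : incr * incr * incr) : [set: incr * incr * incr] z -> 0 <= f2 z.1.
  by move=> _; exact: Z20.
have g120 (z : incr * incr * incr) :
    [set: incr * incr * incr] z -> 0 <= f1 z.1 + f2 z.1.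
  by move=> _; apply: adde_ge0; [exact: Z10|exact: Z20].
have g30 (z : incr * incr * incr) : [set: incr * incr * incr] z ->
    0 <= (EFin \o Z3 F mu r b k.+1) z.2.
  by move=> _; exact: Z30.
have mg1 : measurable_fun [set: incr * incr * incr] (fun z => f1 z.1).
  exact: (measurableT_comp mf1 measurable_fst).
have mg2 : measurable_fun [set: incr * incr * incr] (fun z => f2 z.1).
  exact: (measurableT_comp mf2 measurable_fst).
have mg3 : measurable_fun [set: incr * incr * incr]
    (fun z => (EFin \o Z3 F mu r b k.+1) z.2).
  exact: (measurableT_comp (mZ3 _) measurable_snd).
have mg12 : measurable_fun [set: incr * incr * incr] (fun z => f1 z.1 + f2 z.1).
  exact: emeasurable_funD.
rewrite (ge0_integralD _ measurableT g120 mg12 g30 mg3).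
rewrite (ge0_integralD _ measurableT g10 mg1 g20 mg2).
rewrite (ge0_integral_fst _ _ mf1); last by move=> z; exact: Z10.
rewrite (ge0_integral_fst _ _ mf2); last by move=> z; exact: Z20.
rewrite (ge0_integral_fst _ _ (mZ1 _))//.
rewrite (ge0_integral_snd _ _ (mZ2 _))//.
rewrite (ge0_integral_snd _ _ (mZ3 _))//.
rewrite indic_pieces; congr (_ + _ + _).
- exact: mean_Z1.
- exact: mean_Z2 D0 DE.
- exact: mean_Z3.
Qed.

End simulation_mean.

(** * The passage probability *)

Section passage_probability.
Local Open Scope ereal_scope.
Context (R : realType) d (T : measurableType d) (P : probability T R).
Local Notation incr := (increments R).
Variable X : nat -> {RV P >-> R}.
Let F : probability R R := distribution P (X 0%N).
Hypothesis indep : mutually_independent X.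
Hypothesis idist : identically_distributed X.
Variables (mu : R) (r : nat) (b : R).
Local Notation path w := ((fun i => X i w) : incr).
Local Notation pi_ := (independent_increments (fun=> F)).

Lemma measurable_path_preimage (C : set incr) :
  measurable C -> measurable [set w | C (path w)].
Proof.
move=> mC; rewrite -[X in measurable X]setTI; exact: (measurable_path X).
Qed.

Lemma reads_crossing k : (0 < r)%N -> reads (nn r k) (crossing mu r b k : incr -> Prop).
Proof.
move=> r0 x y xy; rewrite crossingE /setD /mkset (@reads_ge_tau _ _ _ _ x y xy).
by rewrite (reads_le (nn_le k r0) (@reads_ge_tau _ mu b (nn r k.-1)) xy).
Qed.

Lemma nn_leq i j : (0 < r)%N -> (i <= j)%N -> (nn r i <= nn r j)%N.
Proof.
move=> r0; elim: j => [|j IH]; first by rewrite leqn0 => /eqP ->.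
rewrite leq_eqVlt => /predU1P[->//|/IH ij].
by apply: (leq_trans ij); exact: (@nn_le r j.+1 r0).
Qed.

(** The blocks partition the passage event, as 0 < b excludes tau = 0. *)
Lemma passage_probE : (1 < r)%N -> (0 < b)%R ->
  P [set w | tau mu b (path w) < +oo] =
  \sum_(k <oo) pi_ (nn r k) (crossing mu r b k).
Proof.
move=> r1 b0; have r0 : (0 < r)%N by exact: ltnW.
rewrite (_ : [set w | _] = \bigcup_k [set w | crossing mu r b k (path w)]).
  rewrite measure_bigcup//.
  - rewrite eseries_mkcond; apply: eq_eseriesr => k _.
    rewrite mem_set//; apply: path_law => //; first exact: measurable_crossing.
    exact: reads_crossing.
  - by move=> k _; apply: measurable_path_preimage; exact: measurable_crossing.
  - apply/trivIsetP => i j _ _.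
    wlog ij : i j / (i < j)%N => [H|_].
      move=> /[dup] nij; rewrite neq_ltn => /orP[ij|ji]; first exact: H.
      by rewrite setIC; apply: H; rewrite // eq_sym.
    apply/seteqP; split=> // w [/= /andP[_ h1] /andP[h2 _]].
    have := lt_le_trans h2 h1; rewrite lte_fin ltr_nat ltnNge nn_leq//.
    by rewrite -ltnS prednK// (leq_ltn_trans _ ij).
apply/seteqP; split=> w /=; last first.
  by move=> [k _ /andP[_ /le_lt_trans]]; apply; exact: ltry.
move=> /tau_fin_hit[t ht]; have tt := hit_tau ht.
have t0 : (0 < t)%N.
  by case: t ht {tt} => // -[_ H]; exfalso; apply: H; exact: ge_tau1.
have /ex_minnP[k tk kmin] : exists k, (t <= nn r k)%N.
  exists t; case: t t0 {ht tt} => // t _ /=; apply: ltnW; exact: ltn_expl.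
exists k => //; rewrite /crossing /= tt lte_fin lee_fin ltr_nat ler_nat tk andbT.
case: k tk kmin => [|k] tk kmin; first by rewrite leqNgt t0 in tk.
by rewrite ltnNge /=; apply/negP => /kmin; rewrite ltnn.
Qed.

(** The first absolute moment of the increments. *)
Let M1 := (\int[P]_w `|X 0%N w|%:E).

(** The walk is not far below 0 at time j, it has not crossed before, and the
    next increment is large: then it crosses at time j + 1. *)
Let late_jump (K c : R) j : set incr :=
  [set x | ge_tau mu b j.+1 x /\ (- K < walk x j)%R] `&` [set x | (c < x j.+1)%R].

Lemma measurable_walk_gt (c : R) j : measurable [set x : incr | (c < walk x j)%R].
Proof.
rewrite -[X in measurable X]setTI.
rewrite (_ : [set x | _] = (fun x : incr => walk x j) @^-1` `]c, +oo[%classic).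
  by apply: measurable_walk => //; exact: measurable_itv.
by apply/seteqP; split=> x /=; rewrite in_itv/= andbT.
Qed.

Lemma measurable_walk_le (c : R) j : measurable [set w | (walk (path w) j <= c)%R].
Proof.
rewrite (_ : [set w | _] = ~` [set w | [set x | (c < walk x j)%R] (path w)]).
  by apply: measurableC; apply: measurable_path_preimage; exact: measurable_walk_gt.
by apply/seteqP; split=> w /=; [rewrite leNgt => /negP|move=> /negP; rewrite -leNgt].
Qed.

Lemma measurable_coord_gt (c : R) j : measurable [set x : incr | (c < x j)%R].
Proof.
rewrite -[X in measurable X]setTI.
rewrite (_ : [set x | _] = (fun x : incr => x j) @^-1` `]c, +oo[%classic).
  by apply: measurable_coord => //; exact: measurable_itv.
by apply/seteqP; split=> x /=; rewrite in_itv/= andbT.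
Qed.

(** The increment of index j + 1 is independent of the past. *)
Lemma path_next_gt (A : set incr) (c : R) j : measurable A -> reads j (A : incr -> Prop) ->
  P [set w | (A `&` [set x | c < x j.+1])%R (path w)] =
  P [set w | A (path w)] * (Fbar F c)%:E.
Proof.
move=> mA rA.
have rAj : reads j.+1 (A `&` [set x | c < x j.+1]%R : incr -> Prop).
  move=> x y xy; rewrite /setI /mkset (reads_le (leqnSn j) rA xy).
  by rewrite xy// ltnSn.
rewrite (path_law indep idist _ rAj); last first.
  by apply: measurableI => //; exact: measurable_coord_gt.
rewrite (path_law indep idist mA rA) -/F.
have mAB : measurable (A `&` [set x | c < x j.+1]%R).
  by apply: measurableI => //; exact: measurable_coord_gt.
have mh (i : nat) : measurable_fun [set: R] (\1_(`]c, +oo[%classic) : R -> R).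
  exact: measurable_indic.
have H : \int[pi_ j.+1]_x ((\1_A x)%:E *
    (\prod_(j.+1 <= i < j.+2) \1_(`]c, +oo[%classic) (x i))%R%:E) =
    pi_ j A * F `]c, +oo[%classic.
  rewrite (@integral_incr_factor _ (fun=> F) (fun=> \1_(`]c, +oo[%classic)) j
    j.+1 (fun x => (\1_A x)%:E))//.
  - by rewrite big_nat1 integral_indic// integral_indic// !setIT.
  - by apply/measurable_EFinP; exact: measurable_indic.
  - move=> x y xy; rewrite !indicE; congr (nat_of_bool _)%:R%:E.
    by apply/asboolP/asboolP; rewrite (rA _ _ xy).
have -> : (Fbar F c)%:E = F `]c, +oo[%classic.
  by rewrite /Fbar fineK// fin_num_measure.
rewrite -H.
have -> : pi_ j.+1 (A `&` [set x | c < x j.+1]%R) =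
    \int[pi_ j.+1]_x (\1_(A `&` [set x | c < x j.+1]%R) x)%:E.
  by rewrite integral_indic ?setIT.
apply: eq_integral => x _; rewrite big_nat1 -EFinM indicI.
congr (_ * _)%:E; rewrite !indicE; congr (nat_of_bool _)%:R.
by apply/asboolP/asboolP; rewrite /= in_itv/= andbT.
Qed.

Lemma mean_abs i : \int[P]_w `|X i w|%:E = M1.
Proof.
rewrite /M1.
rewrite -[LHS](@ge0_integral_distribution _ _ _ _ _ P (X i) (fun x => `|x|%:E))//; last first.
  by apply/measurable_EFinP.
rewrite -[RHS](@ge0_integral_distribution _ _ _ _ _ P (X 0%N) (fun x => `|x|%:E))//; last first.
  by apply/measurable_EFinP.
by apply: eq_measure_integral => A mA _; exact: idist.
Qed.

(** Markov's inequality for the sum of the absolute increments. *)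
Lemma walk_low (K : R) j : (0 < K)%R ->
  K%:E * P [set w | (walk (path w) j <= - K)%R] <= j%:R%:E * M1.
Proof.
move=> K0.
have mS := measurable_walk_le (- K) j.
have mX i : measurable_fun [set: T] (fun w => `|X i w|%:E).
  by apply/measurable_EFinP; exact: measurableT_comp.
rewrite -[in leLHS](setIT [set w | _]) -integral_indic// -ge0_integralZl//; last 2 first.
- by apply/measurable_EFinP; exact: measurable_indic.
- by rewrite lee_fin ltW.
have -> : j%:R%:E * M1 = \int[P]_w \sum_(1 <= i < j.+1) `|X i w|%:E.
  rewrite ge0_integral_sum//.
  rewrite (eq_bigr (fun=> M1)); last by move=> i _; exact: mean_abs.
  by rewrite big_const_nat subn1 iter_addr_0 mule_natl.
apply: ge0_le_integral => //.
- by move=> w _; rewrite mule_ge0// lee_fin// ltW.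
- by apply: measurable_funeM; apply/measurable_EFinP; exact: measurable_indic.
- by apply: emeasurable_sum.
move=> w _; rewrite sumEFin -EFinM lee_fin indicE.
have [/set_mem /= wK|_] := boolP (_ \in _); last by rewrite mulr0 sumr_ge0.
rewrite mulr1; apply: (@le_trans _ _ (- walk (path w) j)%R); first by rewrite lerNr.
rewrite /walk; apply: (le_trans (ler_norm _)); rewrite normrN.
exact: ler_norm_sum.
Qed.

Lemma late_jump_hit (K c : R) j : (b + j.+1%:R * mu <= c - K)%R ->
  late_jump K c j `<=` hit mu b j.+1.
Proof.
move=> cK x [[xge xK] xc]; split=> //= /ge_tauP /(_ j.+1 (ltnSn _)).
apply/negP; rewrite -ltNge /walk big_nat_recr//= -/(walk x j).
rewrite ltrBrDr; apply: le_lt_trans cK _.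
by rewrite addrC; exact: ltrD.
Qed.

Lemma trivIset_hit : trivIset [set: nat] (fun j => [set w | hit mu b j (path w)]).
Proof.
apply/trivIsetP => i j _ _ ij; apply/seteqP; split=> // w [hi hj].
have := hit_tau hi; rewrite (hit_tau hj) => -[/eqP].
by rewrite eqr_nat eq_sym (negbTE ij).
Qed.

Lemma measurable_passage : measurable [set w | tau mu b (path w) < +oo].
Proof.
rewrite (_ : [set w | _] = \bigcup_j [set w | hit mu b j (path w)]).
  by apply: bigcup_measurable => j _; apply: measurable_path_preimage; exact: measurable_hit.
apply/seteqP; split=> w /=.
  by move=> /tau_fin_hit[t ht]; exists t.
by move=> [j _ /hit_tau ->]; exact: ltry.
Qed.

Let pp : R := passage_prob X mu b.

Lemma passage_probEFin : P [set w | tau mu b (path w) < +oo] = pp%:E.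
Proof.
rewrite /pp /passage_prob fineK// fin_num_measure//; exact: measurable_passage.
Qed.

(** With probability at least 1/2 - P (tau < oo), the walk has not crossed by
    time j and is not far below 0; the next increment is independent of this. *)
Lemma late_jump_prob (K c : R) j : (0 < K)%R -> j%:R%:E * M1 <= (K / 2)%:E ->
  ((2^-1 - pp) * Fbar F c)%:E <= P [set w | late_jump K c j (path w)].
Proof.
move=> K0 jM.
pose A := [set x : incr | ge_tau mu b j.+1 x /\ (- K < walk x j)%R].
have mA : measurable A.
  by apply: measurableI; [exact: measurable_ge_tau|exact: measurable_walk_gt].
have rA : reads j (A : incr -> Prop).
  move=> x y xy; rewrite /A /mkset (@reads_ge_tau _ _ _ _ x y xy).
  by rewrite (@reads_walk _ _ x y xy).
rewrite /late_jump (path_next_gt c mA rA) EFinM.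
apply: lee_wpmul2r; first by rewrite lee_fin; exact: fine_ge0.
have mge : measurable [set w | ge_tau mu b j.+1 (path w)].
  by apply: measurable_path_preimage; exact: measurable_ge_tau.
have mlo := measurable_walk_le (- K) j.
have mfin := measurable_passage.
have lo : P [set w | (walk (path w) j <= - K)%R] <= 2^-1%:E.
  have := le_trans (walk_low j K0) jM.
  have fl : P [set w | (walk (path w) j <= - K)%R] \is a fin_num by exact: fin_num_measure.
  by rewrite -(fineK fl) -EFinM !lee_fin mulrC -ler_pdivlMr// mulrAC divff ?gt_eqF// mul1r.
have := measureU2 P mfin mlo; set U := _ `|` _ => PU.
have mU : measurable U by exact: measurableU.
have : P (~` U) <= P [set w | A (path w)].
  apply: le_measure; rewrite ?inE; [exact: measurableC|exact: measurable_path_preimage|].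
  move=> w /= /not_orP[w1 w2]; split; last by rewrite ltNge; apply/negP.
  apply: contrapT => /tau_leP h; apply: w1; apply: le_lt_trans h _; exact: ltry.
apply: le_trans; rewrite probability_setC// leeBrDr//; last exact: fin_num_measure.
apply: (@le_trans _ _ ((2^-1 - pp)%:E + (pp%:E + 2^-1%:E))).
  rewrite leeD2l//; apply: (le_trans PU); rewrite -passage_probEFin.
  exact: leeD2l.
by rewrite -!EFinD lee_fin; lra.
Qed.

End passage_probability.

Lemma Fbar_ge0 (R : realType) (F : probability R R) x : 0 <= Fbar F x.
Proof. exact: fine_ge0. Qed.

Lemma FbarE (R : realType) (F : probability R R) x :
  F `]x, +oo[%classic = (Fbar F x)%:E.
Proof. by rewrite /Fbar fineK// fin_num_measure. Qed.

(** Markov's inequality for the tail. *)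
Lemma Fbar_markov (R : realType) (F : probability R R) (m1 c : R) :
  (\int[F]_x `|x|%:E = m1%:E)%E -> 0 < c -> c * Fbar F c <= m1.
Proof.
move=> Fm1 c0; rewrite -lee_fin -Fm1 EFinM -FbarE.
rewrite -[X in F X]setIT -integral_indic// -ge0_integralZl//; last 2 first.
- by apply/measurable_EFinP; exact: measurable_indic.
- by rewrite lee_fin ltW.
apply: ge0_le_integral => //.
- by move=> x _; rewrite mule_ge0// lee_fin// ltW.
- by apply: measurable_funeM; apply/measurable_EFinP; exact: measurable_indic.
- by apply/measurable_EFinP.
move=> x _; rewrite -EFinM lee_fin indicE.
have [/set_mem /=|_] := boolP (_ \in _); last by rewrite mulr0.
by rewrite in_itv/= andbT mulr1 => /ltW cx; rewrite (le_trans cx)// ler_norm.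
Qed.

Section increment_law.
Context d (T : measurableType d) (R : realType) (P : probability T R).
Variable X : {RV P >-> R}.
Let F : probability R R := distribution P X.
Hypothesis X1 : P.-integrable [set: T] (EFin \o X).

Lemma law_integrable : F.-integrable [set: R] (fun x : R => x%:E).
Proof.
have /integrableP[_ fin] := X1.
apply/integrableP; split; first exact/measurable_EFinP.
rewrite (@ge0_integral_distribution _ _ _ _ _ P X (fun x => `|x%:E|)%E)//.
by apply: measurableT_comp => //; exact/measurable_EFinP.
Qed.

Lemma law_mean : (\int[F]_x x%:E = 'E_P[X])%E.
Proof.
rewrite unlock (@integral_distribution _ _ _ _ _ P X (fun x => x%:E))//.
exact/measurable_EFinP.
Qed.

Lemma law_abs : exists2 m : R, 0 <= m & (\int[F]_x `|x|%:E = m%:E)%E.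
Proof.
have /integrableP[_ fin] := law_integrable.
have ge0 : (0 <= \int[F]_x `|x|%:E)%E by exact: integral_ge0.
exists (fine (\int[F]_x `|x|%:E)%E); first exact: fine_ge0.
by rewrite fineK// ge0_fin_numE.
Qed.

End increment_law.

(** The events that the walk crosses at time j + 1 by a large increment, for
    j < b, are disjoint, and each has probability at least
    (1/2 - P (tau < oo)) Fbar (c0 b).  Their total probability is at most
    P (tau < oo), and solving for the latter gives the bound. *)
Lemma passage_prob_lower (R : realType) d (T : measurableType d)
    (P : probability T R) (X : nat -> {RV P >-> R}) (mu : R) :
  mutually_independent X -> identically_distributed X ->
  P.-integrable [set: T] (EFin \o X 0%N) -> 0 < mu ->
  exists2 c0 : R, 1 <= c0 & forall b, 1 <= b ->
    b / 8 * Fbar (distribution P (X 0%N)) (c0 * b) <= passage_prob X mu b.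
Proof.
move=> indep idist X1 mu0; set F : probability R R := distribution P (X 0%N).
have [m1 m10 Fm1] := law_abs X1.
have m1E : (\int[P]_w `|X 0%N w|%:E = m1%:E)%E.
  rewrite -Fm1 (@ge0_integral_distribution _ _ _ _ _ P (X 0%N) (fun x => `|x|%:E)%E)//.
  by apply/measurable_EFinP.
  (* c0 b = b + b mu + K: a jump above c0 b from a position above - K crosses
     the boundary at any time up to b, and Markov's inequality bounds the
     probability to be below - K at time j <= b by 1/2. *)
exists (1 + mu + 2 * (m1 + 1)); first by rewrite -addrA lerDl; nra.
move=> b b1; set c := _ * b; set K := 2 * (m1 + 1) * b.
have K0 : 0 < K by rewrite /K; nra.
have c0 : 0 < c by rewrite /c; nra.
set pp := passage_prob X mu b; set N := Num.truncn b.
have /andP[Nb bN] : N%:R <= b < N.+1%:R by apply: truncn_itv; lra.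
have jb j : (j < N)%N -> j.+1%:R <= b by move=> jN; apply: le_trans Nb; rewrite ler_nat.
have NF : N%:R * ((2^-1 - pp) * Fbar F c) <= pp.
  rewrite -lee_fin -(@passage_probEFin _ _ _ P X mu b).
  apply: (@le_trans _ _ (\sum_(j < N) P [set w | hit mu b j.+1 (fun i => X i w)])%E).
    rewrite -[X in (X * _)%:E](_ : \sum_(j < N) 1 = N%:R :> R); last first.
      by rewrite sumr_const card_ord.
    rewrite mulr_suml -sumEFin; apply: lee_sum => j _; rewrite mul1r.
    have cK : b + j.+1%:R * mu <= c - K.
      by have := jb j (ltn_ord j); rewrite /c /K; nra.
    apply: (@le_trans _ _ (P [set w | ([set x : increments R |
       ge_tau mu b j.+1 x /\ (- K < walk x j)%R] `&` [set x | (c < x j.+1)%R]) (fun i => X i w)])).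
      apply: late_jump_prob => //.
      rewrite m1E -EFinM lee_fin.
      have : j%:R <= b by apply: le_trans (jb j (ltn_ord j)); rewrite ler_nat.
      by rewrite /K; nra.
    apply: le_measure; rewrite ?inE.
    - apply: measurable_path_preimage; apply: measurableI; last exact: measurable_coord_gt.
      by apply: measurableI; [exact: measurable_ge_tau|exact: measurable_walk_gt].
    - by apply: measurable_path_preimage; exact: measurable_hit.
    - by move=> w; apply: late_jump_hit.
  rewrite -measure_bigsetU_ord//; last 2 first.
  - by move=> j; apply: measurable_path_preimage; exact: measurable_hit.
  - apply/trivIsetP => i j _ _ ij.
    have /trivIsetP := @trivIset_hit _ _ _ P X mu b.
    by apply=> //; apply: contra_neq ij => -[/val_inj].
  apply: le_measure; rewrite ?inE.
  - apply: bigsetU_measurable => j _; apply: measurable_path_preimage.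
    exact: measurable_hit.
  - exact: measurable_passage.
  - move=> w; rewrite -bigcup_seq => -[j _ /hit_tau /= ->]; exact: ltry.
have Fc0 : 0 <= Fbar F c by exact: Fbar_ge0.
have Fc : c * Fbar F c <= m1 by exact: Fbar_markov.
have pp0 : 0 <= pp by exact: fine_ge0.
have bF : b * Fbar F c <= 1.
  apply: (@le_trans _ _ (c * Fbar F c / (m1 + 1))); last first.
    by rewrite ler_pdivrMr; nra.
  rewrite ler_pdivlMr; last by lra.
  rewrite mulrAC; apply: ler_wpM2r => //; rewrite /c.
  have mub : 0 <= mu * b by rewrite mulr_ge0//; lra.
  have m1b : 0 <= m1 * b by rewrite mulr_ge0//; lra.
  by lra.
have N2 : b <= 2 * N%:R.
  have : 1 <= N%:R :> R.
    rewrite ler1n lt0n; apply/eqP => N0; move: bN; rewrite N0; lra.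
  by have := bN; rewrite -natr1; lra.
(* From N (1/2 - pp) Fbar c <= pp and N Fbar c <= 1: N Fbar c <= 4 pp. *)
have NF1 : N%:R * Fbar F c <= 1 by apply: le_trans bF; exact: ler_wpM2r.
have : 2^-1 * (N%:R * Fbar F c) <= pp * (1 + N%:R * Fbar F c) by lra.
have : pp * (1 + N%:R * Fbar F c) <= pp * 2 by apply: ler_wpM2l => //; lra.
have : b * Fbar F c <= 2 * N%:R * Fbar F c by apply: ler_wpM2r.
by rewrite mulrAC; lra.
Qed.

(** * Potter's bounds *)

Lemma powR_expR (R : realType) (x y : R) : 0 < x -> x `^ y = expR (y * ln x).
Proof. by move=> x0; rewrite /powR gt_eqF. Qed.

(** Potter's bounds of index - alpha: up to constants, f decays between any two
    powers with exponents on both sides of - alpha. *)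
Definition potter_bounds (R : realType) (f : R -> R) (alpha : R) :=
  forall a s : R, 0 <= a -> a < alpha -> alpha < s ->
  exists x0 C, [/\ 1 <= x0, 1 <= C & forall x y : R, x0 <= x -> x <= y ->
    f y <= C * (x / y) `^ a * f x /\ f x <= C * (y / x) `^ s * f y].

Section potter.
Context (R : realType).

(** Every number from 1 on lies between two consecutive powers of 2. *)
Lemma dyadic_bracket (t : R) : 1 <= t -> exists n : nat, 2 ^+ n <= t < 2 ^+ n.+1.
Proof.
move=> t1.
have [N tN] : exists N : nat, t < 2 ^+ N.
  exists (Num.truncn t).+1; apply: lt_trans (truncnS_gt t) _.
  by rewrite -natrX ltr_nat ltn_expl.
elim: N tN => [|N IH] tN; first by move: tN; rewrite expr0 ltNge t1.
by have [tN'|tN'] := ltP t (2 ^+ N); [exact: IH|exists N; rewrite tN'].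
Qed.

Variables (f : R -> R) (alpha : R).
Hypothesis f_gt0 : forall x : R, 0 < x -> 0 < f x.
Hypothesis f_noninc : forall x y : R, 0 < x -> x <= y -> f y <= f x.
Hypothesis f_ratio : f (2 * x) / f x @[x --> +oo] --> 2 `^ (- alpha).

(** Beyond some point, doubling the argument changes f by a factor between
    2 ^ - s and 2 ^ - a. *)
Lemma doubling (a s : R) : a < alpha -> alpha < s ->
  exists2 x0, 1 <= x0 & forall x, x0 <= x ->
    f (2 * x) <= 2 `^ (- a) * f x /\ f x <= 2 `^ s * f (2 * x).
Proof.
move=> aa sa.
have a1 : 2 `^ (- alpha) < 2 `^ (- a) :> R by rewrite !powR_expR// ltr_expR ltr_pM2r ?ltrN2// ln_gt0// ltr1n.
have a2 : 2 `^ (- s) < 2 `^ (- alpha) :> R by rewrite !powR_expR// ltr_expR ltr_pM2r ?ltrN2// ln_gt0// ltr1n.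
have e1 : \forall x \near +oo, f (2 * x) / f x < 2 `^ (- a).
  exact: (cvgr_lt _ f_ratio).
have e2 : \forall x \near +oo, 2 `^ (- s) < f (2 * x) / f x.
  exact: (cvgr_gt _ f_ratio).
have [M [_ HM]] : \forall x \near +oo,
   f (2 * x) / f x < 2 `^ (- a) /\ 2 `^ (- s) < f (2 * x) / f x.
  by near=> x; split; near: x.
exists (Num.max 1 (M + 1)); first by rewrite le_max lexx.
move=> x; rewrite ge_max => /andP[x1 xM].
have Mx : M < x by lra.
have [h1 h2] := HM x Mx.
have fx : 0 < f x by apply: f_gt0; exact: lt_le_trans x1.
split; first by rewrite -ler_pdivrMr// ltW.
rewrite -ler_pdivrMl ?powR_gt0// -powRN -ler_pdivlMr// ltW//.
Unshelve. all: by end_near.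
Qed.

Lemma potter : potter_bounds f alpha.
Proof.
move=> a s a0 aa sa; have s0 : 0 <= s by lra.
have [x0 x01 dbl] := doubling aa sa.
have two_gt0 : 0 < 2 :> R by [].
have iter n x : x0 <= x -> f (2 ^+ n * x) <= (2 ^+ n) `^ (- a) * f x /\
    f x <= (2 ^+ n) `^ s * f (2 ^+ n * x).
  move=> xx; elim: n => [|n [IH1 IH2]].
    by rewrite expr0 !mul1r !powR1 !mul1r.
  have [|h1 h2] := dbl (2 ^+ n * x).
    apply: (le_trans xx); apply: ler_peMl; first lra.
    by apply: exprn_ege1; rewrite ler1n.
  rewrite exprS -!mulrA !powRM ?exprn_ge0//; split.
    by apply: le_trans h1 _; rewrite -mulrA ler_wpM2l ?powR_ge0.
  apply: (le_trans IH2); rewrite -[leRHS]mulrA [leRHS]mulrCA.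
  by rewrite ler_wpM2l ?powR_ge0.
have Ca : 1 <= 2 `^ a :> R by rewrite -[X in X <= _](powRr0 (2 : R)); apply: ler_powR; rewrite ?ler1n.
have Cs : 1 <= 2 `^ s :> R by rewrite -[X in X <= _](powRr0 (2 : R)); apply: ler_powR; rewrite ?ler1n.
exists x0, (2 `^ a * 2 `^ s); split=> //; first by rewrite mulr_ege1.
move=> x y xx xy; have x_gt0 : 0 < x by lra.
have y_gt0 : 0 < y by lra.
have fx := f_gt0 x_gt0; have fy := f_gt0 y_gt0.
have [n /andP[n1 n2]] : exists n : nat, 2 ^+ n <= y / x < 2 ^+ n.+1.
  by apply: dyadic_bracket; rewrite ler_pdivlMr// mul1r.
have n1' : 2 ^+ n * x <= y by rewrite -ler_pdivlMr.
have n2' : y <= 2 ^+ n.+1 * x by rewrite -ler_pdivrMr// ltW.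
have p_gt0 : 0 < 2 ^+ n :> R by rewrite exprn_gt0.
split.
  apply: (@le_trans _ _ (f (2 ^+ n * x))); first by apply: f_noninc => //; rewrite mulr_gt0.
  apply: (le_trans (iter n x xx).1); rewrite ler_wpM2r ?(ltW fx)//.
  apply: (@le_trans _ _ (2 `^ a * (x / y) `^ a)); last first.
    by rewrite ler_wpM2r ?powR_ge0// ler_peMr// powR_ge0.
  rewrite -powRM//; last by rewrite divr_ge0// ltW.
  rewrite powRN -powR_inv1 ?powR_ge0// -powRrM mulrN1 powRN -powR_inv1 ?powR_ge0//.
  rewrite -powRrM mulrC powRrM powR_inv1 ?(ltW p_gt0)//.
  apply: ge0_ler_powR; rewrite ?nnegrE ?invr_ge0 ?(ltW p_gt0)//.
    by rewrite mulr_ge0// divr_ge0// ltW.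
  rewrite mulrA ler_pdivlMr// mulrC ler_pdivrMr// mulrAC -exprS //.
apply: (le_trans (iter n.+1 x xx).2).
apply: (@le_trans _ _ ((2 ^+ n.+1) `^ s * f y)).
  by rewrite ler_wpM2l ?powR_ge0//; apply: f_noninc.
rewrite ler_wpM2r ?(ltW fy)//.
apply: (@le_trans _ _ (2 `^ s * (y / x) `^ s)); last first.
  by rewrite ler_wpM2r ?powR_ge0// ler_peMl// powR_ge0.
rewrite -powRM//; last by rewrite divr_ge0// ltW.
apply: ge0_ler_powR; rewrite ?nnegrE ?exprn_ge0//.
  by rewrite mulr_ge0// divr_ge0// ltW.
by rewrite exprS ler_wpM2l.
Qed.

End potter.

(** * The mass of an exponential tilt *)

Section exponential_inequalities.
Context (R : realType).
Implicit Types (x y a l : R).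

Lemma expR_le_quad y : -1 <= y -> y <= 2^-1 -> expR y <= 1 + y + 2 * y ^+ 2.
Proof.
move=> y1 y2; have e := expR_ge1Dx (- y).
have p := expR_gt0 y; have e' : expR y * expR (- y) = 1 by rewrite -expRD subrr expR0.
have : expR y * (1 - y) <= 1 by rewrite -[leRHS]e' ler_wpM2l// ltW.
have h1 : 0 <= y ^+ 2 by exact: sqr_ge0.
have h2 : 1 <= (1 + y + 2 * y ^+ 2) * (1 - y).
  have -> : (1 + y + 2 * y ^+ 2) * (1 - y) = 1 + y ^+ 2 * (1 - 2 * y) by ring.
  by rewrite lerDl mulr_ge0//; lra.
have y3 : 0 < 1 - y by lra.
move=> h3; have := le_trans h3 h2.
by rewrite ler_pM2r.
Qed.

Lemma expR1_ge2 : 2 <= expR 1 :> R.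
Proof. by have := @expR_ge1Dx R 1; lra. Qed.

(** Away from a bounded window, the exponential is controlled by its first
    order Taylor polynomial and a power; on each unit interval to the right,
    by a constant. *)
Lemma expR_le_steps y a l : 1 < a -> a <= 2 -> y < l ->
  expR y <= 1 + y + 4 * expR 2 * `|y| `^ a
    + \sum_(1 <= j < (Num.truncn l).+1) expR (j.+2)%:R * (j%:R < y)%R%:R.
Proof.
move=> a1 a2 yl.
set S := \sum_(_ <= _ < _) _.
have S0 : 0 <= S by apply: sumr_ge0 => j _; rewrite mulr_ge0 ?expR_ge0.
have e2 : 4 <= expR 2 :> R.
  have -> : 2 = 1 + 1 :> R by [].
  by rewrite expRD; have := expR1_ge2; nra.
have [y2|y2] := leP 2 y; last first.
  have [yh|yh] := leP y 2^-1.
    have [y1|y1] := leP (-1) y.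
      have := expR_le_quad y1 yh.
      have yy : y ^+ 2 <= `|y| `^ a.
        have [->|y0] := eqVneq y 0; first by rewrite expr0n/= powR_ge0.
        rewrite -real_normK ?num_real// -powR_mulrn//; apply: ger_powR => //.
        by rewrite normr_gt0 y0 ler_norml; lra.
      have := powR_ge0 `|y| a; nra.
    have ey : expR y <= 1 by rewrite expR_le1; lra.
    have : - y <= `|y| `^ a.
      by rewrite ltr0_norm; [apply: le1r_powR; lra|lra].
    have := powR_ge0 `|y| a; nra.
  have ey : expR y <= expR 2 by rewrite ler_expR ltW.
  have : 4^-1 <= `|y| `^ a.
    have y0 : 0 < y by lra.
    rewrite gtr0_norm//; have [y1|y1] := leP y 1.
      apply: (@le_trans _ _ (y `^ 2%:R)); last by apply: ger_powR; rewrite ?y0.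
      rewrite powR_mulrn ?(ltW y0)//; nra.
    by apply: (@le_trans _ _ y); [lra|apply: le1r_powR; lra].
  by nra.
set t := Num.truncn y.
have /andP[ty yt] : t%:R <= y < t.+1%:R by apply: truncn_itv; lra.
have t2 : (2 <= t)%N by rewrite /t truncn_ge_nat//; lra.
have tl : (t <= Num.truncn l)%N.
  by rewrite truncn_ge_nat; [apply: le_trans ty (ltW yl)|lra].
have : expR y <= S.
  clearbody t; case: t ty yt t2 tl => [|[|u]] // ty yt _ tl.
  rewrite /S (bigD1_seq u.+1)/= ?iota_uniq ?mem_index_iota//; last first.
    by apply/andP; split => //; exact: leqW.
  have -> : (u.+1%:R < y)%R by apply: lt_le_trans ty; rewrite ltr_nat.
  rewrite mulr1; apply: ler_wpDr; last by rewrite ler_expR ltW.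
  by apply: sumr_ge0 => j _; rewrite mulr_ge0 ?expR_ge0.
have := powR_ge0 `|y| a; nra.
Qed.

(** The majorant of [expR_le_steps] stays nonnegative beyond l, so that it may
    be integrated over the whole line. *)
Lemma expR_steps_nneg y a l : 1 < a -> 0 <= l -> l <= y ->
  0 <= 1 + y + 4 * expR 2 * `|y| `^ a
    + \sum_(1 <= j < (Num.truncn l).+1) expR (j.+2)%:R * (j%:R < y)%R%:R.
Proof.
move=> a1 l0 ly; rewrite !addr_ge0 ?mulr_ge0 ?powR_ge0 ?expR_ge0//; first lra.
by apply: sumr_ge0 => j _; rewrite mulr_ge0 ?expR_ge0.
Qed.

Lemma sqr_ratio_expR l (j : nat) : (0 < j)%N -> j%:R <= l ->
  (l / j%:R) ^+ 2 <= 16 * expR ((l - j%:R) / 2).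
Proof.
move=> j0 jl; have j1 : 1 <= j%:R :> R by rewrite ler1n.
set u := (l - j%:R) / 4.
have u0 : 0 <= u by rewrite /u divr_ge0//; lra.
have lj : l / j%:R <= 4 * expR u.
  apply: (@le_trans _ _ (4 * (1 + u))); last by rewrite ler_wpM2l// expR_ge1Dx.
  rewrite ler_pdivrMr; last lra.
  by rewrite /u; nra.
have lj0 : 0 <= l / j%:R by rewrite divr_ge0//; lra.
rewrite (_ : (l - j%:R) / 2 = u + u); last by rewrite /u; lra.
rewrite expRD (_ : 16 * _ = (4 * expR u) ^+ 2); last by ring.
by rewrite lerXn2r// nnegrE ?mulr_ge0 ?expR_ge0.
Qed.

Lemma sum_expR_half_le (n : nat) :
  \sum_(1 <= j < n.+1) expR (j%:R / 2) <= 2 * expR (n.+1%:R / 2) :> R.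
Proof.
have h15 : 3 / 2 <= expR 2^-1 :> R by have := @expR_ge1Dx R 2^-1; lra.
elim: n => [|n IH]; first by rewrite big_geq// mulr_ge0 ?expR_ge0.
rewrite big_nat_recr//=.
have e : expR (n.+2%:R / 2) = expR 2^-1 * expR (n.+1%:R / 2) :> R.
  by rewrite -expRD; congr expR; rewrite -[n.+2%:R]natr1; lra.
rewrite e; move: IH h15; set A := \sum_(_ <= _ < _) _.
by have := expR_gt0 (n.+1%:R / 2 : R); nra.
Qed.

(** The geometric sum behind the bound of the large increments: summands decay
    geometrically away from the upper end of the range. *)
Lemma sum_steps_le l : 0 <= l ->
  \sum_(1 <= j < (Num.truncn l).+1) expR (j.+2)%:R * (l / j%:R) ^+ 2
  <= 32 * expR 3 * expR l.
Proof.
move=> l0; set N := Num.truncn l.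
have Nl : N%:R <= l by rewrite truncn_le.
apply: (@le_trans _ _ (\sum_(1 <= j < N.+1)
    16 * expR 2 * expR (l / 2) * expR (j%:R / 2))).
  rewrite [leLHS]big_nat_cond [leRHS]big_nat_cond; apply: ler_sum => j.
  rewrite andbT ltnS => /andP[j0 jN].
  have jl : j%:R <= l by apply: le_trans Nl; rewrite ler_nat.
  apply: (@le_trans _ _ (expR (j.+2)%:R * (16 * expR ((l - j%:R) / 2)))).
    by rewrite ler_wpM2l ?expR_ge0// sqr_ratio_expR.
  rewrite le_eqVlt; apply/orP; left; apply/eqP.
  rewrite mulrCA -!mulrA -!expRD; congr (_ * expR _).
  by rewrite -addn2 natrD; lra.
rewrite -mulr_sumr.
apply: (@le_trans _ _ (16 * expR 2 * expR (l / 2) * (2 * expR (N.+1%:R / 2)))).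
  by rewrite ler_wpM2l ?sum_expR_half_le// !mulr_ge0 ?expR_ge0.
have -> : 16 * expR 2 * expR (l / 2) * (2 * expR (N.+1%:R / 2)) =
    32 * expR (2 + l / 2 + N.+1%:R / 2) :> R by rewrite !expRD; ring.
rewrite -[leRHS]mulrA -expRD ler_pM2l// ler_expR -[N.+1%:R]natr1; lra.
Qed.

End exponential_inequalities.

Section truncated_mgf.
Context (R : realType) (F : probability R R) (a Ma : R).
Hypotheses (a1 : 1 < a) (a2 : a <= 2).
Hypothesis F_int : F.-integrable [set: R] (fun x : R => x%:E).
Hypothesis F_mean0 : (\int[F]_x x%:E = 0)%E.
Hypothesis F_moment : (\int[F]_x (`|x| `^ a)%:E = Ma%:E)%E.

Lemma measurable_abs_powR : measurable_fun [set: R] (fun x : R => `|x| `^ a).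
Proof. exact: (measurableT_comp (measurable_powR a) (@normr_measurable R setT)). Qed.

(** Integrating [expR_le_steps] at y = th x: the linear term vanishes because
    the mean does. *)
Lemma mgf_bound (th m : R) : 0 < th -> 0 <= m ->
  (\int[F]_(x in `]-oo, m[) (expR (th * x))%:E <=
   (1 + 4 * expR 2 * (th `^ a * Ma)
    + \sum_(1 <= j < (Num.truncn (th * m)).+1)
        expR (j.+2)%:R * Fbar F (j%:R / th))%:E)%E.
Proof.
move=> th0 m0; set l := th * m; set N := (Num.truncn l).+1.
have l0 : 0 <= l by rewrite mulr_ge0 // ltW.
pose u (x : R) : \bar R := (1 + th * x)%:E.
pose S (x : R) : R := \sum_(1 <= j < N) expR (j.+2)%:R * (j%:R < th * x)%R%:R.
pose v (x : R) : \bar R := (4 * expR 2 * th `^ a * `|x| `^ a + S x)%:E.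
have Iu : (\int[F]_x u x = 1)%E.
  rewrite /u; under eq_integral do rewrite EFinD EFinM.
  rewrite integralD//; last exact: integrableZl.
    rewrite integralZl// F_mean0 mule0 adde0 integral_cst// mul1e.
    exact: probability_setT.
  exact: finite_measure_integrable_cst.
have iu : F.-integrable [set: R] u.
  apply: (eq_integrable measurableT (fun x : R => (1%:E + th%:E * x%:E)%E)).
    by move=> x _; rewrite /u EFinD EFinM.
  apply: integrableD => //; last exact: integrableZl.
  exact: finite_measure_integrable_cst.
have mind (j : nat) : measurable_fun [set: R] (\1_(`](j%:R / th), +oo[%classic) : R -> R).
  exact: measurable_indic.
have SE x : S x = \sum_(1 <= j < N) expR (j.+2)%:R * \1_(`](j%:R / th), +oo[%classic) x.
  apply: eq_bigr => j _; rewrite indicE mem_setE in_itv/= andbT.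
  by rewrite ltr_pdivrMr// [x * th]mulrC.
have mS : measurable_fun [set: R] S.
  rewrite (funext SE); apply: measurable_sum => j; exact: measurable_funM.
have S0 x : 0 <= S x by apply: sumr_ge0 => j _; rewrite mulr_ge0 ?expR_ge0.
have K0 : 0 <= 4 * expR 2 * th `^ a by rewrite !mulr_ge0 ?expR_ge0 ?powR_ge0.
have mv : measurable_fun [set: R] v.
  apply/measurable_EFinP; apply: measurable_funD => //; apply: measurable_funM => //.
  exact: measurable_abs_powR.
have v0 x : (0 <= v x)%E by rewrite lee_fin addr_ge0// mulr_ge0 ?powR_ge0.
have Iv : (\int[F]_x v x = (4 * expR 2 * (th `^ a * Ma) +
   \sum_(1 <= j < N) expR (j.+2)%:R * Fbar F (j%:R / th))%:E)%E.
  have mp : measurable_fun [set: R] (fun x : R => (`|x| `^ a)%:E).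
    by apply/measurable_EFinP; exact: measurable_abs_powR.
  have mKp : measurable_fun [set: R]
      (fun x : R => ((4 * expR 2 * th `^ a)%:E * (`|x| `^ a)%:E)%E).
    exact: measurable_funeM.
  have p0 (x : R) : [set: R] x -> (0 <= (`|x| `^ a)%:E)%E.
    by move=> _; rewrite lee_fin powR_ge0.
  have Kp0 (x : R) : [set: R] x ->
      (0 <= (4 * expR 2 * th `^ a)%:E * (`|x| `^ a)%:E)%E.
    by move=> _; rewrite mule_ge0// lee_fin powR_ge0.
  have S0' (x : R) : [set: R] x -> (0 <= (S x)%:E)%E by move=> _; rewrite lee_fin.
  have mS' : measurable_fun [set: R] (EFin \o S) by exact/measurable_EFinP.
  rewrite /v; under eq_integral do rewrite EFinD EFinM.
  rewrite (ge0_integralD _ measurableT Kp0 mKp S0' mS').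
  rewrite (ge0_integralZl _ measurableT mp p0)//.
  rewrite F_moment EFinD -EFinM -!mulrA; congr (_ + _)%E.
  under eq_integral do rewrite SE -sumEFin.
  rewrite ge0_integral_sum//; last first.
    by move=> j; apply/measurable_EFinP; exact: measurable_funM.
  rewrite -sumEFin; apply: eq_bigr => j _.
  under eq_integral do rewrite EFinM.
  have mI := measurableT_comp (@EFin_measurable R setT) (mind j).
  rewrite (ge0_integralZl _ measurableT mI)//; last by move=> x _; rewrite /= lee_fin.
  by rewrite integral_indic// setIT EFinM; congr (_ * _)%E; exact: FbarE.
have iv : F.-integrable [set: R] v.
  apply/integrableP; split => //.
  by under eq_integral do rewrite gee0_abs//; rewrite Iv ltry.
have uvE x : (u x + v x)%E = (1 + th * x + 4 * expR 2 * `|th * x| `^ a + S x)%:E.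
  rewrite /u /v -EFinD normrM (ger0_norm (ltW th0)) powRM ?(ltW th0)//.
  by congr (_%:E); rewrite -!mulrA -!addrA.
have -> : (1 + 4 * expR 2 * (th `^ a * Ma)
    + \sum_(1 <= j < N) expR (j.+2)%:R * Fbar F (j%:R / th))%:E =
    (\int[F]_x (u x + v x))%E.
  by rewrite integralD// Iu Iv -EFinD addrA.
rewrite integral_mkcond; apply: ge0_le_integral => //.
- by move=> x _; rewrite erestrict_ge0// => y _; rewrite lee_fin expR_ge0.
- apply/(measurable_restrictT _ _).1 => //; apply/measurable_EFinP.
  apply: measurable_funTS.
  by apply: (@measurableT_comp _ _ _ _ _ _ expR) => //; exact: measurable_funM.
- by apply: emeasurable_funD => //; case/integrableP: iu.
move=> x _; rewrite patchE; case: ifPn => [/set_mem|/negP xm].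
  rewrite /= in_itv/= => xm; rewrite uvE lee_fin.
  by apply: expR_le_steps => //; rewrite ltr_pM2l.
rewrite uvE lee_fin; apply: expR_steps_nneg => //.
rewrite ler_pM2l// leNgt; apply/negP => xm'; apply: xm.
by rewrite inE/= in_itv.
Qed.

(** By Markov's inequality ]-m, m[ has positive mass. *)
Lemma mgf_pos (th m : R) : 0 <= th -> 0 < m -> (\int[F]_x `|x|%:E < m%:E)%E ->
  (0 < \int[F]_(x in `]-oo, m[) (expR (th * x))%:E)%E.
Proof.
move=> th0 m0 Fm.
have mex D : measurable D -> measurable_fun D (fun x : R => (expR (th * x))%:E).
  move=> mD; apply/measurable_EFinP; apply: measurable_funTS.
  by apply: (@measurableT_comp _ _ _ _ _ _ expR) => //; exact: measurable_funM.
have far : (F (~` `](- m)%R, m[%classic) < 1)%E.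
  rewrite ltNge; apply/negP => F1; move: Fm; apply/negP; rewrite -leNgt.
  apply: (@le_trans _ _ (m%:E * F (~` `](- m)%R, m[%classic))%E).
    by rewrite -[leLHS]mule1; apply: lee_wpmul2l => //; rewrite lee_fin ltW.
  rewrite -[X in F X]setIT -integral_indic//; last exact: measurableC.
  rewrite -ge0_integralZl//; last 2 first.
  - by apply/measurable_EFinP; apply: measurable_indic; exact: measurableC.
  - by rewrite lee_fin ltW.
  apply: ge0_le_integral => //.
  - by move=> x _; rewrite mule_ge0// lee_fin// ltW.
  - apply: measurable_funeM; apply/measurable_EFinP.
    by apply: measurable_indic; exact: measurableC.
  - by apply/measurable_EFinP.
  move=> x _; rewrite -EFinM lee_fin indicE.
  have [/set_mem /= xm|_] := boolP (_ \in _); last by rewrite mulr0.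
  rewrite mulr1 leNgt; apply/negP => xm'; apply: xm.
  by rewrite in_itv/= -ltr_norml.
have near1 : (0 < F `](- m)%R, m[%classic)%E.
  rewrite ltNge; apply/negP => F0.
  have F0' : F `](- m)%R, m[%classic = 0%E.
    by apply/eqP; rewrite eq_le F0 measure_ge0.
  move: far; rewrite probability_setC// F0'.
  by rewrite sube0 ltxx.
apply: (@lt_le_trans _ _ (\int[F]_(x in `](- m)%R, m[) (expR (th * x))%:E)%E); last first.
  apply: ge0_subset_integral => //.
  - exact: mex.
  - by move=> x; rewrite /= !in_itv/= => /andP[].
apply: (@lt_le_trans _ _ (\int[F]_(x in `](- m)%R, m[) (expR (- (th * m)))%:E)%E).
  by rewrite integral_cst// mule_gt0// lte_fin expR_gt0.
apply: ge0_le_integral => //.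
- exact: mex.
- move=> x; rewrite /= in_itv/= => /andP[mx _]; rewrite lee_fin ler_expR.
  by rewrite -mulrN ler_wpM2l// ltW.
Qed.

End truncated_mgf.

Section series.
Context (R : realType).
Local Open Scope ereal_scope.

(** A series dominated by the increments of a nonnegative sequence. *)
Lemma nneseries_le_telescope (u : nat -> \bar R) (v : nat -> R) :
  (forall j, 0 <= u j) -> (forall j, (0 <= v j)%R) ->
  (forall j, u j <= (v j - v j.+1)%R%:E) -> \sum_(j <oo) u j <= (v 0%N)%:E.
Proof.
move=> u0 v0 uv; apply: lime_le; first by apply: is_cvg_nneseries => n _ _; exact: u0.
apply: nearW => n; apply: (@le_trans _ _ (\sum_(0 <= j < n) (v j - v j.+1)%R%:E)).
  by apply: lee_sum => j _; exact: uv.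
rewrite sumEFin lee_fin (@telescope_sumr_eq _ _ _ (fun j => - v j)%R)//.
  by rewrite opprK addrC lerBlDr lerDl.
by move=> j _; rewrite opprK addrC.
Qed.

End series.

Section moments.
Context (R : realType) (F : probability R R).

Lemma measurable_abs_ge (x : R) : measurable [set y : R | x <= `|y|].
Proof.
rewrite (_ : [set y | _] = (fun y : R => `|y|) @^-1` `[x, +oo[%classic).
  rewrite -[X in measurable X]setTI; apply: normr_measurable => //.
by apply/seteqP; split=> y /=; rewrite in_itv/= andbT.
Qed.

(** A power tail of order larger than a makes the absolute moment of order a
    finite: decompose dyadically. *)
Lemma moment_of_tail (a a' C x0 : R) : 0 < a -> a < a' -> 0 <= C -> 0 < x0 ->
  (forall x, x0 <= x -> (F [set y | (x <= `|y|)%R] <= (C * x `^ (- a'))%:E)%E) ->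
  (\int[F]_y (`|y| `^ a)%:E < +oo)%E.
Proof.
move=> a0 aa C0 x00 tail.
pose A (j : nat) : set R := [set y | 2 ^+ j * x0 <= `|y|].
pose c (j : nat) : R := (2 ^+ j.+1 * x0) `^ a.
have c0 j : 0 <= c j by exact: powR_ge0.
have mA j : measurable (A j) by exact: measurable_abs_ge.
pose q : R := 2 `^ (a - a').
have q0 : 0 < q by rewrite powR_gt0.
have q1 : q < 1.
  have l2 : 0 < ln 2 :> R by apply: ln_gt0; rewrite ltr1n.
  by rewrite /q powR_expR// expR_lt1; nra.
pose K : R := 2 `^ a * x0 `^ a * C * x0 `^ (- a').
have K0 : 0 <= K by rewrite !mulr_ge0 ?powR_ge0.
have p2 (j : nat) s : (2 ^+ j) `^ s = (2 `^ s) ^+ j :> R.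
  by rewrite -powR_mulrn// -powRrM mulrC powRrM powR_mulrn// powR_ge0.
have term j : ((c j)%:E * F (A j) <= (K / (1 - q) * q ^+ j - K / (1 - q) * q ^+ j.+1)%:E)%E.
  apply: (@le_trans _ _ ((c j)%:E * (C * (2 ^+ j * x0) `^ (- a'))%:E)%E).
    apply: lee_wpmul2l; first by rewrite lee_fin.
    by apply: tail; rewrite ler_peMl ?(ltW x00)// exprn_ege1// ler1n.
  rewrite -EFinM lee_fin le_eqVlt; apply/orP; left; apply/eqP.
  have -> : K / (1 - q) * q ^+ j - K / (1 - q) * q ^+ j.+1 = K * q ^+ j.
    by rewrite exprS; field; lra.
  have -> : q ^+ j = (2 `^ a) ^+ j * (2 `^ (- a')) ^+ j.
    by rewrite -exprMn -powRD// pnatr_eq0 implybT.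
  rewrite /c !powRM ?exprn_ge0 ?(ltW x00)// !p2 exprS /K; ring.
have fin : (\sum_(j <oo) ((c j)%:E * F (A j)) <= (K / (1 - q))%:E)%E.
  rewrite -[K / (1 - q)]mulr1 -(expr0 q).
  apply: (nneseries_le_telescope (v := fun j => K / (1 - q) * q ^+ j)) => //.
  - by move=> j; rewrite mule_ge0// lee_fin.
  - by move=> j; rewrite mulr_ge0 ?exprn_ge0 ?(ltW q0)// divr_ge0//; lra.
apply: (@le_lt_trans _ _ ((x0 `^ a)%:E + (K / (1 - q))%:E)%E); last by rewrite -EFinD ltry.
have mser : measurable_fun [set: R] (fun y => \sum_(j <oo) ((c j)%:E * (\1_(A j) y)%:E))%E.
  apply: ge0_emeasurable_sum => [j y _ _|j _]; first by rewrite mule_ge0// lee_fin.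
  by apply: measurable_funeM; apply/measurable_EFinP; exact: measurable_indic.
have ser0 y : (0 <= \sum_(j <oo) ((c j)%:E * (\1_(A j) y)%:E))%E.
  by apply: nneseries_ge0 => j _ _; rewrite mule_ge0// lee_fin.
apply: (@le_trans _ _ (\int[F]_y ((x0 `^ a)%:E +
    \sum_(j <oo) ((c j)%:E * (\1_(A j) y)%:E)))%E).
  apply: ge0_le_integral => //.
  - by apply/measurable_EFinP; exact: measurable_abs_powR.
  - by apply: emeasurable_funD.
  move=> y _; have [yx|yx] := leP `|y| x0.
    rewrite -[leLHS]adde0; apply: leeD => //; rewrite lee_fin.
    by apply: ge0_ler_powR; rewrite ?nnegrE ?(ltW a0) ?(ltW x00).
  have [n /andP[n1 n2]] : exists n : nat, 2 ^+ n <= `|y| / x0 < 2 ^+ n.+1.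
    by apply: dyadic_bracket; rewrite ler_pdivlMr// mul1r ltW.
  apply: (@le_trans _ _ (\sum_(j <oo) ((c j)%:E * (\1_(A j) y)%:E))%E); last first.
    by rewrite leeDr// lee_fin powR_ge0.
  have yA : A n y by rewrite /A /= -ler_pdivlMr.
  rewrite (nneseries_split 0 n.+1); last by move=> j _; rewrite mule_ge0// lee_fin.
  rewrite add0n big_nat_recr//= indicE mem_set// mule1.
  rewrite -addeA addeCA; apply: le_trans (leeDl _ _); last first.
    apply: adde_ge0; last by apply: nneseries_ge0 => j _ _; rewrite mule_ge0// lee_fin.
    by apply: sume_ge0 => j _; rewrite mule_ge0// lee_fin.
  rewrite lee_fin /c; apply: ge0_ler_powR; rewrite ?nnegrE ?(ltW a0)//.
    by rewrite mulr_ge0 ?exprn_ge0 ?(ltW x00).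
  by rewrite -ler_pdivrMr// ltW.
rewrite ge0_integralD//; last by rewrite lee_fin powR_ge0.
rewrite integral_cst// [X in (_ * X)%E](_ : _ = 1%E) ?mule1; last exact: probability_setT.
rewrite leeD2l// integral_nneseries//; last 2 first.
- by move=> j; apply: measurable_funeM; apply/measurable_EFinP; exact: measurable_indic.
- by move=> j y _; rewrite mule_ge0// lee_fin.
apply: le_trans fin; rewrite le_eqVlt; apply/orP; left; apply/eqP.
apply: eq_eseriesr => j _; rewrite ge0_integralZl//; last 2 first.
- by apply/measurable_EFinP; exact: measurable_indic.
- by rewrite lee_fin.
by rewrite integral_indic// setIT.
Qed.

End moments.

Lemma powR_near_pinfty (R : realType) (e M : R) : 0 < e ->
  \forall m \near +oo, M <= m `^ e.
Proof.
move=> e0; exists ((`|M| + 1) `^ e^-1); split; first by rewrite num_real.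
move=> m Mm; apply: (@le_trans _ _ ((`|M| + 1) `^ e^-1 `^ e)).
  rewrite -powRrM mulVf ?gt_eqF// powRr1; last by rewrite addr_ge0.
  by have := ler_norm M; lra.
apply: ge0_ler_powR; rewrite ?nnegrE ?powR_ge0 ?(ltW e0) ?(ltW Mm)//.
by apply: le_trans (ltW Mm); exact: powR_ge0.
Qed.

Section tilting.
Context (R : realType) (F : probability R R) (a Ma m1 C x0 : R).
Hypotheses (a1 : 1 < a) (a2 : a <= 2).
Hypothesis F_int : F.-integrable [set: R] (fun x : R => x%:E).
Hypothesis F_mean0 : (\int[F]_x x%:E = 0)%E.
Hypothesis F_abs : (\int[F]_x `|x|%:E = m1%:E)%E.
Hypothesis F_moment : (\int[F]_x (`|x| `^ a)%:E = Ma%:E)%E.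
Hypothesis Fbar_gt0 : forall x, 0 < x -> 0 < Fbar F x.
Hypotheses (x01 : 1 <= x0) (C1 : 1 <= C).
Hypothesis F_potter : forall x y, x0 <= x -> x <= y ->
  Fbar F y <= C * (x / y) `^ a * Fbar F x /\
  Fbar F x <= C * (y / x) `^ 2 * Fbar F y.

(** Tilting at rate th = - log (n Fbar m) / m, where n = O(m), costs a factor
    1 + O(1 / n) only: the tilted mass of the bulk is 1 + O(th ^ a) because the
    mean vanishes, and that of the range up to m is O(Fbar m exp (th m)). *)
Lemma tilt_mass_bound (c1 : R) : 0 < c1 -> exists C' : R, \forall m \near +oo,
  forall n : nat, (0 < n)%N -> n%:R <= c1 * m ->
  let th := - ln (n%:R * Fbar F m) / m in
  0 < th /\ exists D : R, [/\ 0 < D, D <= 1 + C' / n%:R &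
    (\int[F]_(x in `]-oo, m[) (expR (th * x))%:E = D%:E)%E].
Proof.
move=> c10.
have Ma0 : 0 <= Ma by rewrite -lee_fin -F_moment integral_ge0// => x _; rewrite lee_fin powR_ge0.
have mgf_up := mgf_bound a1 a2 F_int F_mean0 F_moment.
have mgf_lo th m : 0 <= th -> 0 < m -> m1 < m ->
    (0 < \int[F]_(x in `]-oo, m[) (expR (th * x))%:E)%E.
  by move=> th0 m0 mm; apply: mgf_pos => //; rewrite F_abs lte_fin.
have [a1' a2' x01' C1'] := And4 a1 a2 x01 C1.
(* With this eta, th = O(m ^ (eta - 1)) and (eta - 1) a = -1, so that
   th ^ a = O(1 / m). *)
set eta := (a - 1) / a.
have eta0 : 0 < eta by rewrite /eta divr_gt0//; lra.
have x0_gt0 : 0 < x0 by lra.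
have Fx0 := Fbar_gt0 x0_gt0.
set kap := Fbar F x0 * x0 ^+ 2 / C.
have kap0 : 0 < kap by rewrite /kap divr_gt0 ?mulr_gt0 ?exprn_gt0//; lra.
set C3 := 2 / eta + `|ln kap|.
have C30 : 0 < C3 by rewrite /C3 ltr_pwDl// divr_gt0.
set C4 := C * x0 `^ a * Fbar F x0.
set C' := 4 * expR 2 * (C3 `^ a * c1 * Ma) + 32 * expR 3 * C.
have eta1 : eta < 1 by rewrite /eta ltr_pdivrMr; lra.
have etaE : (eta - 1) * a = -1 by rewrite /eta; field; lra.
(* These constants stay opaque below; csE records their values. *)
have csE : [/\ kap = Fbar F x0 * x0 ^+ 2 / C, C3 = 2 / eta + `|ln kap|,
    C4 = C * x0 `^ a * Fbar F x0
  & C' = 4 * expR 2 * (C3 `^ a * c1 * Ma) + 32 * expR 3 * C] by [].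
clearbody C' C4 C3 kap eta; exists C'.
near=> m; move=> n n0 nm; set l := - ln (n%:R * Fbar F m); set th := l / m.
have m_x0 : x0 <= m by near: m; apply: nbhs_pinfty_ge; rewrite num_real.
have m_gt0 : 0 < m by lra.
have m_ge1 : 1 <= m by lra.
have m_m1 : m1 < m by near: m; apply: nbhs_pinfty_gt; rewrite num_real.
have m_al : c1 * C4 + 1 <= m `^ (a - 1) /\ C3 * x0 <= m `^ (1 - eta).
  split; near: m; apply: powR_near_pinfty; first by lra.
  by rewrite subr_gt0.
have lthE : l = - ln (n%:R * Fbar F m) /\ th = l / m by [].
clearbody th l.
have n1 : 1 <= n%:R :> R by rewrite ler1n.
have n_gt0 : 0 < n%:R :> R by rewrite ltr0n.
have Fm := Fbar_gt0 m_gt0.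
have nF0 : 0 < n%:R * Fbar F m by rewrite mulr_gt0.
(* n Fbar m = O(m ^ (1 - a)), by the upper Potter bound from x0 to m. *)
have nF1 : n%:R * Fbar F m < 1.
  have h : Fbar F m * m `^ a <= C4.
    have [Fm_up _] := F_potter (lexx x0) m_x0.
    apply: (@le_trans _ _ (C * (x0 / m) `^ a * Fbar F x0 * m `^ a)).
      by rewrite ler_wpM2r ?powR_ge0.
    rewrite powRM ?invr_ge0 ?(ltW x0_gt0) ?(ltW m_gt0)// le_eqVlt; apply/orP; left.
    rewrite -[m^-1]powR_inv1 ?(ltW m_gt0)// -powRrM mulN1r powRN; apply/eqP.
    by have [_ _ -> _] := csE; field; rewrite gt_eqF// powR_gt0.
  have mm : m `^ a = m * m `^ (a - 1).
    by rewrite mulr_powRB1 ?(ltW m_gt0)// (lt_trans _ a1').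
  rewrite mm in h; have [m_a _] := m_al.
  have pm : 0 < m `^ (a - 1) by exact: powR_gt0.
  move: (m `^ (a - 1)) h m_a pm => pw h m_a pm.
  have : n%:R * Fbar F m * pw <= c1 * C4.
    apply: (@le_trans _ _ (c1 * m * Fbar F m * pw)); last by nra.
    by rewrite ler_wpM2r ?(ltW pm)// ler_wpM2r// ltW.
  by move=> h2; nra.
have l0 : 0 < l by rewrite lthE.1 oppr_gt0 ln_lt0// nF0.
have th0 : 0 < th by rewrite lthE.2 divr_gt0.
have thm : th * m = l by rewrite lthE.2 divfK// gt_eqF.
(* th m = O(log m) by the lower Potter bound from x0 to m, and log m is at
   most m ^ eta / eta. *)
have lm : l <= C3 * m `^ eta.
  have lnm : ln m <= m `^ eta / eta.
    rewrite ler_pdivlMr// mulrC -ln_powR ltW// ln_sublinear// powR_gt0//.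
  have meta : 1 <= m `^ eta by rewrite -[X in X <= _](powRr0 m); apply: ler_powR => //; exact: ltW.
  have kF : kap / m ^+ 2 <= n%:R * Fbar F m.
    apply: (@le_trans _ _ (Fbar F m)); last by rewrite ler_peMl// ltW.
    have [-> _ _ _] := csE; rewrite ler_pdivrMr ?exprn_gt0// ler_pdivrMr; last lra.
    have x2 : 0 < x0 ^+ 2 by rewrite exprn_gt0.
    have [_] := F_potter (lexx x0) m_x0; rewrite (_ : (m / x0) `^ 2 = m ^+ 2 / x0 ^+ 2); last first.
      by rewrite powR_mulrn ?divr_ge0 ?(ltW m_gt0) ?(ltW x0_gt0)// expr_div_n.
    rewrite mulrA mulrAC ler_pdivlMr// => h.
    by apply: (le_trans h); rewrite le_eqVlt; apply/orP; left; apply/eqP; ring.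
  have m20 : 0 < m ^+ 2 by rewrite exprn_gt0.
  have : l <= - ln (kap / m ^+ 2).
    by rewrite lthE.1 lerN2 ler_ln ?posrE// divr_gt0.
  rewrite ln_div ?posrE// lnXn// -mulr_natl => h.
  have : - ln kap <= `|ln kap| by rewrite -normrN ler_norm.
  have := normr_ge0 (ln kap); have [_ -> _ _] := csE; rewrite mulrDl => h1 h2.
  have : `|ln kap| <= `|ln kap| * m `^ eta by rewrite ler_peMr.
  have -> : 2 / eta * m `^ eta = 2 * (m `^ eta / eta) by ring.
  by lra.
(* Hence the thresholds j / th lie beyond x0, where Potter's bounds hold. *)
have lx0 : l * x0 <= m.
  apply: (@le_trans _ _ (C3 * m `^ eta * x0)); first by rewrite ler_wpM2r// ltW.
  apply: (@le_trans _ _ (m `^ eta * m `^ (1 - eta))).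
    by rewrite mulrAC mulrC ler_wpM2l ?powR_ge0//; exact: m_al.2.
  rewrite -powRD; last by apply/implyP => _; rewrite gt_eqF.
  by rewrite addrCA subrr addr0 powRr1 ?(ltW m_gt0).
split=> //.
have up := mgf_up th m th0 (ltW m_gt0).
have lo := mgf_lo th m (ltW th0) m_gt0 m_m1.
have fn : (\int[F]_(x in `]-oo, m[) (expR (th * x))%:E)%E \is a fin_num.
  by rewrite ge0_fin_numE ?(ltW lo)//; apply: le_lt_trans up (ltry _).
exists (fine (\int[F]_(x in `]-oo, m[) (expR (th * x))%:E)%E); split.
- by rewrite fine_gt0// lo ltey_eq fn.
- rewrite -lee_fin fineK//; apply: (le_trans up); rewrite lee_fin thm.
  have [_ _ _ ->] := csE; rewrite -addrA lerD2l [leRHS]mulrDl; apply: lerD.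
    rewrite -[leRHS]mulrA ler_wpM2l ?mulr_ge0 ?expR_ge0//.
    rewrite mulrAC; apply: ler_wpM2r => //.
    apply: (@le_trans _ _ (C3 `^ a / m)); last first.
      rewrite -mulrA ler_wpM2l ?powR_ge0//.
      by rewrite ler_pdivlMr// mulrC ler_pdivrMr// mulrC.
    apply: (@le_trans _ _ ((C3 * m `^ eta / m) `^ a)).
      apply: ge0_ler_powR; rewrite ?nnegrE ?(ltW th0)//; first by lra.
        by rewrite divr_ge0 ?mulr_ge0 ?powR_ge0 ?(ltW C30) ?(ltW m_gt0).
      by rewrite lthE.2 ler_pM2r// invr_gt0.
    rewrite -mulrA powRM ?(ltW C30)//; last by rewrite divr_ge0 ?powR_ge0 ?(ltW m_gt0).
    rewrite ler_wpM2l ?powR_ge0//.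
    have -> : m `^ eta / m = m `^ (eta - 1).
      rewrite powRB ?powRr1 ?(ltW m_gt0)//.
      by apply/implyP => _; rewrite gt_eqF.
    rewrite -powRrM etaE.
    by rewrite powR_inv1 ?(ltW m_gt0).
  (* Fbar (j / th) <= C (l / j) ^ 2 Fbar m, by the lower Potter bound from
     j / th to m. *)
  apply: (@le_trans _ _ (\sum_(1 <= j < (Num.truncn l).+1)
      C * Fbar F m * (expR (j.+2)%:R * (l / j%:R) ^+ 2))).
    rewrite [leLHS]big_nat_cond [leRHS]big_nat_cond; apply: ler_sum => j.
    rewrite andbT ltnS => /andP[j0 jl'].
    have jl : j%:R <= l by apply: le_trans (_ : (Num.truncn l)%:R <= l); rewrite ?ler_nat// truncn_le ltW.
    have j1 : 1 <= j%:R :> R by rewrite ler1n.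
    have jth : x0 <= j%:R / th.
      rewrite ler_pdivlMr// lthE.2 mulrA ler_pdivrMr// mulrC.
      by apply: (le_trans lx0); rewrite ler_peMl// ltW.
    have jm : j%:R / th <= m by rewrite ler_pdivrMr// mulrC thm.
    have [_ h] := F_potter jth jm.
    rewrite mulrCA ler_wpM2l ?expR_ge0//; apply: (le_trans h).
    rewrite (_ : m / (j%:R / th) = l / j%:R); last first.
      by rewrite -thm; field; rewrite !gt_eqF//; lra.
    rewrite powR_mulrn; last by rewrite divr_ge0//; lra.
    by rewrite mulrAC.
  rewrite -mulr_sumr.
  apply: (@le_trans _ _ (C * Fbar F m * (32 * expR 3 * expR l))).
    by rewrite ler_wpM2l ?sum_steps_le ?(ltW l0)// mulr_ge0 ?(ltW Fm)//; lra.
  have -> : expR l = (n%:R * Fbar F m)^-1 by rewrite lthE.1 expRN lnK.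
  rewrite le_eqVlt; apply/orP; left; apply/eqP; field.
  by rewrite !gt_eqF.
- by rewrite fineK.
Unshelve. all: by end_near.
Qed.

End tilting.

(** * Geometric levels *)

(** Convexity of the negative power function, in the form of a lower bound of
    its decrement. *)
Lemma powRN_decrement (R : realType) (x y e : R) : 0 < x -> x <= y -> 0 < e ->
  e * (y - x) * y `^ (- (1 + e)) <= x `^ (- e) - y `^ (- e).
Proof.
move=> x0 xy e0; have y0 : 0 < y by lra.
have py : 0 < y `^ (- e) by exact: powR_gt0.
have -> : x `^ (- e) = y `^ (- e) * expR (e * ln (y / x)).
  rewrite !powR_expR// -expRD ln_div ?posrE//; congr expR; ring.
have h1 : 1 - x / y <= ln (y / x).
  have := @le_ln1Dx R (x / y - 1).
  rewrite (_ : 1 + (x / y - 1) = x / y); last by ring.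
  rewrite !ln_div ?posrE// => h.
  have : ln x - ln y <= x / y - 1 by apply: h; rewrite ltrBrDr addNr divr_gt0.
  by lra.
have -> : y `^ (- (1 + e)) = y `^ (- e) / y.
  rewrite (_ : - (1 + e) = - e - 1); last by ring.
  by rewrite powRB ?powRr1 ?(ltW y0)//; apply/implyP => _; rewrite gt_eqF.
have h2 := @expR_ge1Dx R (e * ln (y / x)).
have -> : e * (y - x) * (y `^ (- e) / y) = y `^ (- e) * (e * (1 - x / y)).
  by field; rewrite gt_eqF.
rewrite -[X in _ <= _ - X]mulr1 -mulrBr ler_wpM2l ?(ltW py)//.
have : e * (1 - x / y) <= e * ln (y / x) by rewrite ler_wpM2l// ltW.
by lra.
Qed.

Section levels.
Context (R : realType).

Lemma nn_double r k : (1 < r)%N -> (0 < k)%N -> ((nn r k.-1).*2 <= nn r k)%N.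
Proof.
move=> r1; case: k => // -[|k] _ //=.
by rewrite [in leqRHS]expnS -mul2n leq_mul2r r1 orbT.
Qed.

(** Each block is at least half of the range up to its end: r >= 2. *)
Lemma nn_gap r k : (1 < r)%N -> (0 < k)%N ->
  (nn r k)%:R <= 2 * ((nn r k)%:R - (nn r k.-1)%:R) :> R.
Proof.
move=> r1 k0; have : ((nn r k.-1).*2)%:R <= (nn r k)%:R :> R.
  by rewrite ler_nat; exact: nn_double.
by rewrite -mul2n natrM; lra.
Qed.

Lemma level_ge (mu b : R) r k : 0 < mu -> b <= level mu r b k.
Proof. by move=> mu0; rewrite lerDl mulr_ge0// ltW. Qed.

(** Consecutive levels differ by the drift over a block. *)
Lemma levelS (mu b : R) r k : (0 < k)%N ->
  level mu r b k.+1 - level mu r b k = ((nn r k)%:R - (nn r k.-1)%:R) * mu.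
Proof. by case: k => // k _; rewrite /level /=; ring. Qed.

(** The constant comparing n_k with the k-th level. *)
Definition level_cst (mu : R) r : R := r%:R * (1 + mu^-1).

Lemma level_cst_gt0 (mu : R) r : 0 < mu -> (1 < r)%N -> 0 < level_cst mu r.
Proof.
move=> mu0 r1; rewrite mulr_gt0// ?ltr0n ?(ltnW r1)//.
by rewrite addr_gt0// invr_gt0.
Qed.

Lemma nn_le_level (mu b : R) r k : 0 < mu -> (1 < r)%N -> 1 <= b -> (0 < k)%N ->
  (nn r k)%:R <= level_cst mu r * level mu r b k.
Proof.
move=> mu0 r1 b1 k0; have r0 : 0 < r%:R :> R by rewrite ltr0n ltnW.
have im0 : 0 < mu^-1 by rewrite invr_gt0.
rewrite /level_cst /level; case: k k0 => // -[|k] _ /=.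
  by rewrite expn1 mul0r addr0 -mulrA ler_peMr ?(ltW r0)//; nra.
rewrite [in leLHS]expnS natrM -mulrA ler_wpM2l ?(ltW r0)//.
set N : R := (_ ^ _)%:R; have N0 : 0 <= N by [].
rewrite (_ : (1 + mu^-1) * (b + N * mu) = N + (N * mu + b * (1 + mu^-1))).
  by rewrite lerDl addr_ge0 ?mulr_ge0 ?addr_ge0 ?(ltW mu0) ?(ltW im0)//; lra.
by field; rewrite gt_eqF.
Qed.

Lemma levelS_le (mu b : R) r k : 0 < mu -> (1 < r)%N -> 1 <= b -> (0 < k)%N ->
  level mu r b k.+1 <= (1 + level_cst mu r * mu) * level mu r b k.
Proof.
move=> mu0 r1 b1 k0; have := nn_le_level mu0 r1 b1 k0.
have : level mu r b k.+1 = b + (nn r k)%:R * mu by [].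
have := level_ge b r k mu0.
set n : R := (nn r k)%:R; set m := level _ _ _ k; set c := level_cst _ _.
by move=> h1 -> h2; nra.
Qed.

Variables (mu : R) (r : nat).
Hypotheses (mu0 : 0 < mu) (r1 : (1 < r)%N).

(** The ratio of the k-th level to the first one. *)
Definition rho (b : R) k : R := level mu r b k / b.

Lemma rho_ge1 b k : 0 < b -> 1 <= rho b k.
Proof. by move=> b0; rewrite /rho ler_pdivlMr// mul1r level_ge. Qed.

Lemma rho_le b k : 0 < b -> rho b k <= rho b k.+1.
Proof.
move=> b0; rewrite /rho ler_pM2r ?invr_gt0// lerD2l ler_wpM2r ?(ltW mu0)//.
by rewrite ler_nat nn_le// ltnW.
Qed.

Lemma rho_gap b k : 0 < b -> (0 < k)%N ->
  mu / 2 * ((nn r k)%:R / b) <= rho b k.+1 - rho b k.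
Proof.
move=> b0 k0; rewrite /rho -mulrBl levelS// mulrA ler_pM2r ?invr_gt0//.
by have := nn_gap r1 k0; have := mu0; set n : R := (nn r k)%:R; nra.
Qed.

Lemma rhoS_le b k : 1 <= b -> (0 < k)%N ->
  rho b k.+1 <= (1 + level_cst mu r * mu) * rho b k.
Proof.
move=> b1 k0; have b0 : 0 < b by lra.
by rewrite /rho mulrA ler_pM2r ?invr_gt0// levelS_le.
Qed.

Lemma nn_le_rho b k : 1 <= b -> (0 < k)%N ->
  (nn r k)%:R <= level_cst mu r * b * rho b k.
Proof.
move=> b1 k0; have b0 : 0 < b by lra.
apply: (le_trans (nn_le_level mu0 r1 b1 k0)).
by rewrite /rho -mulrA [b * _]mulrC divfK// gt_eqF.
Qed.

Lemma rho0 b : 0 < b -> rho b 0 = 1.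
Proof. by move=> b0; rewrite /rho /level/= mul0r addr0 divff// gt_eqF. Qed.

(** The series of n_k / b rho_k ^ -(1 + e) is bounded uniformly in b: up to a
    constant, its terms are the decrements of rho_k ^ - e. *)
Lemma sum_rho_le (e : R) : 0 < e -> exists2 C : R, 0 < C & forall b : R, 1 <= b ->
  (\sum_(k <oo) (if (0 < k)%N then
     (nn r k)%:R / b * rho b k `^ (- (1 + e)) else 0)%:E <= C%:E)%E.
Proof.
move=> e0; set c2 := 1 + level_cst mu r * mu.
have c2_gt0 : 0 < c2 by rewrite addr_gt0// mulr_gt0// level_cst_gt0.
set C := 2 / mu / e * c2 `^ (1 + e).
have C0 : 0 < C by rewrite !mulr_gt0 ?invr_gt0 ?powR_gt0.
exists C => // b b1; have b0 : 0 < b by lra.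
have rho_gt0 k : 0 < rho b k by apply: lt_le_trans (rho_ge1 k b0).
have -> : C%:E = (C * rho b 0 `^ (- e))%:E by rewrite rho0// powR1 mulr1.
apply: (nneseries_le_telescope (v := fun k => C * rho b k `^ (- e))).
- by move=> k; rewrite lee_fin; case: ifP => // _; rewrite !mulr_ge0 ?powR_ge0 ?invr_ge0 ?(ltW b0).
- by move=> k; rewrite mulr_ge0 ?powR_ge0 ?(ltW C0).
move=> k; rewrite lee_fin -mulrBr; case: ifPn => [k0|]; last first.
  rewrite -leqNgt leqn0 => /eqP ->.
  by rewrite /rho /level /= subrr mulr0.
have x1 := rho_gap b0 k0; have x2 := rhoS_le b1 k0.
set x := rho b k in x1 x2 *; set y := rho b k.+1 in x1 x2 *.
have x0 : 0 < x by exact: rho_gt0.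
have y0 : 0 < y by exact: rho_gt0.
have dec := powRN_decrement x0 (rho_le k b0) e0; rewrite -/y in dec.
apply: (@le_trans _ _ (C * (e * (y - x) * y `^ (- (1 + e))))); last first.
  by rewrite ler_wpM2l// ltW.
have py : x `^ (- (1 + e)) <= c2 `^ (1 + e) * y `^ (- (1 + e)).
  rewrite !powRN -ler_pdivrMl ?powR_gt0// -invfM -powRM ?(ltW c2_gt0) ?(ltW x0)//.
  rewrite lef_pV2 ?posrE ?(powR_gt0 _ y0) ?(powR_gt0 _ (mulr_gt0 c2_gt0 x0))//.
  apply: ge0_ler_powR.
  - by rewrite addr_ge0// ltW.
  - by rewrite nnegrE ltW.
  - by rewrite nnegrE; exact: mulr_ge0 (ltW c2_gt0) (ltW x0).
  - exact: x2.
apply: (@le_trans _ _ ((nn r k)%:R / b * (c2 `^ (1 + e) * y `^ (- (1 + e))))).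
  by rewrite ler_wpM2l// divr_ge0// ltW.
rewrite /C (_ : 2 / mu / e * c2 `^ (1 + e) * (e * (y - x) * y `^ (- (1 + e))) =
  (2 / mu * (y - x)) * (c2 `^ (1 + e) * y `^ (- (1 + e)))); last first.
  by field; rewrite !gt_eqF.
rewrite ler_wpM2r ?mulr_ge0 ?powR_ge0//.
rewrite -ler_pdivrMl ?divr_gt0//; apply: le_trans x1.
by rewrite invfM invrK [2^-1 * _]mulrC.
Qed.

End levels.

(** * Moments of the estimator *)

Section pathwise_bounds.
Context (R : realType) (F : probability R R) (mu : R) (r : nat).
Hypotheses (mu0 : 0 < mu) (r1 : (1 < r)%N).
Local Notation incr := (increments R).

Lemma Fbar_noninc (x y : R) : x <= y -> Fbar F y <= Fbar F x.
Proof.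
move=> xy; rewrite -lee_fin -!FbarE; apply: le_measure; rewrite ?inE//.
by move=> z /=; rewrite !in_itv/= !andbT; exact: le_lt_trans.
Qed.

Lemma div_count_le (v : R) (N : nat) (A : set incr) x :
  0 <= v -> v / N%:R * \1_A x <= v.
Proof.
move=> v0; apply: (@le_trans _ _ (v / N%:R)).
  by rewrite indicE ler_piMr ?divr_ge0//; case: (_ \in _).
case: N => [|N]; first by rewrite invr0 mulr0.
by rewrite ler_piMr// invf_le1 ?ler1n ?ltr0n.
Qed.

Lemma q_le b k : (0 < k)%N -> q F mu r b k <= (nn r k)%:R * Fbar F (level mu r b k).
Proof.
move=> k0; apply: (@le_trans _ _ (\sum_((nn r k.-1).+1 <= i < (nn r k).+1)
    Fbar F (level mu r b k))).
  rewrite /q [leLHS]big_nat_cond [leRHS]big_nat_cond; apply: ler_sum => i.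
  rewrite andbT => /andP[ai _]; apply: Fbar_noninc.
  by rewrite /level lerD2l ler_wpM2r ?(ltW mu0)// ler_nat ltnW.
by rewrite sumr_const_nat subSS -[leLHS]mulr_natl ler_wpM2r ?Fbar_ge0// ler_nat leq_subr.
Qed.

Lemma Z1_le b k x : (0 < k)%N ->
  Z1 F mu r b k x <= (nn r k)%:R * Fbar F (level mu r b k).
Proof.
move=> k0; apply: le_trans (q_le b k0); apply: div_count_le.
by apply: sumr_ge0 => i _; exact: Fbar_ge0.
Qed.

Lemma Z3_le b k x : Z3 F mu r b k x <= (nn r k)%:R * Fbar F (level mu r b k).
Proof. by apply: div_count_le; rewrite mulr_ge0// Fbar_ge0. Qed.

(** On its support, the likelihood ratio of the tilted walk is at most
    exp (- th m) exp (tau Lambda) with exp (- th m) = n Fbar m. *)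
Lemma Z2_le b k x (C' D : R) : (0 < k)%N -> 0 < b -> 0 <= C' ->
  0 < (nn r k)%:R * Fbar F (level mu r b k) ->
  0 < theta F mu r b k -> 0 < D -> D <= 1 + C' / (nn r k)%:R ->
  (\int[F]_(x in `]-oo, level mu r b k[) (expR (theta F mu r b k * x))%:E = D%:E)%E ->
  Z2 F mu r b k x <= expR C' * ((nn r k)%:R * Fbar F (level mu r b k)).
Proof.
move=> k0 b0 C'0 nF0 th0 D0 DC DE.
have n0 : 0 < (nn r k)%:R :> R by rewrite ltr0n (leq_ltn_trans _ (nn_lt r1 k0)).
have m0 : 0 < level mu r b k by apply: lt_le_trans (level_ge b r k mu0).
have La : Lambda F mu r b k (theta F mu r b k) <= C' / (nn r k)%:R.
  rewrite /Lambda /Rintegral DE/=; have := @le_ln1Dx R (D - 1).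
  rewrite (_ : 1 + (D - 1) = D); last by ring.
  by move=> h; have := h _; lra.
set th := theta _ _ _ _ _ in th0 DE La *.
have eth : expR (- th * level mu r b k) = (nn r k)%:R * Fbar F (level mu r b k).
  by rewrite /th /theta mulNr divfK ?gt_eqF// opprK lnK.
rewrite /Z2 -/th indicE; have [/set_mem xC|_] := boolP (_ \in _); last first.
  by rewrite mulr0 mulr_ge0 ?expR_ge0// ltW.
rewrite mulr1 -eth -expRD ler_expR.
have [[/andP[t1 t2]] _] := xC.
have /tau_fin_hit[t xt] : (tau mu b x < +oo)%E by apply: le_lt_trans t2 (ltry _).
rewrite (hit_tau xt) /= natrK.
move: t1 t2; rewrite (hit_tau xt) lte_fin lee_fin ltr_nat ler_nat => t1 t2.
have Sx : level mu r b k <= walk x t.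
  have : b < walk x t - t%:R * mu.
    case: xt => /ge_tauP ge1 ge2; rewrite ltNge; apply/negP => le3.
    apply: ge2; apply/ge_tauP => s; rewrite ltnS leq_eqVlt => /predU1P[->//|].
    exact: ge1.
  have : (nn r k.-1)%:R * mu <= t%:R * mu.
    by rewrite ler_wpM2r ?(ltW mu0)// ler_nat ltnW.
  by rewrite /level; lra.
have h1 : - th * walk x t <= - th * level mu r b k.
  by rewrite !mulNr lerN2 ler_wpM2l// ltW.
have h2 : t%:R * Lambda F mu r b k th <= C'.
  apply: (@le_trans _ _ (t%:R * (C' / (nn r k)%:R))); first by rewrite ler_wpM2l.
  rewrite mulrA ler_pdivrMr// mulrC ler_wpM2l// ler_nat//.
by lra.
Qed.

Lemma Z_le (p : nat -> R) b k z (CZ : R) : (0 < k)%N -> 0 < p k ->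
  (forall x, Z2 F mu r b k x <= CZ * ((nn r k)%:R * Fbar F (level mu r b k))) ->
  Z F mu r p b (k, z) <=
  (2 + CZ) * ((nn r k)%:R * Fbar F (level mu r b k)) / p k.
Proof.
move=> k0 pk Z2C; rewrite /Z/= ler_pM2r ?invr_gt0//.
have := Z1_le b z.1.1 k0; have := Z2C z.1.2; have := Z3_le b k z.2.
by move=> h1 h2 h3; rewrite mulrDl; lra.
Qed.

End pathwise_bounds.

Section moments_under_Q.
Context (R : realType) (F : probability R R) (mu : R) (r : nat).
Hypotheses (mu0 : 0 < mu) (r1 : (1 < r)%N).
Variables (p : nat -> R) (b : R).
Hypothesis pmf : is_pmf p.

(** The moment of the estimator when Z <= phi k on the runs with K = k. *)
Lemma moment_le (phi : nat -> R) (g : R) : 0 < 1 + g ->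
  (forall k, 0 <= phi k) ->
  (forall k z, (0 < k)%N -> Z F mu r p b (k, z) <= phi k) ->
  ('E_(Q F mu r p b)[(fun w => Z F mu r p b w `^ (1 + g))%R] <=
   \sum_(k <oo) (if (0 < k)%N then p k * phi k `^ (1 + g) else 0)%:E)%E.
Proof.
move=> g0 phi0 Zphi.
have mZ : measurable_fun setT (fun w => Z F mu r p b w `^ (1 + g)).
  exact: (measurableT_comp (measurable_powR (1 + g)) (measurable_Z F mu p b r1)).
rewrite unlock integral_Q//; last 2 first.
- exact/measurable_EFinP.
- by move=> w; rewrite lee_fin powR_ge0.
apply: lee_nneseries => [k _ _|k _].
  by case: ifP => [k0|_]; rewrite ?mul0e// mule_ge0 ?lee_fin ?(ltW (pmf.1 k k0))//;
    apply: integral_ge0 => z _; rewrite lee_fin powR_ge0.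
case: ifPn => [k0|_]; last by rewrite mul0e.
have pk := pmf.1 k k0; rewrite EFinM lee_wpmul2l ?lee_fin ?(ltW pk)//.
apply: (@le_trans _ _ (\int[(law1 F mu r b k \x law2 F mu r b k \x law3 F mu r b k)%E]_z
   (phi k `^ (1 + g))%:E)%E); last first.
  by rewrite integral_cst// [X in (_ * X)%E](_ : _ = 1%E) ?mule1//; exact: probability_setT.
apply: ge0_le_integral => //.
- by move=> z _; rewrite lee_fin powR_ge0.
- by apply/measurable_EFinP; exact: (measurableT_comp mZ (measurable_pair1 k)).
- move=> z _; rewrite lee_fin; apply: ge0_ler_powR; rewrite ?nnegrE ?(ltW g0) ?Zphi//.
  exact: Z_ge0.
Qed.

Lemma mean_nu : ('E_(Q F mu r p b)[(fun w => (nu r w)%:R : R)%R] =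
  \sum_(k <oo) (if (0 < k)%N then p k * (nn r k)%:R else 0)%:E)%E.
Proof.
have mnu : measurable_fun setT
    (fun w : nat * (increments R * increments R * increments R) => (nu r w)%:R : R).
  by apply: measurable_nat_sections => k; rewrite /nu/=; exact: measurable_cst.
rewrite unlock integral_Q//; last exact/measurable_EFinP.
apply: eq_eseriesr => k _; rewrite /nu/=.
rewrite integral_cst// [X in (_ * (_ * X))%E](_ : _ = 1%E); last exact: probability_setT.
by rewrite mule1; case: ifP => _; rewrite ?mul0e// EFinM.
Qed.

End moments_under_Q.

(** A limit superior at +oo is less than +oo if and only if the function is
    eventually bounded above by a real number. *)
Lemma limf_esup_lty (R : realType) (f : R -> \bar R) (M : R) :
  (\forall x \near +oo, (f x <= M%:E)%E) ->
  (limf_esup f (pinfty_nbhs R) < +oo)%E.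
Proof.
move=> fM; apply: (@le_lt_trans _ _ M%:E); last exact: ltry.
rewrite /limf_esup; set V := [set x | (f x <= M%:E)%E].
apply: (@le_trans _ _ (ereal_sup (f @` V))).
  by apply: ereal_inf_lbound; exists V.
by apply: ge_ereal_sup => _ [x Vx <-].
Qed.

Lemma limf_esup_lty_bound (R : realType) (f : R -> \bar R) :
  (limf_esup f (pinfty_nbhs R) < +oo)%E ->
  exists M : R, \forall x \near +oo, (f x <= M%:E)%E.
Proof.
move=> /ereal_inf_lt[_ [V VF <-]] supV.
exists (fine (Order.max (ereal_sup (f @` V)) 0)%E).
have fin : (Order.max (ereal_sup (f @` V)) 0)%E \is a fin_num.
  by rewrite ge0_fin_numE ?le_max ?lexx ?orbT// gt_max supV ltry.
rewrite fineK//; apply: filterS VF => x Vx.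
by rewrite le_max; apply/orP; left; apply: ereal_sup_ubound; exists x.
Qed.

(** The tilting rate is positive and the tilt is a bounded change of measure
    along a whole block. *)
Definition bounded_tilts (R : realType) (F : probability R R) (mu : R) r :=
  exists C' : R, \forall b \near +oo, forall k, (0 < k)%N ->
  0 < theta F mu r b k /\ exists D : R, [/\ 0 < D, D <= 1 + C' / (nn r k)%:R &
    (\int[F]_(x in `]-oo, level mu r b k[)
        (expR (theta F mu r b k * x))%:E = D%:E)%E].

Section moment_asymptotics.
Context (R : realType) (F : probability R R) (mu : R) (r : nat) (alpha : R).
Hypotheses (mu0 : 0 < mu) (r1 : (1 < r)%N) (alpha1 : 1 < alpha).
Hypothesis Fbar_gt0 : forall x : R, 0 < x -> 0 < Fbar F x.
Hypothesis Fbar_potter : potter_bounds (Fbar F) alpha.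

Hypothesis tilt_ok : bounded_tilts F mu r.

(** One term of the moment series, when the tail at the k-th level is at most
    C rh ^ - a Fb and the weight is at least c x rh ^ - kappa. *)
Lemma power_term (CZ n fk pk x rh Fb b c C a kappa g : R) :
  0 < CZ -> 0 < n -> 0 < fk -> 0 < pk -> 0 < x -> 0 < rh -> 0 < Fb -> 0 < b ->
  0 < c -> 0 < C -> 0 < g -> n = x * b -> fk <= C * rh `^ (- a) * Fb ->
  c * x * rh `^ (- kappa) <= pk ->
  pk * (CZ * (n * fk) / pk) `^ (1 + g) <=
  (CZ * C) `^ (1 + g) * c `^ (- g) * (b * Fb) `^ (1 + g) *
    (x * rh `^ (- (a * (1 + g) - g * kappa))).
Proof.
move=> CZ0 n0 fk0 pk0 x0 rh0 Fb0 b0 c0 C0 g0 nE fkle pkge.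
have G0 : 0 <= 1 + g by lra.
have nf0 : 0 < CZ * (n * fk) by rewrite !mulr_gt0.
have prh s : 0 < rh `^ s by exact: powR_gt0.
have -> : pk * (CZ * (n * fk) / pk) `^ (1 + g) =
    (CZ * (n * fk)) `^ (1 + g) * pk `^ (- g).
  rewrite powRM ?invr_ge0 ?(ltW nf0) ?(ltW pk0)// mulrCA; congr (_ * _).
  rewrite -powR_inv1 ?(ltW pk0)// -powRrM -[X in X * _]powRr1 ?(ltW pk0)//.
  by rewrite -powRD; [congr (_ `^ _); ring|apply/implyP => _; rewrite gt_eqF].
have y0 : 0 < CZ * C * (b * Fb) * (x * rh `^ (- a)) by rewrite !mulr_gt0.
have z0 : 0 < c * x * rh `^ (- kappa) by rewrite !mulr_gt0.
apply: (@le_trans _ _ ((CZ * C * (b * Fb) * (x * rh `^ (- a))) `^ (1 + g) *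
   (c * x * rh `^ (- kappa)) `^ (- g))).
  apply: ler_pM; rewrite ?powR_ge0//.
    apply: ge0_ler_powR => //; rewrite ?nnegrE ?(ltW nf0) ?(ltW y0)//.
    rewrite (_ : CZ * C * (b * Fb) * (x * rh `^ (- a)) =
      CZ * (n * (C * rh `^ (- a) * Fb))); last by rewrite nE; ring.
    by rewrite !ler_pM2l.
  rewrite [leLHS]powRN [leRHS]powRN lef_pV2 ?posrE ?powR_gt0//.
  by apply: ge0_ler_powR; rewrite ?nnegrE ?(ltW g0) ?(ltW z0) ?(ltW pk0).
rewrite le_eqVlt; apply/orP; left; apply/eqP.
have E : forall u s, 0 < u -> u `^ s = expR (s * ln u) by move=> u s; exact: powR_expR.
have lnrh s : ln (rh `^ s) = s * ln rh by exact: ln_powR.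
have bF0 : 0 < b * Fb by exact: mulr_gt0.
have CC0 : 0 < CZ * C by exact: mulr_gt0.
have xr0 : 0 < x * rh `^ (- a) by exact: mulr_gt0.
rewrite !powRM ?(ltW CZ0) ?(ltW C0) ?(ltW bF0) ?(ltW CC0) ?(ltW xr0) ?(ltW x0)
  ?(ltW c0) ?(ltW Fb0) ?(ltW b0) ?(mulr_ge0 (ltW CC0) (ltW bF0)) ?(mulr_ge0 (ltW c0) (ltW x0)) ?powR_ge0//.
have hx : x `^ (1 + g) * x `^ (- g) = x.
  by rewrite -powRD ?addrK ?powRr1 ?(ltW x0)//; apply/implyP => _; rewrite gt_eqF.
have hr : rh `^ (- a) `^ (1 + g) * rh `^ (- kappa) `^ (- g) =
    rh `^ (- (a * (1 + g) - g * kappa)).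
  rewrite -!powRrM -powRD; last by apply/implyP => _; rewrite gt_eqF.
  by congr (_ `^ _); ring.
rewrite -hr -[in RHS]hx.
move: (CZ `^ _) (C `^ _) (b `^ _) (Fb `^ _) (x `^ (1 + g)) (x `^ (- g)) (c `^ _).
move: (rh `^ (- a) `^ _) (rh `^ (- kappa) `^ _) => *; ring.
Qed.

(** The exponent condition leaves room for replacing alpha by a smaller a in the
    upper Potter bound. *)
Lemma Z_moment_bound (p : R -> nat -> R) (kappa g c : R) :
  0 < g -> 0 <= kappa -> 1 < alpha * (1 + g) - g * kappa -> 0 < c ->
  (forall b, 0 < b -> is_pmf (p b)) ->
  (\forall b \near +oo, forall k, (0 < k)%N ->
     c * ((nn r k)%:R / b) * rho mu r b k `^ (- kappa) <= p b k) ->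
  exists2 K : R, 0 < K & \forall b \near +oo,
    ('E_(Q F mu r (p b) b)[(fun w => Z F mu r (p b) b w `^ (1 + g))%R] <=
     (K * (b * Fbar F b) `^ (1 + g))%:E)%E.
Proof.
move=> g0 kap0 E1 c0 pmf plow; have al1 := alpha1; have [C' tilt] := tilt_ok.
set E := alpha * (1 + g) - g * kappa - 1.
have E0 : 0 < E by rewrite /E; lra.
(* Half of the surplus E is spent on a < alpha; the other half makes
   [sum_rho_le] applicable. *)
set a := alpha - E / (2 * (1 + g)).
have gg : 0 < 2 * (1 + g) by lra.
have a_lt : a < alpha by rewrite /a ltrBlDr ltrDl divr_gt0.
have a0 : 0 <= a.
  rewrite /a subr_ge0 ler_pdivrMr// /E.
  have : 0 <= g * kappa by rewrite mulr_ge0// ltW.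
  have : 0 <= alpha * (1 + g) by rewrite mulr_ge0//; lra.
  by lra.
have aE : a * (1 + g) - g * kappa = 1 + E / 2.
  by rewrite /a /E; field; lra.
have al_lt : alpha < alpha + 1 by lra.
have [x0 [C [x01 C1 potter]]] := Fbar_potter a0 a_lt al_lt.
have E20 : 0 < E / 2 by lra.
have [C5 C50 sumC5] := sum_rho_le mu0 r1 E20.
set CZ := 2 + expR `|C'|.
have CZ0 : 0 < CZ by rewrite /CZ addr_gt0 ?expR_gt0.
have C0 : 0 < C by lra.
set K0 := (CZ * C) `^ (1 + g) * c `^ (- g).
have K00 : 0 < K0 by rewrite mulr_gt0// powR_gt0// mulr_gt0.
exists (K0 * C5); first exact: mulr_gt0.
near=> b.
have b_x0 : x0 <= b by near: b; apply: nbhs_pinfty_ge; rewrite num_real.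
have b1 : 1 <= b by lra.
have b0 : 0 < b by lra.
have tiltb : forall k, (0 < k)%N ->
  0 < theta F mu r b k /\ exists D : R, [/\ 0 < D, D <= 1 + C' / (nn r k)%:R &
    (\int[F]_(x in `]-oo, level mu r b k[)
        (expR (theta F mu r b k * x))%:E = D%:E)%E] by near: b.
have plowb : forall k, (0 < k)%N ->
     c * ((nn r k)%:R / b) * rho mu r b k `^ (- kappa) <= p b k by near: b.
have pb := pmf b b0.
have m0 k : 0 < level mu r b k by apply: lt_le_trans b0 (level_ge b r k mu0).
have Fm0 k : 0 < Fbar F (level mu r b k) by exact: Fbar_gt0.
pose phi k := if (0 < k)%N then
  CZ * ((nn r k)%:R * Fbar F (level mu r b k)) / p b k else 0.
apply: (le_trans (@moment_le _ F mu r r1 (p b) b pb phi g _ _ _)).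
- by lra.
- move=> k; rewrite /phi; case: ifP => // k0.
  rewrite divr_ge0 ?(ltW (pb.1 k k0))// mulr_ge0 ?(ltW CZ0)// mulr_ge0//.
  exact: Fbar_ge0.
- move=> k z k0; rewrite /phi k0; apply: Z_le => //; first exact: pb.1.
  move=> x; have [th0 [D [D0 DC DE]]] := tiltb k k0.
  have n0 : 0 < (nn r k)%:R :> R by rewrite ltr0n (leq_ltn_trans _ (nn_lt r1 k0)).
  apply: (@Z2_le _ F mu r mu0 r1 b k x `|C'| D) => //.
    by rewrite mulr_gt0.
  by apply: (le_trans DC); rewrite lerD2l ler_pM2r ?invr_gt0// ler_norm.
have bF0 : 0 <= (b * Fbar F b) `^ (1 + g) by exact: powR_ge0.
apply: (@le_trans _ _ (\sum_(k <oo) ((K0 * (b * Fbar F b) `^ (1 + g))%:E *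
   (if (0 < k)%N then
     (nn r k)%:R / b * rho mu r b k `^ (- (1 + E / 2)) else 0)%:E))%E).
  apply: lee_nneseries => [k _ _|k _].
    by case: ifP => // k0; rewrite lee_fin mulr_ge0 ?powR_ge0 ?(ltW (pb.1 k k0)).
  rewrite -EFinM lee_fin; case: ifPn => [k0|_]; last by rewrite mulr0.
  have n0 : 0 < (nn r k)%:R :> R by rewrite ltr0n (leq_ltn_trans _ (nn_lt r1 k0)).
  have rh1 := rho_ge1 r mu0 k b0.
  rewrite /phi k0 -aE /K0; apply: power_term => //.
  - exact: pb.1.
  - exact: divr_gt0.
  - by lra.
  - exact: Fbar_gt0.
  - by rewrite divfK// gt_eqF.
  - have [h _] := potter b (level mu r b k) b_x0 (level_ge b r k mu0).
    apply: (le_trans h); rewrite le_eqVlt; apply/orP; left; apply/eqP.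
    have -> : b / level mu r b k = rho mu r b k `^ (-1).
      by rewrite powR_inv1 ?(le_trans ler01 rh1)// /rho invf_div.
    by rewrite -powRrM mulN1r.
  - exact: plowb.
rewrite nneseriesZl//; last first.
  move=> k _; rewrite lee_fin; case: ifP => // _.
  by rewrite mulr_ge0 ?powR_ge0// divr_ge0// ltW.
apply: (@le_trans _ _ ((K0 * (b * Fbar F b) `^ (1 + g))%:E * C5%:E)%E).
  by apply: lee_wpmul2l; [rewrite lee_fin mulr_ge0 ?(ltW K00)|exact: sumC5].
by rewrite -EFinM lee_fin mulrAC.
Unshelve. all: by end_near.
Qed.

End moment_asymptotics.

(** * A selection for all moment orders *)

Lemma eseries_telescope (R : realType) (v : nat -> R) : v n @[n --> \oo] --> 0 ->
  (\sum_(1 <= k <oo) (v k - v k.+1)%:E = (v 1%N)%:E)%E.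
Proof.
move=> v0; apply: cvg_lim => //.
rewrite (_ : (v 1%N)%:E = (v 1%N - 0)%:E); last by rewrite subr0.
have h : (v 1%N - v n)%:E @[n --> \oo] --> (v 1%N - 0)%:E.
  by apply: cvg_EFin; [exact: nearW|apply: cvgB => //; exact: cvg_cst].
apply: cvg_trans h; apply: near_eq_cvg; exists 1%N => // n /= n1.
rewrite sumEFin; congr (_%:E).
rewrite (@telescope_sumr_eq _ _ _ (fun j => - v j))//.
  by rewrite opprK addrC.
by move=> j _; rewrite opprK addrC.
Qed.

Section level_limits.
Context (R : realType) (mu : R) (r : nat).
Hypotheses (mu0 : 0 < mu) (r1 : (1 < r)%N).

Lemma nn_ge k : (k <= nn r k)%N.
Proof. by case: k => // k /=; apply: ltnW; exact: ltn_expl. Qed.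

(** Sequences dominated by a negative power of the levels tend to 0. *)
Lemma cvg_level0 (v : nat -> R) (b C e : R) : 0 < b -> 0 < C -> 0 < e ->
  (forall k, 0 <= v k) -> (forall k, v k <= C * level mu r b k `^ (- e)) ->
  v n @[n --> \oo] --> 0.
Proof.
move=> b0 C0 e0 v0 vC; apply/cvgr0Pnorm_le => eps eps0.
have [M [_ HM]] : \forall m \near +oo, C / eps <= m `^ e by exact: powR_near_pinfty.
have [N MN] : exists N : nat, `|M| < N%:R * mu.
  exists (Num.truncn (`|M| / mu)).+1; rewrite -ltr_pdivrMr//.
  exact: truncnS_gt.
exists N.+1 => // n /= Nn; rewrite ger0_norm//.
have Ml : M < level mu r b n.
  apply: (le_lt_trans (ler_norm M)); apply: (lt_le_trans MN).
  rewrite /level -[leLHS]add0r; apply: lerD; first exact: ltW.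
  rewrite ler_wpM2r ?(ltW mu0)// ler_nat; apply: leq_trans (nn_ge n.-1).
  by rewrite -ltnS prednK// (leq_ltn_trans _ Nn).
have l0 : 0 < level mu r b n by apply: lt_le_trans b0 (level_ge b r n mu0).
apply: (le_trans (vC n)); rewrite powRN ler_pdivrMr ?powR_gt0// mulrC.
by rewrite -ler_pdivrMr//; exact: HM.
Qed.

End level_limits.

Section log_selection.
Context (R : realType) (mu : R) (r : nat).
Hypotheses (mu0 : 0 < mu) (r1 : (1 < r)%N).

(** A decreasing function with value 1 at 1, barely integrable at infinity.  Up
    to logarithms its increments along the levels are of the order of
    (n_k / b) rho_k ^ - 2, which serves all the moment orders at once. *)
Definition log_tail (v : R) : R := (v * (1 + ln v) ^+ 2)^-1.

(** The increments of [log_tail] along the ratios of the levels. *)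
Definition log_selection (b : R) k : R :=
  log_tail (rho mu r b k) - log_tail (rho mu r b k.+1).

Lemma one_ln_ge1 (v : R) : 1 <= v -> 1 <= 1 + ln v.
Proof. by move=> v1; rewrite lerDl ln_ge0. Qed.

Lemma log_tail_gt0 (v : R) : 1 <= v -> 0 < log_tail v.
Proof.
move=> v1; have := one_ln_ge1 v1 => a1.
by rewrite /log_tail invr_gt0 mulr_gt0 ?exprn_gt0//; lra.
Qed.

Lemma log_tail_decrement (v w : R) : 1 <= v -> v <= w ->
  (w - v) / (v * w * (1 + ln v) ^+ 2) <= log_tail v - log_tail w.
Proof.
move=> v1 vw; have w1 : 1 <= w by lra.
have a1 := one_ln_ge1 v1; have c1 := one_ln_ge1 w1.
have ac : 1 + ln v <= 1 + ln w by rewrite lerD2l ler_ln// posrE; lra.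
set a := 1 + ln v in a1 ac *; set c := 1 + ln w in c1 ac *.
have h : log_tail w <= (w * a ^+ 2)^-1.
  rewrite /log_tail -/c lef_pV2 ?posrE ?mulr_gt0 ?exprn_gt0//; try lra.
  by rewrite ler_pM2l; [apply: lerXn2r; rewrite ?nnegrE; lra|lra].
apply: (@le_trans _ _ (log_tail v - (w * a ^+ 2)^-1)); last by rewrite lerD2l lerN2.
rewrite le_eqVlt; apply/orP; left; apply/eqP; rewrite /log_tail -/a.
by field; rewrite !gt_eqF//; lra.
Qed.

(** The increments of [log_tail], weighted by v, are dominated by the increments
    of a bounded function. *)
Lemma log_tail_weight (v w : R) : 1 <= v -> v <= w ->
  v * (log_tail v - log_tail w) <=
  ((1 + ln v) ^- 2 + (1 + ln v)^-1) - ((1 + ln w) ^- 2 + (1 + ln w)^-1).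
Proof.
move=> v1 vw; have w1 : 1 <= w by lra.
have a1 := one_ln_ge1 v1; have c1 := one_ln_ge1 w1.
have v_gt0 : 0 < v by lra.
have w_gt0 : 0 < w by lra.
have ac : ln v <= ln w by rewrite ler_ln// posrE; lra.
have vwl : 1 - v / w <= ln w - ln v.
  have := @le_ln1Dx R (v / w - 1).
  rewrite (_ : 1 + (v / w - 1) = v / w); last by ring.
  rewrite ln_div ?posrE// => h.
  have : ln v - ln w <= v / w - 1 by apply: h; rewrite ltrBrDr addNr divr_gt0.
  by lra.
set a := 1 + ln v in a1 *; set c := 1 + ln w in c1 *.
have ca : c - a = ln w - ln v by rewrite /a /c; ring.
rewrite -ca in vwl.
have c_ge_a : a <= c by rewrite /a /c lerD2l.
have -> : v * (log_tail v - log_tail w) = (a ^- 2 - c ^- 2) + (1 - v / w) * c ^- 2.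
  by rewrite /log_tail -/a -/c; field; rewrite !gt_eqF//; lra.
have : (1 - v / w) * c ^- 2 <= a^-1 - c^-1.
  apply: (@le_trans _ _ ((c - a) * c ^- 2)).
    by rewrite ler_wpM2r// invr_ge0 exprn_ge0//; lra.
  have -> : a^-1 - c^-1 = (c - a) * (a * c)^-1 by field; rewrite !gt_eqF//; lra.
  rewrite ler_wpM2l ?subr_ge0// lef_pV2 ?posrE ?exprn_gt0 ?mulr_gt0//; try lra.
  by rewrite expr2 ler_wpM2r//; lra.
by lra.
Qed.

Lemma log_tail_le (v : R) : 1 <= v -> log_tail v <= v `^ (-1).
Proof.
move=> v1; have a1 := one_ln_ge1 v1; have v0 : 0 < v by lra.
rewrite powR_inv1 ?(ltW v0)// /log_tail lef_pV2 ?posrE ?mulr_gt0 ?exprn_gt0//; try lra.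
by rewrite ler_peMr ?(ltW v0)// exprn_ege1.
Qed.

Lemma rho_lt b k : 0 < b -> (0 < k)%N -> rho mu r b k < rho mu r b k.+1.
Proof.
move=> b0 k0; rewrite -subr_gt0; apply: lt_le_trans (rho_gap mu0 r1 b0 k0).
rewrite mulr_gt0 ?divr_gt0// ltr0n; exact: leq_ltn_trans _ (nn_lt r1 k0).
Qed.

Lemma log_selection_pmf b : 0 < b -> is_pmf (log_selection b).
Proof.
move=> b0; split=> [k k0|].
  have rl := rho_lt b0 k0; have rk1 := rho_ge1 r mu0 k b0.
  apply: lt_le_trans (log_tail_decrement rk1 (ltW rl)).
  have a1 := one_ln_ge1 rk1.
  have v0 : 0 < rho mu r b k by lra.
  have w0 : 0 < rho mu r b k.+1 by lra.
  apply: divr_gt0; first by rewrite subr_gt0.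
  by apply: mulr_gt0; [exact: mulr_gt0|apply: exprn_gt0; lra].
rewrite (@eseries_telescope _ (fun k => log_tail (rho mu r b k))).
  by rewrite /rho /level /= mul0r addr0 divff ?gt_eqF// /log_tail ln1 addr0 mul1r expr1n invr1.
apply: (@cvg_level0 _ mu r mu0 r1 _ b b 1) => // k.
  by rewrite ltW// log_tail_gt0// rho_ge1.
apply: (le_trans (log_tail_le (rho_ge1 r mu0 k b0))).
have l0 : 0 < level mu r b k by apply: lt_le_trans b0 (level_ge b r k mu0).
by rewrite /rho !powR_inv1 ?invf_div ?divr_ge0 ?(ltW l0) ?(ltW b0).
Qed.

(** The logarithm costs an arbitrarily small power of rho_k. *)
Lemma log_selection_ge (eta b : R) k : 0 < eta -> 1 <= b -> (0 < k)%N ->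
  mu / 2 / (1 + level_cst mu r * mu) / (1 + eta^-1) ^+ 2 * ((nn r k)%:R / b)
    * rho mu r b k `^ (- (2 + 2 * eta)) <= log_selection b k.
Proof.
move=> eta0 b1 k0; have b0 : 0 < b by lra.
have rl := rho_lt b0 k0; have rk1 := rho_ge1 r mu0 k b0.
apply: le_trans (log_tail_decrement rk1 (ltW rl)).
have gap := rho_gap mu0 r1 b0 k0; have up := rhoS_le mu0 r1 b1 k0.
have a1 := one_ln_ge1 rk1.
set v := rho mu r b k in rl rk1 gap up a1 *; set w := rho mu r b k.+1 in rl gap up *.
set c2 := 1 + level_cst mu r * mu in up *.
have c20 : 0 < c2 by rewrite addr_gt0// mulr_gt0// level_cst_gt0.
clearbody v w c2.
have v0 : 0 < v by lra.
have w0 : 0 < w by lra.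
have ie0 : 0 < eta^-1 by rewrite invr_gt0.
have av : 1 + ln v <= (1 + eta^-1) * v `^ eta.
  have veta : 1 <= v `^ eta by rewrite -[X in X <= _](powRr0 v); apply: ler_powR => //; exact: ltW.
  have : ln v <= eta^-1 * v `^ eta.
    by rewrite -ler_pdivrMl ?invr_gt0// invrK -ln_powR ltW// ln_sublinear// powR_gt0.
  by nra.
have pv : 0 < v `^ eta by exact: powR_gt0.
have x0 : 0 < mu / 2 * ((nn r k)%:R / b).
  rewrite !mulr_gt0 ?invr_gt0// ltr0n; exact: leq_ltn_trans _ (nn_lt r1 k0).
have -> : v `^ (- (2 + 2 * eta)) = (v ^+ 2 * (v `^ eta) ^+ 2)^-1.
  rewrite powRN; congr (_ ^-1); rewrite powRD; last by apply/implyP => _; rewrite gt_eqF.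
  rewrite powR_mulrn ?(ltW v0)//; congr (_ * _).
  by rewrite mulrC powRrM powR_mulrn// ltW.
set A := mu / 2 * ((nn r k)%:R / b) in gap x0.
rewrite (_ : mu / 2 / c2 / (1 + eta^-1) ^+ 2 * ((nn r k)%:R / b) *
   (v ^+ 2 * (v `^ eta) ^+ 2)^-1 =
   A / (v * (c2 * v) * ((1 + eta^-1) * v `^ eta) ^+ 2)); last first.
  by rewrite /A; field; rewrite !gt_eqF//; lra.
apply: ler_pM => //; first exact: ltW.
  by rewrite invr_ge0 !mulr_ge0 ?exprn_ge0 ?mulr_ge0 ?(ltW v0) ?(ltW c20) ?(ltW pv)//; lra.
rewrite lef_pV2 ?posrE ?mulr_gt0 ?exprn_gt0 ?mulr_gt0//; try lra.
apply: ler_pM; rewrite ?exprn_ge0 ?mulr_ge0 ?(ltW v0) ?(ltW w0)//; first lra.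
  by rewrite ler_pM2l.
by rewrite lerXn2r// nnegrE ?mulr_ge0 ?(ltW pv)//; lra.
Qed.

Lemma log_selection_nu (b : R) : 1 <= b ->
  (\sum_(k <oo) (if (0 < k)%N then log_selection b k * (nn r k)%:R else 0)%:E <=
   (2 * level_cst mu r * b)%:E)%E.
Proof.
move=> b1; have b0 : 0 < b by lra.
have lc0 : 0 < level_cst mu r by exact: level_cst_gt0.
pose V k : R := level_cst mu r * b *
  ((1 + ln (rho mu r b k)) ^- 2 + (1 + ln (rho mu r b k))^-1).
have -> : 2 * level_cst mu r * b = V 0%N.
  by rewrite /V rho0// ln1 addr0 expr1n invr1; ring.
have pm := log_selection_pmf b0.
apply: nneseries_le_telescope.
- move=> k; rewrite lee_fin; case: ifP => // k0.
  by rewrite mulr_ge0// ltW//; exact: pm.1.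
- move=> k; have a1 := one_ln_ge1 (rho_ge1 r mu0 k b0).
  have a0 : 0 <= 1 + ln (rho mu r b k) by lra.
  apply: mulr_ge0; first exact: mulr_ge0 (ltW lc0) (ltW b0).
  by apply: addr_ge0; rewrite invr_ge0 ?exprn_ge0.
move=> k; rewrite lee_fin; case: ifPn => [k0|]; last first.
  by rewrite -leqNgt leqn0 => /eqP ->; rewrite /V /rho /level /= subrr.
have nle := nn_le_rho mu0 r1 b1 k0.
have rk1 := rho_ge1 r mu0 k b0.
have wt := log_tail_weight rk1 (ltW (rho_lt b0 k0)).
apply: (@le_trans _ _ (log_selection b k * (level_cst mu r * b * rho mu r b k))).
  by rewrite ler_wpM2l// ltW//; exact: pm.1.
have -> : log_selection b k * (level_cst mu r * b * rho mu r b k) =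
  level_cst mu r * b * (rho mu r b k * log_selection b k) by ring.
rewrite /V -mulrBr; apply: ler_wpM2l => //.
exact: mulr_ge0 (ltW lc0) (ltW b0).
Qed.

End log_selection.

(** * The power selection *)

Section dyadic_integral.
Context (R : realType).
Local Notation leb := (@lebesgue_measure R).

Lemma leb_itv_co (x y : R) : x <= y -> leb `[x, y[%classic = (y - x)%:E.
Proof.
move=> xy; rewrite lebesgue_measure_itv /= lte_fin.
case: ifPn => [_|]; first by rewrite EFinB.
by rewrite -leNgt => yx; rewrite (le_anti (introT andP (conj xy yx))) subrr.
Qed.

(** Integral of a nonincreasing function whose values along a geometric
    progression decay geometrically. *)
Lemma integral_dyadic_le (g : R -> R) (x q A : R) : 0 < x ->
  (forall u, 0 < u -> 0 <= g u) -> (forall u v, 0 < u -> u <= v -> g v <= g u) ->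
  measurable_fun [set: R] g -> 0 < q -> q < 1 -> 0 <= A ->
  (forall j : nat, 2 ^+ j * g (2 ^+ j * x) <= A * q ^+ j) ->
  (\int[leb]_(u in `[x, +oo[) (g u)%:E <= (A * x / (1 - q))%:E)%E.
Proof.
move=> x0 g0 gdec mg q0 q1 A0 gA.
pose I (j : nat) : set R := `[2 ^+ j * x, 2 ^+ j.+1 * x[%classic.
have p2 (j : nat) : 0 < 2 ^+ j * x by rewrite mulr_gt0 ?exprn_gt0.
have gj0 (j : nat) : 0 <= g (2 ^+ j * x) by exact: g0.
have mI j : measurable (I j) by exact: measurable_itv.
have gI0 (j : nat) u : (0 <= (g (2 ^+ j * x))%:E * (\1_(I j) u)%:E)%E.
  by apply: mule_ge0; rewrite lee_fin ?gj0// indicE.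
apply: (@le_trans _ _ (\int[leb]_u
    (\sum_(j <oo) ((g (2 ^+ j * x))%:E * (\1_(I j) u)%:E)))%E).
  rewrite integral_mkcond; apply: ge0_le_integral => //.
  - move=> u _; rewrite erestrict_ge0// => v; rewrite /= in_itv/= andbT => xv.
    by rewrite lee_fin g0//; lra.
  - apply/(measurable_restrictT _ _).1 => //; apply/measurable_EFinP.
    exact: measurable_funTS.
  - apply: ge0_emeasurable_sum => [j u _ _|j _]; first exact: gI0.
    by apply: measurable_funeM; apply/measurable_EFinP; apply: measurable_indic; exact: measurable_itv.
  move=> u _; rewrite patchE; case: ifPn => [/set_mem|_]; last first.
    by apply: nneseries_ge0 => j _ _; exact: gI0.
  rewrite /= in_itv/= andbT => xu.
  have [n /andP[n1 n2]] : exists n : nat, 2 ^+ n <= u / x < 2 ^+ n.+1.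
    by apply: dyadic_bracket; rewrite ler_pdivlMr// mul1r.
  have n1' : 2 ^+ n * x <= u by rewrite -ler_pdivlMr.
  have n2' : u < 2 ^+ n.+1 * x by rewrite -ltr_pdivrMr.
  rewrite (nneseries_split 0 n.+1); last by move=> j _; exact: gI0.
  rewrite add0n big_nat_recr//= indicE mem_set ?mule1; last first.
    by rewrite /I /= in_itv/= n1' n2'.
  apply: (@le_trans _ _ (g (2 ^+ n * x))%:E); first by rewrite lee_fin gdec.
  rewrite -addeA addeCA; apply: leeDl; apply: adde_ge0.
    by apply: sume_ge0 => j _; exact: gI0.
  by apply: nneseries_ge0 => j _ _; exact: gI0.
rewrite integral_nneseries//; last first.
  by move=> j; apply: measurable_funeM; apply/measurable_EFinP; apply: measurable_indic; exact: measurable_itv.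
have q10 : 0 < 1 - q by lra.
rewrite -[A * x / (1 - q)]mulr1 -(expr0 q).
apply: (nneseries_le_telescope (v := fun j => A * x / (1 - q) * q ^+ j)).
- by move=> j; apply: integral_ge0 => u _; exact: gI0.
- move=> j; apply: mulr_ge0; last by rewrite exprn_ge0// ltW.
  by apply: divr_ge0; [rewrite mulr_ge0// ltW|exact: ltW].
move=> j; rewrite ge0_integralZl//; last 2 first.
- by apply/measurable_EFinP; apply: measurable_indic; exact: measurable_itv.
- by rewrite lee_fin.
rewrite integral_indic; last exact: measurable_itv.
have lI : leb (I j) = (2 ^+ j.+1 * x - 2 ^+ j * x)%:E.
  by apply: leb_itv_co; rewrite ler_pM2r// exprS ler_peMl ?exprn_ge0// ler1n.
rewrite setIT; apply: (@le_trans _ _ ((g (2 ^+ j * x))%:E *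
    (2 ^+ j.+1 * x - 2 ^+ j * x)%:E)%E); first by rewrite -lI.
rewrite -EFinM lee_fin.
have -> : A * x / (1 - q) * q ^+ j - A * x / (1 - q) * q ^+ j.+1 = x * (A * q ^+ j).
  by rewrite exprS; field; rewrite gt_eqF.
have -> : g (2 ^+ j * x) * (2 ^+ j.+1 * x - 2 ^+ j * x) = x * (2 ^+ j * g (2 ^+ j * x)).
  by rewrite exprS; ring.
by rewrite ler_pM2l.
exact: measurableT.
Qed.

End dyadic_integral.

Section power_selection.
Context (R : realType) (F : probability R R) (mu : R) (r : nat) (alpha beta m1 : R).
Hypotheses (mu0 : 0 < mu) (r1 : (1 < r)%N) (ab : alpha < beta) (m10 : 0 < m1).
Hypothesis Fbar_gt0 : forall x : R, 0 < x -> 0 < Fbar F x.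
Hypothesis Fbar_m1 : forall x : R, 0 < x -> x * Fbar F x <= m1.
Local Notation G := (Gbar F alpha beta).
Local Notation GI := (GbarI F alpha beta).
Local Notation leb := (@lebesgue_measure R).

Lemma Gbar_gt0 x : 0 < x -> 0 < G x.
Proof. by move=> x0; rewrite /Gbar divr_gt0 ?powR_gt0 ?Fbar_gt0. Qed.

Lemma Gbar_noninc x y : 0 < x -> x <= y -> G y <= G x.
Proof.
move=> x0 xy; have y0 : 0 < y by exact: lt_le_trans xy.
rewrite /Gbar; apply: ler_pM; rewrite ?Fbar_ge0 ?invr_ge0 ?powR_ge0//.
  exact: Fbar_noninc.
rewrite lef_pV2 ?posrE ?powR_gt0//.
by apply: ge0_ler_powR; rewrite ?nnegrE ?(ltW x0) ?(ltW y0)// subr_ge0 ltW.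
Qed.

Lemma measurable_Gbar : measurable_fun [set: R] G.
Proof.
apply: measurable_funM.
  by apply: nonincreasing_measurable => // x y xy; exact: Fbar_noninc.
rewrite (_ : (fun x => _) = (fun x : R => x `^ (- (beta - alpha)))).
  exact: measurable_powR.
by apply/funext => x; rewrite powRN.
Qed.

(** A crude bound from Fbar x = O(1 / x): it makes the integral finite and GbarI
    tend to 0 at infinity. *)
Lemma GbarI_int_le x : 0 < x ->
  (\int[leb]_(u in `[x, +oo[) (G u)%:E <=
   (m1 / (1 - 2 `^ (alpha - beta)) * x `^ (- (beta - alpha)))%:E)%E.
Proof.
move=> x0; set q : R := 2 `^ (alpha - beta).
have ab' := ab.
have q0 : 0 < q by exact: powR_gt0.
have q1 : q < 1.
  have l2 : 0 < ln 2 :> R by apply: ln_gt0; rewrite ltr1n.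
  by rewrite /q powR_expR// expR_lt1; nra.
have px : 0 < x `^ (- (beta - alpha)) by exact: powR_gt0.
apply: le_trans (@integral_dyadic_le _ G x q (m1 * x `^ (- (beta - alpha)) / x)
  x0 _ _ measurable_Gbar q0 q1 _ _) _.
- by move=> u u0; apply/ltW/Gbar_gt0.
- by move=> u v u0 uv; exact: Gbar_noninc.
- by rewrite divr_ge0 ?mulr_ge0 ?(ltW m10) ?(ltW px) ?(ltW x0).
- move=> j; have y0 : 0 < 2 ^+ j * x by rewrite mulr_gt0 ?exprn_gt0.
  have := Fbar_m1 y0; rewrite /Gbar -powRN powRM ?exprn_ge0 ?(ltW x0)//.
  have -> : (2 ^+ j) `^ (- (beta - alpha)) = q ^+ j.
    by rewrite -powR_mulrn// -powRrM mulrC powRrM powR_mulrn ?powR_ge0// opprB.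
  set f := Fbar _ _ => h.
  have pq : 0 < q ^+ j by rewrite exprn_gt0.
  rewrite (_ : 2 ^+ j * (f * (q ^+ j * x `^ (- (beta - alpha)))) =
    (2 ^+ j * x * f) * (q ^+ j * x `^ (- (beta - alpha)) / x)); last first.
    by field; rewrite gt_eqF.
  rewrite (_ : m1 * _ / x * _ = m1 * (q ^+ j * x `^ (- (beta - alpha)) / x)); last by ring.
  by rewrite ler_wpM2r// divr_ge0 ?mulr_ge0 ?(ltW pq) ?(ltW px) ?(ltW x0).
rewrite lee_fin le_eqVlt; apply/orP; left; apply/eqP.
by field; rewrite !gt_eqF// subr_gt0.
Qed.

Lemma GbarI_fin x : 0 < x -> (\int[leb]_(u in `[x, +oo[) (G u)%:E)%E = (GI x)%:E.
Proof.
move=> x0; rewrite /GbarI /Rintegral fineK// ge0_fin_numE.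
  exact: le_lt_trans (GbarI_int_le x0) (ltry _).
apply: integral_ge0 => u; rewrite /= in_itv/= andbT => xu.
by rewrite lee_fin; apply/ltW/Gbar_gt0; exact: lt_le_trans xu.
Qed.

Lemma GbarI_le x : 0 < x ->
  GI x <= m1 / (1 - 2 `^ (alpha - beta)) * x `^ (- (beta - alpha)).
Proof. by move=> x0; rewrite -lee_fin -GbarI_fin//; exact: GbarI_int_le. Qed.

Lemma GbarI_ge0 x : 0 < x -> 0 <= GI x.
Proof.
move=> x0; rewrite -lee_fin -GbarI_fin//; apply: integral_ge0 => u.
rewrite /= in_itv/= andbT => xu.
by rewrite lee_fin; apply/ltW/Gbar_gt0; exact: lt_le_trans xu.
Qed.

(** The integrated tail between two points lies between the values at the end
    points times the length. *)
Lemma GbarI_diff x y : 0 < x -> x <= y ->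
  (y - x) * G y <= GI x - GI y /\ GI x - GI y <= (y - x) * G x.
Proof.
move=> x0 xy; have y0 : 0 < y by exact: lt_le_trans xy.
have mG D : measurable_fun D (fun u : R => (G u)%:E).
  by apply/measurable_EFinP; apply: measurable_funTS; exact: measurable_Gbar.
have GIsplit : (\int[leb]_(u in `[x, +oo[) (G u)%:E =
   \int[leb]_(u in `[x, y[) (G u)%:E + \int[leb]_(u in `[y, +oo[) (G u)%:E)%E.
  have itvE : `[x, +oo[%classic = `[x, y[%classic `|` `[y, +oo[%classic :> set R.
    apply/seteqP; split=> u /=; rewrite !in_itv/= !andbT.
      by move=> xu; have [uy|yu] := ltP u y; [left|right]; rewrite // xu.
    by move=> [/andP[]//|yu]; exact: le_trans yu.
  have G0 (u : R) : (`[x, y[%classic `|` `[y, +oo[%classic) u -> (0 <= (G u)%:E)%E.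
    rewrite -itvE /= in_itv/= andbT => xu; rewrite lee_fin.
    by apply/ltW/Gbar_gt0; exact: lt_le_trans xu.
  have dis : [disjoint `[x, y[%classic & `[y, +oo[%classic : set R].
    apply/disj_setPS => u [] /=; rewrite !in_itv/= andbT => /andP[_ uy].
    by rewrite leNgt uy.
  rewrite itvE; apply: ge0_integral_setU => //; exact: mG.
have E : (\int[leb]_(u in `[x, y[) (G u)%:E = (GI x - GI y)%:E)%E.
  rewrite EFinB -(GbarI_fin x0) GIsplit -(GbarI_fin y0) addeK//.
  by rewrite (GbarI_fin y0).
have lb := leb_itv_co xy.
split; rewrite -lee_fin -E.
  rewrite mulrC EFinM -lb -integral_cst//.
  apply: ge0_le_integral => //.
  - by move=> u _; rewrite lee_fin; apply/ltW/Gbar_gt0.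
  - exact: mG.
  - move=> u; rewrite /= in_itv/= => /andP[xu uy]; rewrite lee_fin.
    by apply: Gbar_noninc; [exact: lt_le_trans xu|exact: ltW].
rewrite mulrC EFinM -lb -integral_cst//.
apply: ge0_le_integral => //.
- move=> u; rewrite /= in_itv/= => /andP[xu uy]; rewrite lee_fin.
  by apply/ltW/Gbar_gt0; exact: lt_le_trans xu.
- exact: mG.
- move=> u; rewrite /= in_itv/= => /andP[xu uy]; rewrite lee_fin.
  exact: Gbar_noninc.
Qed.

End power_selection.

Section power_selection_bounds.
Context (R : realType) (F : probability R R) (mu : R) (r : nat) (alpha beta m1 : R).
Hypotheses (mu0 : 0 < mu) (r1 : (1 < r)%N) (alpha1 : 1 < alpha) (ab : alpha < beta)
  (beta2 : 2 < beta) (m10 : 0 < m1).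
Hypothesis Fbar_gt0 : forall x : R, 0 < x -> 0 < Fbar F x.
Hypothesis Fbar_m1 : forall x : R, 0 < x -> x * Fbar F x <= m1.
Hypothesis Fbar_potter : potter_bounds (Fbar F) alpha.
Local Notation G := (Gbar F alpha beta).
Local Notation GI := (GbarI F alpha beta).
Local Notation sel := (selection F mu r alpha beta).

Lemma GbarI_gt0 x : 0 < x -> 0 < GI x.
Proof.
move=> x0; have x2 : x <= 2 * x by lra.
have x20 : 0 < 2 * x by lra.
have [h _] := GbarI_diff ab m10 Fbar_gt0 Fbar_m1 x0 x2.
have h2 := GbarI_ge0 ab m10 Fbar_gt0 Fbar_m1 x20.
have : 0 < (2 * x - x) * G (2 * x) by rewrite mulr_gt0 ?Gbar_gt0//; lra.
by lra.
Qed.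

Lemma level_gt0 b k : 0 < b -> 0 < level mu r b k.
Proof. by move=> b0; apply: lt_le_trans b0 (level_ge b r k mu0). Qed.

Lemma level_lt b k : (0 < k)%N -> level mu r b k < level mu r b k.+1.
Proof.
move=> k0; rewrite -subr_gt0 levelS// mulr_gt0// subr_gt0 ltr_nat.
exact: nn_lt.
Qed.

Lemma power_selection_pmf b : 0 < b -> is_pmf (sel b).
Proof.
move=> b0; have gib := GbarI_gt0 b0; split=> [k k0|].
  have l0 := level_gt0 k b0; have l10 := level_gt0 k.+1 b0.
  have [h _] := GbarI_diff ab m10 Fbar_gt0 Fbar_m1 l0 (ltW (level_lt b k0)).
  rewrite /selection divr_gt0//; apply: lt_le_trans h.
  by rewrite mulr_gt0 ?Gbar_gt0// subr_gt0 level_lt.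
transitivity (\sum_(1 <= k <oo) (GI (level mu r b k) / GI b -
    GI (level mu r b k.+1) / GI b)%:E)%E.
  by apply: eq_eseriesr => k _; rewrite /selection mulrBl.
rewrite (@eseries_telescope _ (fun k => GI (level mu r b k) / GI b)).
  by rewrite /level/= mul0r addr0 divff ?gt_eqF.
have q1 : 0 < 1 - 2 `^ (alpha - beta) :> R.
  have l2 : 0 < ln 2 :> R by apply: ln_gt0; rewrite ltr1n.
  by have ab' := ab; rewrite subr_gt0 powR_expR// expR_lt1; nra.
apply: (@cvg_level0 _ mu r mu0 r1 _ b (m1 / (1 - 2 `^ (alpha - beta)) / GI b)
  (beta - alpha)) => //.
- by rewrite !divr_gt0.
- by rewrite subr_gt0.
- move=> k; rewrite divr_ge0 ?(ltW gib)//.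
  by apply/ltW/GbarI_gt0; exact: level_gt0.
- move=> k; rewrite mulrAC ler_pM2r ?invr_gt0//.
  by apply: GbarI_le => //; exact: level_gt0.
Qed.

Lemma Gbar_ratio_le (a C x y : R) : 0 < x -> x <= y ->
  Fbar F y <= C * (x / y) `^ a * Fbar F x ->
  G y <= C * (y / x) `^ (- (a + beta - alpha)) * G x.
Proof.
move=> x0 xy h; have y0 : 0 < y by lra.
rewrite /Gbar (_ : (y / x) `^ (- (a + beta - alpha)) =
   (x / y) `^ a * (x `^ (beta - alpha) / y `^ (beta - alpha))); last first.
  rewrite !powR_expR ?divr_gt0// -expRN -!expRD; congr expR.
  by rewrite !ln_div ?posrE//; ring.
have px : 0 < x `^ (beta - alpha) by exact: powR_gt0.
have py : 0 < y `^ (beta - alpha) by exact: powR_gt0.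
rewrite (_ : C * _ * _ = C * (x / y) `^ a * Fbar F x / y `^ (beta - alpha)).
  by rewrite ler_pM2r ?invr_gt0.
by field; rewrite !gt_eqF.
Qed.

Lemma Gbar_ratio_ge (s C x y : R) : 0 < x -> x <= y -> 0 < C ->
  Fbar F x <= C * (y / x) `^ s * Fbar F y ->
  C^-1 * (y / x) `^ (- (s + beta - alpha)) * G x <= G y.
Proof.
move=> x0 xy C0 h; have y0 : 0 < y by lra.
have ps : 0 < (y / x) `^ s by rewrite powR_gt0 ?divr_gt0.
rewrite /Gbar (_ : (y / x) `^ (- (s + beta - alpha)) =
   ((y / x) `^ s)^-1 * (x `^ (beta - alpha) / y `^ (beta - alpha))); last first.
  rewrite !powR_expR ?divr_gt0// -!expRN -!expRD; congr expR.
  by rewrite !ln_div ?posrE//; ring.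
have px : 0 < x `^ (beta - alpha) by exact: powR_gt0.
have py : 0 < y `^ (beta - alpha) by exact: powR_gt0.
rewrite (_ : C^-1 * _ * _ = (C * (y / x) `^ s)^-1 * Fbar F x / y `^ (beta - alpha)).
  by rewrite ler_pM2r ?invr_gt0// ler_pdivrMl ?mulr_gt0.
by field; rewrite !gt_eqF.
Qed.

(** Exponent just below alpha for which n_k p_k stays summable. *)
Let a := alpha - (beta - 2) / beta.

(** The exponent e for which n_k p_k is of the order of
    n_k rho_k ^ - (1 + e) at most; it is positive since beta > 2. *)
Let ea : R := (beta - 2) - (beta - 2) / beta.

Lemma low_exponent : [/\ 0 <= a, a < alpha & 0 < ea].
Proof.
have [al1 be2] := (alpha1, beta2).
have h : (beta - 2) / beta < 1 by rewrite ltr_pdivrMr; lra.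
have h0 : 0 < (beta - 2) / beta by rewrite divr_gt0; lra.
split; rewrite /a /ea; try lra.
by rewrite subr_gt0 ltr_pdivrMr; nra.
Qed.

(** Karamata's bound, up to a constant: GbarI b = O(b Gbar b). *)
Lemma GbarI_upper : exists C x0 : R, [/\ 0 < C, 1 <= x0 &
  forall b, x0 <= b -> GI b <= C * (b * G b)].
Proof.
have [a0 aa e0] := low_exponent.
have al : alpha < alpha + 1 by lra.
have [x0 [C [x01 C1 potter]]] := Fbar_potter a0 aa al.
set q : R := 2 `^ (- (1 + ea)).
have q0 : 0 < q by exact: powR_gt0.
have q1 : q < 1.
  have l2 : 0 < ln 2 :> R by apply: ln_gt0; rewrite ltr1n.
  by rewrite /q powR_expR// expR_lt1; nra.
exists (C / (1 - q)), x0; split=> //; first by rewrite divr_gt0; lra.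
move=> b bx; have b0 : 0 < b by lra.
have Gb := Gbar_gt0 alpha beta Fbar_gt0 b0.
rewrite -lee_fin -(GbarI_fin ab m10 Fbar_gt0 Fbar_m1 b0).
apply: le_trans (@integral_dyadic_le _ G b q (C * G b) b0 _ _
  (measurable_Gbar F alpha beta) q0 q1 _ _) _.
- by move=> u u0; apply/ltW/Gbar_gt0.
- by move=> u v u0 uv; exact: Gbar_noninc.
- by rewrite mulr_ge0 ?(ltW Gb)//; lra.
- move=> j.
  have bj : b <= 2 ^+ j * b by rewrite ler_peMl ?(ltW b0)// exprn_ege1// ler1n.
  have [h _] := potter b (2 ^+ j * b) bx bj.
  have := Gbar_ratio_le b0 bj h; rewrite mulfK ?gt_eqF// => h2.
  have p2 : 0 < 2 ^+ j :> R by rewrite exprn_gt0.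
  apply: (@le_trans _ _ (2 ^+ j * (C * (2 ^+ j) `^ (- (a + beta - alpha)) * G b))).
    by rewrite ler_pM2l.
  rewrite le_eqVlt; apply/orP; left; apply/eqP.
  have -> : q ^+ j = 2 ^+ j * (2 ^+ j) `^ (- (a + beta - alpha)).
    have -> : 2 ^+ j * (2 ^+ j) `^ (- (a + beta - alpha)) =
        (2 ^+ j) `^ (1 + - (a + beta - alpha)) :> R.
      by rewrite powRD ?powRr1 ?(ltW p2)//; apply/implyP => _; rewrite gt_eqF.
    rewrite -powR_mulrn ?(ltW q0)// /q -powRrM -powR_mulrn// -powRrM.
    congr (_ `^ _).
    by rewrite /a /ea; ring.
  by ring.
rewrite lee_fin le_eqVlt; apply/orP; left; apply/eqP; field.
by rewrite gt_eqF// subr_gt0.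
Qed.

(** The increments of GbarI dominate the length of the interval times the value
    at the right end point, and GbarI b = O(b Gbar b). *)
Lemma power_selection_ge (s : R) : alpha < s -> exists2 c : R, 0 < c &
  \forall b \near +oo, forall k, (0 < k)%N ->
    c * ((nn r k)%:R / b) * rho mu r b k `^ (- (s + beta - alpha)) <= sel b k.
Proof.
move=> sa; have [a0 aa e0] := low_exponent.
have [ab' al1] := (ab, alpha1).
have [x0 [C [x01 C1 potter]]] := Fbar_potter a0 aa sa.
have [CI [x1 [CI0 x11 upper]]] := GbarI_upper.
set c2 := 1 + level_cst mu r * mu.
have c20 : 0 < c2 by rewrite addr_gt0// mulr_gt0// level_cst_gt0.
have C0 : 0 < C by lra.
set kap := s + beta - alpha.
have kap0 : 0 < kap by rewrite /kap; lra.
exists (mu / 2 / CI / C * c2 `^ (- kap)).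
  by rewrite mulr_gt0 ?powR_gt0// !divr_gt0.
near=> b; move=> k k0.
have bx0 : x0 <= b by near: b; apply: nbhs_pinfty_ge; rewrite num_real.
have bx1 : x1 <= b by near: b; apply: nbhs_pinfty_ge; rewrite num_real.
have b1 : 1 <= b by lra.
have b0 : 0 < b by lra.
have l0 := level_gt0 k b0; have l10 := level_gt0 k.+1 b0.
have [dif _] := GbarI_diff ab m10 Fbar_gt0 Fbar_m1 l0 (ltW (level_lt b k0)).
have Gb := Gbar_gt0 alpha beta Fbar_gt0 b0.
have GIb := GbarI_gt0 b0.
have bG0 : 0 < CI * (b * G b) by exact: mulr_gt0 CI0 (mulr_gt0 b0 Gb).
have lev := level_ge b r k.+1 mu0.
have [_ h] := potter _ _ bx0 lev.
have rat := Gbar_ratio_ge b0 lev C0 h; rewrite -/kap -/(rho mu r b k.+1) in rat.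
have rS := rhoS_le mu0 r1 b1 k0; have gap := nn_gap R r1 k0.
have rk1 := rho_ge1 r mu0 k b0; have rk2 := rho_ge1 r mu0 k.+1 b0.
have rpow : c2 `^ (- kap) * rho mu r b k `^ (- kap) <= rho mu r b k.+1 `^ (- kap).
  rewrite -powRM ?(ltW c20) ?(le_trans ler01 rk1)//.
  rewrite [leLHS]powRN [leRHS]powRN lef_pV2 ?posrE ?powR_gt0 ?(lt_le_trans ltr01 rk2)//.
    apply: ge0_ler_powR => //; rewrite ?nnegrE; first exact: ltW.
      exact: le_trans ler01 rk2.
    exact: mulr_ge0 (ltW c20) (le_trans ler01 rk1).
  exact: mulr_gt0 c20 (lt_le_trans ltr01 rk1).
apply: (@le_trans _ _ ((level mu r b k.+1 - level mu r b k) * G (level mu r b k.+1)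
    / (CI * (b * G b)))); last first.
  rewrite /selection; apply: ler_pM => //.
  - apply: mulr_ge0; first by rewrite subr_ge0 ltW// level_lt.
    by apply/ltW/Gbar_gt0.
  - by rewrite invr_ge0 ltW.
  - by rewrite lef_pV2 ?posrE// upper.
set gk := G (level mu r b k.+1) in rat *.
rewrite levelS//; set n : R := (nn r k)%:R in gap *; set n' : R := (nn r k.-1)%:R in gap *.
set rp := rho mu r b k.+1 `^ (- kap) in rat rpow.
have n0 : 0 <= n by [].
have rp0 : 0 <= rp by exact: powR_ge0.
have gk' : C^-1 * (c2 `^ (- kap) * rho mu r b k `^ (- kap)) * G b <= gk.
  apply: le_trans rat; rewrite ler_pM2r// ler_pM2l ?invr_gt0//.
rewrite ler_pdivlMr//.
have -> : mu / 2 / CI / C * c2 `^ (- kap) * (n / b) * rho mu r b k `^ (- kap) * (CI * (b * G b))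
  = (n / 2 * mu) * (C^-1 * (c2 `^ (- kap) * rho mu r b k `^ (- kap)) * G b).
  by field; rewrite !gt_eqF.
apply: ler_pM => //.
- by rewrite mulr_ge0 ?divr_ge0 ?(ltW mu0).
- apply: mulr_ge0; last exact: ltW.
  by apply: mulr_ge0; [rewrite invr_ge0 ltW|rewrite mulr_ge0 ?powR_ge0].
- by rewrite ler_pM2r//; lra.
Unshelve. all: by end_near.
Qed.

(** The increments of GbarI are at most the length of the interval times the
    value at the left end point, and b Gbar b = O(GbarI b). *)
Lemma power_selection_nu : exists C : R, \forall b \near +oo,
  (\sum_(k <oo) (if (0 < k)%N then sel b k * (nn r k)%:R else 0)%:E <= (C * b)%:E)%E.
Proof.
have [a0 aa e0] := low_exponent.
have [ab' al1] := (ab, alpha1).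
have al : alpha < alpha + 1 by lra.
have [x0 [C [x01 C1 potter]]] := Fbar_potter a0 aa al.
have C0 : 0 < C by lra.
have [C5 C50 sumC5] := sum_rho_le mu0 r1 e0.
set kap := alpha + 1 + beta - alpha.
have lc0 := level_cst_gt0 mu0 r1.
set K := mu * C * C * 2 `^ kap * level_cst mu r.
have K0 : 0 < K by apply: mulr_gt0 => //; rewrite !mulr_gt0 ?powR_gt0.
exists (K * C5); near=> b.
have bx0 : x0 <= b by near: b; apply: nbhs_pinfty_ge; rewrite num_real.
have b1 : 1 <= b by lra.
have b0 : 0 < b by lra.
have Gb := Gbar_gt0 alpha beta Fbar_gt0 b0.
have GIb := GbarI_gt0 b0.
have pm := power_selection_pmf b0.
have GIlow : b * (C^-1 * 2 `^ (- kap) * G b) <= GI b.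
  have b2 : b <= 2 * b by lra.
  have b20 : 0 < 2 * b by lra.
  have [h _] := GbarI_diff ab m10 Fbar_gt0 Fbar_m1 b0 b2.
  have h2 := GbarI_ge0 ab m10 Fbar_gt0 Fbar_m1 b20.
  have [_ h3] := potter _ _ bx0 b2.
  have := Gbar_ratio_ge b0 b2 C0 h3; rewrite mulfK ?gt_eqF// -/kap => h4.
  have : b * (C^-1 * 2 `^ (- kap) * G b) <= b * G (2 * b) by rewrite ler_pM2l.
  by move: h; rewrite (_ : 2 * b - b = b); [lra|ring].
apply: (@le_trans _ _ (\sum_(k <oo) ((K * b)%:E * (if (0 < k)%N then
     (nn r k)%:R / b * rho mu r b k `^ (- (1 + ea)) else 0)%:E))%E); last first.
  rewrite nneseriesZl//; last first.
    move=> k _; rewrite lee_fin; case: ifP => // _.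
    by rewrite mulr_ge0 ?powR_ge0// divr_ge0// ltW.
  apply: (@le_trans _ _ ((K * b)%:E * C5%:E)%E); last by rewrite -EFinM lee_fin mulrAC.
  apply: lee_wpmul2l; last exact: sumC5.
  by rewrite lee_fin; exact: mulr_ge0 (ltW K0) (ltW b0).
apply: lee_nneseries => [k _ _|k _].
  by case: ifP => // k0; rewrite lee_fin mulr_ge0// ltW//; exact: pm.1.
rewrite -EFinM lee_fin; case: ifPn => [k0|_]; last by rewrite mulr0.
have l0 := level_gt0 k b0.
have [_ dif] := GbarI_diff ab m10 Fbar_gt0 Fbar_m1 l0 (ltW (level_lt b k0)).
have lev := level_ge b r k mu0.
have [h _] := potter _ _ bx0 lev.
have rat := Gbar_ratio_le b0 lev h; rewrite -/(rho mu r b k) in rat.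
have nle := nn_le_rho mu0 r1 b1 k0.
have rk1 := rho_ge1 r mu0 k b0.
have rk0 : 0 < rho mu r b k by lra.
set n : R := (nn r k)%:R in nle *.
have n0 : 0 <= n by [].
have pk2 : 0 < 2 `^ kap :> R by exact: powR_gt0.
set re := rho mu r b k `^ (- (a + beta - alpha)) in rat.
have re0 : 0 < re by exact: powR_gt0.
have den0 : 0 < b * (C^-1 * 2 `^ (- kap) * G b).
  apply: mulr_gt0 => //; apply: mulr_gt0 => //.
  by apply: mulr_gt0; [rewrite invr_gt0|exact: powR_gt0].
have selle : sel b k <= (n * mu * (C * re * G b)) / (b * (C^-1 * 2 `^ (- kap) * G b)).
  rewrite /selection; apply: ler_pM.
  - have l10 := level_gt0 k.+1 b0.
    have [h5 _] := GbarI_diff ab m10 Fbar_gt0 Fbar_m1 l0 (ltW (level_lt b k0)).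
    apply: le_trans h5; apply: mulr_ge0; first by rewrite subr_ge0 ltW// level_lt.
    by apply/ltW/Gbar_gt0.
  - by rewrite invr_ge0 ltW.
  - apply: (le_trans dif); apply: ler_pM => //.
    + by rewrite subr_ge0 ltW// level_lt.
    + by apply/ltW/Gbar_gt0.
    + by rewrite levelS// ler_pM2r// lerBlDr lerDl.
  - by rewrite lef_pV2 ?posrE.
apply: (@le_trans _ _ ((n * mu * (C * re * G b)) / (b * (C^-1 * 2 `^ (- kap) * G b)) *
    (level_cst mu r * b * rho mu r b k))).
  by apply: ler_pM => //; apply/ltW; exact: pm.1.
rewrite le_eqVlt; apply/orP; left; apply/eqP.
have -> : rho mu r b k `^ (- (1 + ea)) = re * rho mu r b k.
  rewrite /re -[X in _ = _ * X]powRr1 ?(ltW rk0)// -powRD; last by apply/implyP => _; rewrite gt_eqF.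
  by congr (_ `^ _); rewrite /a /ea; ring.
rewrite /K powRN; field.
by rewrite !gt_eqF.
Unshelve. all: by end_near.
Qed.

End power_selection_bounds.

(** * Regularly varying tails and moments *)

Section regularly_varying_tail.
Context (R : realType) (F : probability R R) (alpha : R) (L : R -> R).
Hypothesis FbarL : forall x : R, 0 < x -> Fbar F x = x `^ (- alpha) * L x.
Hypothesis svL : slowly_varying L.

(** A vanishing tail would make L, hence L x / L x, vanish eventually. *)
Lemma regvar_Fbar_gt0 (x : R) : 0 < x -> 0 < Fbar F x.
Proof.
move=> x0; rewrite lt_neqAle Fbar_ge0 andbT eq_sym; apply/eqP => Fx0.
have L0 y : x <= y -> L y = 0.
  move=> xy; have y0 : 0 < y by exact: lt_le_trans xy.
  have Fy : Fbar F y = 0.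
    by apply/eqP; rewrite eq_le Fbar_ge0 andbT -Fx0 Fbar_noninc.
  have := FbarL y0; rewrite Fy => /esym/eqP.
  by rewrite mulf_eq0 (gt_eqF (powR_gt0 _ y0))/= => /eqP.
have h1 := svL (@ltr01 R).
have h0 : L (1 * y) / L y @[y --> +oo] --> (0 : R).
  apply: cvg_near_cst; exists x; split; first by rewrite num_real.
  by move=> y xy; rewrite mul1r L0 ?mul0r// ltW.
have e01 : (0 : R) = 1 by apply: (cvg_unique _ h0 h1); exact: norm_hausdorff.
by have := @oner_neq0 R; rewrite -e01 eqxx.
Qed.

Lemma regvar_ratio : Fbar F (2 * x) / Fbar F x @[x --> +oo] --> 2 `^ (- alpha).
Proof.
have h2 : L (2 * x) / L x @[x --> +oo] --> (1 : R) by apply: svL.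
have h : 2 `^ (- alpha) * (L (2 * x) / L x) @[x --> +oo] --> 2 `^ (- alpha) * 1.
  by apply: cvgM h2; exact: cvg_cst.
rewrite mulr1 in h; apply: cvg_trans h; apply: near_eq_cvg.
exists 1; split; first by rewrite num_real.
move=> x x1 /=; have x0 : 0 < x by lra.
have x20 : 0 < 2 * x by lra.
rewrite !FbarL// powRM ?(ltW x0)//.
have px : 0 < x `^ (- alpha) by exact: powR_gt0.
have Lx : L x != 0.
  have := regvar_Fbar_gt0 x0; rewrite FbarL// => h3.
  by apply/eqP => L0; move: h3; rewrite L0 mulr0 ltxx.
by field; rewrite Lx gt_eqF.
Qed.

Lemma regvar_potter : potter_bounds (Fbar F) alpha.
Proof.
apply: potter.
- exact: regvar_Fbar_gt0.
- by move=> x y _; exact: Fbar_noninc.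
- exact: regvar_ratio.
Qed.

(** Where L is differentiable the tail is continuous, so F has no atom. *)
Lemma no_atom (c : R) : 0 < c -> derivable L c 1 ->
  F `[c, +oo[%classic = (Fbar F c)%:E.
Proof.
move=> c0 dL.
have cL : {for c, continuous L}.
  by apply: differentiable_continuous; apply/derivable1_diffP.
have cp : {for c, continuous (fun x : R => x `^ (- alpha))}.
  apply: differentiable_continuous; apply/derivable1_diffP.
  by apply: derivable_powR; rewrite in_itv/= c0.
have cF : Fbar F x @[x --> c] --> Fbar F c.
  rewrite FbarL//; have h : x `^ (- alpha) * L x @[x --> c] --> c `^ (- alpha) * L c.
    exact: cvgM.
  apply: cvg_trans h; apply: near_eq_cvg; near=> x.
  by rewrite FbarL//; near: x; exact: lt_nbhsr.
have cFl : Fbar F x @[x --> c^'-] --> Fbar F c by exact: cvg_at_left_filter.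
have fc : F `[c, +oo[%classic \is a fin_num by exact: fin_num_measure.
have up : fine (F `[c, +oo[%classic) <= Fbar F c.
  apply: (cvgr_to_ge cFl); near=> x.
  have xc : x < c by near: x; exact: nbhs_left_lt.
  rewrite /Fbar fine_le ?fin_num_measure//; apply: le_measure; rewrite ?inE//.
  by move=> y /=; rewrite !in_itv/= !andbT; exact: lt_le_trans.
apply/eqP; rewrite eq_le -{1}(fineK fc) lee_fin up/= -FbarE.
apply: le_measure; rewrite ?inE//.
by move=> y /=; rewrite !in_itv/= !andbT; exact: ltW.
Unshelve. all: by end_near.
Qed.

End regularly_varying_tail.

Section moments_of_increments.
Context d (T : measurableType d) (R : realType) (P : probability T R).
Variable X : {RV P >-> R}.
Let F : probability R R := distribution P X.

Lemma moment_of_variance (a : R) : 1 <= a -> a <= 2 -> ('E_P[X] = 0)%E ->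
  ('V_P[X] < +oo)%E -> (\int[F]_x (`|x| `^ a)%:E < +oo)%E.
Proof.
move=> a1 a2 EX VX.
have V2 : ('V_P[X] = \int[F]_x (x ^+ 2)%:E)%E.
  rewrite /variance unlock EX /= unlock.
  rewrite (@ge0_integral_distribution _ _ _ _ _ P X (fun x => (x ^+ 2)%:E))//.
  - apply: eq_integral => w _; congr (_%:E).
    by transitivity ((X w - 0) * (X w - 0)); rewrite // subr0 expr2.
  - by apply/measurable_EFinP; exact: measurable_funX.
  - by move=> x; rewrite lee_fin sqr_ge0.
apply: (@le_lt_trans _ _ (\int[F]_x (1%:E + (x ^+ 2)%:E))%E).
  apply: ge0_le_integral => //.
  - by apply/measurable_EFinP; exact: measurable_abs_powR.
  - by apply: emeasurable_funD => //; apply/measurable_EFinP; exact: measurable_funX.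
  move=> x _; rewrite -EFinD lee_fin.
  have [x1|x1] := leP `|x| 1.
    apply: (@le_trans _ _ (1 `^ a)); last by rewrite powR1 lerDl sqr_ge0.
    apply: ge0_ler_powR; rewrite ?nnegrE//; lra.
  apply: (@le_trans _ _ (`|x| `^ 2)); first by apply: ler_powR => //; exact: ltW.
  by rewrite powR_mulrn// real_normK ?num_real// lerDr.
rewrite ge0_integralD//; last 2 first.
- by move=> x _; rewrite lee_fin sqr_ge0.
- by apply/measurable_EFinP; exact: measurable_funX.
rewrite -V2 integral_cst// lte_add_pinfty// mul1e.
by apply: (@le_lt_trans _ _ 1%E); [exact: probability_le1|exact: ltry].
Qed.

(** Absolute moments of order less than alpha, when the left tail is not
    heavier than the right one. *)
Lemma moment_of_left_tail (a a' C x0 M : R) : 0 < a -> a < a' -> 1 <= x0 -> 1 <= C ->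
  (forall x : R, x0 <= x -> Fbar F x <= C * (x0 / x) `^ a' * Fbar F x0) ->
  (forall x : R, x0 <= x -> 0 < Fbar F x) ->
  (forall x : R, x0 <= x -> fine (F `]-oo, - x[%classic) / Fbar F x <= M) ->
  (\int[F]_x (`|x| `^ a)%:E < +oo)%E.
Proof.
move=> a0 aa x01 C1 up pos left.
have x0_gt0 : 0 < x0 by lra.
set C2 := (1 + `|M|) * (C * (2 * x0) `^ a' * Fbar F x0).
have C20 : 0 <= C2.
  rewrite /C2 mulr_ge0 ?addr_ge0// mulr_ge0 ?Fbar_ge0// mulr_ge0 ?powR_ge0//; lra.
apply: (@moment_of_tail _ F a a' C2 (2 * x0)) => //; first by lra.
move=> x xx; have x2 : x0 <= x / 2 by lra.
have x_gt0 : 0 < x by lra.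
have := up _ x2; have := left _ x2; have := pos _ x2.
set f := Fbar F (x / 2) => f0 lf uf.
have mR : measurable (`]x / 2, +oo[%classic : set R) by [].
have mL : measurable (`]-oo, - (x / 2)[%classic : set R) by [].
apply: (@le_trans _ _
    (F `](x / 2)%R, +oo[%classic + F `]-oo, (- (x / 2))%R[%classic)%E).
  apply: le_trans (measureU2 F mR mL); apply: le_measure; rewrite ?inE.
  - exact: measurable_abs_ge.
  - exact: measurableU.
  move=> y /=; rewrite !in_itv/= andbT => xy.
  have [y0|y0] := leP 0 y; [left|right].
    by move: xy; rewrite ger0_norm//; lra.
  by move: xy; rewrite ltr0_norm//; lra.
rewrite FbarE -/f -(@fineK _ (F `]-oo, _[%classic)) ?fin_num_measure// -EFinD lee_fin.
set l := fine _ in lf *.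
have l1 : l <= `|M| * f.
  rewrite -ler_pdivrMr//; apply: (le_trans lf); exact: ler_norm.
apply: (@le_trans _ _ ((1 + `|M|) * f)); first by lra.
rewrite /C2 -[leRHS]mulrA ler_wpM2l ?addr_ge0//; apply: (le_trans uf).
rewrite le_eqVlt; apply/orP; left; apply/eqP.
rewrite (_ : x0 / (x / 2) = 2 * x0 * x^-1); last by field; rewrite gt_eqF.
rewrite powRM ?invr_ge0 ?(ltW x_gt0) ?mulr_ge0 ?(ltW x0_gt0)//.
rewrite -[x^-1]powR_inv1 ?(ltW x_gt0)// -powRrM mulN1r; ring.
Qed.

End moments_of_increments.

(** * Efficiency of the selections *)

Section strong_efficiency.
Context (R : realType) (d : measure_display) (T : measurableType d).
Context (P : probability T R) (X : nat -> {RV P >-> R}).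
Context (mu : R) (r : nat) (alpha : R) (L : R -> R).
Let F : probability R R := distribution P (X 0%N).
Hypothesis indep : mutually_independent X.
Hypothesis idist : identically_distributed X.
Hypothesis X1 : P.-integrable [set: T] (EFin \o X 0%N).
Hypothesis EX : ('E_P[X 0%N] = 0)%E.
Hypothesis mu0 : 0 < mu.
Hypothesis r1 : (1 < r)%N.
Hypothesis alpha1 : 1 < alpha.
Hypothesis alpha32 : alpha <= 3 / 2.
Hypothesis FbarL : forall x, 0 < x -> Fbar F x = x `^ (- alpha) * L x.
Hypothesis svL : slowly_varying L.
Hypothesis left_tail : ('V_P[X 0%N] = +oo)%E ->
  (limf_esup (fun x : R => (fine (F `]-oo, (- x)%R[%classic) / Fbar F x)%:E)
    (pinfty_nbhs R) < +oo)%E.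
Hypothesis dL : exists2 t0 : R, 0 < t0 & forall x, t0 <= x -> derivable L x 1.

Let Fbar_gt0 := regvar_Fbar_gt0 FbarL svL.
Let Fbar_potter := regvar_potter FbarL svL.

(** The increments have a moment of order (1 + alpha) / 2, above 1: through the
    variance if it is finite, and by comparing the left tail with the right one
    otherwise. *)
Lemma absolute_moment :
  exists Ma : R, (\int[F]_x (`|x| `^ ((1 + alpha) / 2))%:E = Ma%:E)%E.
Proof.
have [al1 al2] : 1 < alpha /\ alpha <= 3 / 2 by split.
suff fin : (\int[F]_x (`|x| `^ ((1 + alpha) / 2))%:E < +oo)%E.
  exists (fine (\int[F]_x (`|x| `^ ((1 + alpha) / 2))%:E)%E).
  rewrite fineK// ge0_fin_numE//; apply: integral_ge0 => x _.
  by rewrite lee_fin powR_ge0.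
have [VX|VX] := eqVneq 'V_P[X 0%N]%E +oo%E; last first.
  by apply: moment_of_variance; rewrite ?ltey//; lra.
have [M [x1 [_ hM]]] := limf_esup_lty_bound (left_tail VX).
have [|||x0 [C [x01 C1 pot]]] := @Fbar_potter ((1 + 3 * alpha) / 4) (alpha + 1).
- lra.
- lra.
- lra.
set y0 := Num.max x0 (x1 + 1).
have xy : x0 <= y0 by rewrite le_max lexx.
have x1y : x1 < y0 by rewrite lt_max; apply/orP; right; lra.
apply: (@moment_of_left_tail _ _ _ _ _ _ ((1 + 3 * alpha) / 4) C y0 M) => //.
- lra.
- lra.
- exact: le_trans xy.
- by move=> x yx; have [] := pot y0 x xy yx.
- by move=> x yx; apply: Fbar_gt0; lra.
- by move=> x yx; rewrite -lee_fin; apply: hM; exact: lt_le_trans yx.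
Qed.

Lemma tilt_controlled : bounded_tilts F mu r.
Proof.
have [al1 al2] : 1 < alpha /\ alpha <= 3 / 2 by split.
have [Ma mom] := absolute_moment.
have [m1 _ abs1] := law_abs X1.
have [|||x0 [C [x01 C1 pot]]] := @Fbar_potter ((1 + alpha) / 2) 2; [lra|lra|lra|].
have a1 : 1 < (1 + alpha) / 2 by lra.
have a2 : (1 + alpha) / 2 <= 2 by lra.
have mean0 : (\int[F]_x x%:E = 0)%E by rewrite -EX; exact: law_mean.
have [C' [M [_ hM]]] := tilt_mass_bound a1 a2 (law_integrable X1) mean0 abs1
  mom Fbar_gt0 x01 C1 pot (level_cst_gt0 mu0 r1).
exists C'; near=> b; move=> k k0.
have Mb : M < b by near: b; apply: nbhs_pinfty_gt; rewrite num_real.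
have b1 : 1 <= b by near: b; apply: nbhs_pinfty_ge; rewrite num_real.
have bl := level_ge b r k mu0.
apply: hM (lt_le_trans Mb bl) _ _ _ => //; last exact: nn_le_level.
by case: k k0 {bl} => // k _; rewrite /nn expn_gt0 ltnW.
Unshelve. all: by end_near.
Qed.

Lemma unbiased (p : R -> nat -> R) : (forall b, 0 < b -> is_pmf (p b)) ->
  \forall b \near +oo, unbiased_estimator X mu r p b.
Proof.
move=> pmf; have [t0 t00 dLt] := dL; have [C' tiltC] := tilt_controlled.
near=> b.
have b0 : 0 < b by near: b; apply: nbhs_pinfty_gt; rewrite num_real.
have bt : t0 <= b by near: b; apply: nbhs_pinfty_ge; rewrite num_real.
have tb : forall k : nat, (0 < k)%N -> exists2 D : R, 0 < D &
    (\int[F]_(x in `]-oo, level mu r b k[)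
        (expR (theta F mu r b k * x))%:E = D%:E)%E.
  near: b; apply: filterS tiltC => b tb k k0.
  by have [_ [D [D0 _ DE]]] := tb k k0; exists D.
rewrite /unbiased_estimator -passage_probEFin (passage_probE indep idist mu r1 b0).
apply: (expectation_Z (pmf _ b0) mu0 r1 _ tb) => c bc.
have c0 : 0 < c by exact: lt_le_trans bc.
split; last exact: Fbar_gt0.
by apply: (no_atom FbarL c0); apply: dLt; exact: le_trans bc.
Unshelve. all: by end_near.
Qed.

(** The passage probability is at least of the order of b times the tail at b,
    which matches the order of the moment bound. *)
Lemma relative_moment_lty (p : R -> nat -> R) (kappa g c : R) : 0 < g ->
  0 <= kappa -> 1 < alpha * (1 + g) - g * kappa -> 0 < c ->
  (forall b, 0 < b -> is_pmf (p b)) ->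
  (\forall b \near +oo, forall k, (0 < k)%N ->
    c * ((nn r k)%:R / b) * rho mu r b k `^ (- kappa) <= p b k) ->
  (limf_esup (relative_moment X mu r p g) (pinfty_nbhs R) < +oo)%E.
Proof.
move=> g0 kappa0 ineq c_gt0 pmf plow.
have [al1 al2] : 1 < alpha /\ alpha <= 3 / 2 by split.
have [K K0 bound] := Z_moment_bound mu0 r1 alpha1 Fbar_gt0 Fbar_potter
  tilt_controlled g0 kappa0 ineq c_gt0 pmf plow.
have [c0 c01 lower] := passage_prob_lower indep idist X1 mu0.
have [|||x0 [C [x01 C1 pot]]] := @Fbar_potter 1 2; [lra|lra|lra|].
set c' := (8 * C * c0 `^ 2)^-1.
have c0_gt0 : 0 < c0 by lra.
have c'0 : 0 < c'.
  have h : 0 < c0 `^ 2 by exact: powR_gt0.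
  by rewrite /c' invr_gt0; apply: mulr_gt0 => //; lra.
apply: (@limf_esup_lty R _ (K * (c' `^ (1 + g))^-1)).
near=> b.
have b1 : 1 <= b by near: b; apply: nbhs_pinfty_ge; rewrite num_real.
have bx : x0 <= b by near: b; apply: nbhs_pinfty_ge; rewrite num_real.
have b0 : 0 < b by lra.
have Fb : 0 < Fbar F b by exact: Fbar_gt0.
have pp : c' * (b * Fbar F b) <= passage_prob X mu b.
  apply: le_trans (lower _ b1).
  have bcb : b <= c0 * b by rewrite ler_peMl// ltW.
  have [_ up] := pot b (c0 * b) bx bcb.
  rewrite (_ : c0 * b / b = c0) in up; last by field; rewrite gt_eqF.
  rewrite /c' mulrC ler_pdivrMr; last by rewrite -invr_gt0.
  apply: le_trans (_ : b * (C * c0 `^ 2 * Fbar F (c0 * b)) <= _).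
    by rewrite ler_pM2l.
  by rewrite le_eqVlt; apply/orP; left; apply/eqP; field.
have bF0 : 0 < b * Fbar F b by exact: mulr_gt0.
have g10 : 0 <= 1 + g by lra.
have pg : (c' `^ (1 + g)) * (b * Fbar F b) `^ (1 + g) <=
    passage_prob X mu b `^ (1 + g).
  have cb0 : 0 <= c' * (b * Fbar F b) by apply: mulr_ge0; exact: ltW.
  rewrite -powRM ?(ltW bF0) ?(ltW c'0)//; apply: ge0_ler_powR => //.
  by rewrite nnegrE; exact: le_trans pp.
have h1 : 0 < c' `^ (1 + g) by exact: powR_gt0.
have h2 : 0 < (b * Fbar F b) `^ (1 + g) by exact: powR_gt0.
have h3 : 0 < passage_prob X mu b `^ (1 + g).
  by apply: lt_le_trans pg; exact: mulr_gt0.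
rewrite /relative_moment.
apply: (@le_trans _ _ ((K * (b * Fbar F b) `^ (1 + g))%:E *
    ((passage_prob X mu b `^ (1 + g))^-1)%:E)%E).
  apply: lee_wpmul2r; first by rewrite lee_fin invr_ge0 ltW.
  by near: b.
rewrite -EFinM lee_fin ler_pdivrMr// -mulrA ler_pM2l// ler_pdivlMl//.
Unshelve. all: by end_near.
Qed.

Lemma tail_moment_bound : exists2 m1 : R, 0 < m1 &
  forall x : R, 0 < x -> x * Fbar F x <= m1.
Proof.
have [m m0 abs1] := law_abs X1.
exists (m + 1) => [|x x0]; first by rewrite ltr_wpDl.
by apply: (le_trans (Fbar_markov abs1 x0)); rewrite lerDl.
Qed.

Lemma log_selection_efficient :
  [/\ forall b, 0 < b -> is_pmf (log_selection mu r b),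
      \forall b \near +oo, unbiased_estimator X mu r (log_selection mu r) b,
      forall gamma, 0 < gamma < (alpha - 1) / (2 - alpha) ->
        (limf_esup (relative_moment X mu r (log_selection mu r) gamma)
           (pinfty_nbhs R) < +oo)%E
    & exists C : R, \forall b \near +oo,
        (expected_nu X mu r (log_selection mu r) b <= (C * b)%:E)%E].
Proof.
have [al1 al2] : 1 < alpha /\ alpha <= 3 / 2 by split.
have pmf (b : R) : 0 < b -> is_pmf (log_selection mu r b).
  exact: log_selection_pmf.
split => //; first exact: unbiased.
- move=> g /andP[g0 glt].
  have E0 : 0 < alpha * (1 + g) - 2 * g - 1.
    by move: glt; rewrite ltr_pdivlMr; lra.
  (* The surplus of alpha (1 + g) - 2 g over 1 is split between the logarithm,
     kappa = 2 + 2 eta, and the strict inequality required. *)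
  set eta := (alpha * (1 + g) - 2 * g - 1) / (4 * g).
  have eta0 : 0 < eta by apply: divr_gt0 => //; lra.
  set c := mu / 2 / (1 + level_cst mu r * mu) / (1 + eta^-1) ^+ 2.
  have lc := level_cst_gt0 mu0 r1.
  have c_gt0 : 0 < c.
    have h1 : 0 < 1 + level_cst mu r * mu by apply: addr_gt0 => //; exact: mulr_gt0.
    have h2 : 0 < 1 + eta^-1 by rewrite addr_gt0 ?invr_gt0.
    by apply: divr_gt0; [apply: divr_gt0 => //; exact: divr_gt0|exact: exprn_gt0].
  apply: (@relative_moment_lty _ (2 + 2 * eta) g c) => //.
  + lra.
  + rewrite (_ : g * (2 + 2 * eta) =
      2 * g + (alpha * (1 + g) - 2 * g - 1) / 2); first lra.
    by rewrite /eta; field; rewrite gt_eqF.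
  + by exists 1; split; [exact: num_real|move=> b /ltW b1 k k0; exact: log_selection_ge].
- exists (2 * level_cst mu r); near=> b.
  have b1 : 1 <= b by near: b; apply: nbhs_pinfty_ge; rewrite num_real.
  have b0 : 0 < b by lra.
  rewrite /expected_nu (mean_nu _ _ _ _ (pmf _ b0)).
  exact: log_selection_nu.
Unshelve. all: by end_near.
Qed.

Lemma power_selection_efficient (gamma beta : R) :
  0 < gamma < (alpha - 1) / (2 - alpha) ->
  2 < beta < alpha + gamma^-1 * (alpha - 1) ->
  let p := selection F mu r alpha beta in
  [/\ forall b, 0 < b -> is_pmf (p b),
      \forall b \near +oo, unbiased_estimator X mu r p b,
      (limf_esup (relative_moment X mu r p gamma) (pinfty_nbhs R) < +oo)%E
    & exists C : R, \forall b \near +oo,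
        (expected_nu X mu r p b <= (C * b)%:E)%E].
Proof.
move=> /andP[g0 glt] /andP[beta2 blt] p.
have [al1 al2] : 1 < alpha /\ alpha <= 3 / 2 by split.
have ab : alpha < beta by lra.
have [m1 m10 Fm1] := tail_moment_bound.
have pmf (b : R) : 0 < b -> is_pmf (p b).
  exact: (power_selection_pmf mu0 r1 ab m10 Fbar_gt0 Fm1).
split => //; first exact: unbiased.
- set E := alpha * (1 + gamma) - gamma * beta - 1.
  have E0 : 0 < E.
    have : gamma * beta < gamma * (alpha + gamma^-1 * (alpha - 1)).
      by rewrite ltr_pM2l.
    by rewrite mulrDr mulrA mulfV ?gt_eqF// mul1r /E; lra.
  (* Half of the surplus E is spent on s > alpha in the lower Potter bound. *)
  set s := alpha + E / (2 * gamma).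
  have sa : alpha < s by rewrite /s ltrDl divr_gt0//; lra.
  have [c c_gt0 low] := power_selection_ge mu0 r1 alpha1 ab beta2 m10 Fbar_gt0
    Fm1 Fbar_potter sa.
  apply: (@relative_moment_lty _ (s + beta - alpha) gamma c) => //; first lra.
  rewrite (_ : gamma * (s + beta - alpha) = gamma * beta + E / 2).
    by move: E0; rewrite /E; lra.
  by rewrite /s; field; rewrite gt_eqF.
- have [C nuC] := power_selection_nu mu0 r1 alpha1 ab beta2 m10 Fbar_gt0 Fm1
    Fbar_potter.
  exists C; near=> b.
  have b0 : 0 < b by near: b; apply: nbhs_pinfty_gt; rewrite num_real.
  rewrite /expected_nu (mean_nu _ _ _ _ (pmf _ b0)).
  by near: b.
Unshelve. all: by end_near.
Qed.

End strong_efficiency.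

Unset Implicit Arguments.

Theorem theorem6 (R : realType) (d : measure_display) (T : measurableType d)
    (P : probability T R) (X : nat -> {RV P >-> R})
    (mu : R) (r : nat) (alpha : R) (L : R -> R) :
  mutually_independent X ->
  identically_distributed X ->
  P.-integrable [set: T] (EFin \o X 0%N) ->
  ('E_P[X 0%N] = 0)%E ->
  0 < mu ->
  (1 < r)%N ->
  1 < alpha <= 3 / 2 ->
  let F := distribution P (X 0%N) in
  (forall x, 0 < x -> Fbar F x = x `^ (- alpha) * L x) ->
  slowly_varying L ->
  (('V_P[X 0%N] = +oo)%E ->
    (limf_esup (fun x : R => (fine (F `]-oo, - x[%classic) / Fbar F x)%:E)
      (pinfty_nbhs R) < +oo)%E) ->
  (exists2 t0 : R, 0 < t0 &
    (forall x, t0 <= x -> derivable L x 1) /\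
    {within `[t0, +oo[, continuous derive1 L}) ->
  derive1 L =o_ (FilterType (pinfty_nbhs R) _) (fun x => L x / x) ->
  (exists p : R -> nat -> R,
    [/\ forall b, 0 < b -> is_pmf (p b),
        \forall b \near +oo, unbiased_estimator X mu r p b,
        forall gamma, 0 < gamma < (alpha - 1) / (2 - alpha) ->
          (limf_esup (relative_moment X mu r p gamma) (pinfty_nbhs R)
             < +oo)%E
      & exists C : R, \forall b \near +oo,
          (expected_nu X mu r p b <= (C * b)%:E)%E]) /\
  (forall gamma beta : R,
    0 < gamma < (alpha - 1) / (2 - alpha) ->
    2 < beta < alpha + gamma^-1 * (alpha - 1) ->
    let p := selection F mu r alpha beta in
    [/\ forall b, 0 < b -> is_pmf (p b),
        \forall b \near +oo, unbiased_estimator X mu r p b,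
        (limf_esup (relative_moment X mu r p gamma) (pinfty_nbhs R)
           < +oo)%E
      & exists C : R, \forall b \near +oo,
          (expected_nu X mu r p b <= (C * b)%:E)%E]).
Proof.
move=> indep idist X1 EX mu0 r1 /andP[alpha1 alpha32] F FbarL svL left_tail.
move=> [t0 t00 [dLt _]] _.
have dL : exists2 t0 : R, 0 < t0 & forall x, t0 <= x -> derivable L x 1.
  by exists t0.
split; first by exists (log_selection mu r);
  exact: (log_selection_efficient _ _ _ _ _ _ _ _ FbarL).
by move=> gamma beta; exact: (power_selection_efficient _ _ _ _ _ _ _ _ FbarL).
Qed.
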